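(* Let $n\ge 3$, $2\le k\le n$, let $\Omega\subset\mathbb{R}^n$ be a domain and let $B_\varepsilon\Subset\Omega$ be a ball. Suppose that $w$ is a positive continuous viscosity solution on $\Omega$ to $$\sigma_k(\lambda(-A_w))=1,\qquad \lambda(-A_w)\in\Gamma_k^+ \quad\text{in }\Omega,$$ and that $w$ has a hypersurface $\Sigma$ of singular points in $B_\varepsilon$. Let $w_0=w|_{\Sigma\cap B_\varepsilon}$ and, for $\alpha\in\mathbb{R}$, at each point of $\Sigma\cap B_\varepsilon$ let $$T_\alpha=-w_0\big(\nabla_\Sigma^2 w_0-\alpha\,\mathrm{II}_\Sigma\big)+\tfrac12\big(|\nabla_\Sigma w_0|^2+\alpha^2\big)g_\Sigma .$$ Then at every point of $\Sigma\cap B_\varepsilon$, for both $\alpha=\nabla_\nu w^+$ and $\alpha=\nabla_\nu w^-$ (evaluated at that point), $$\lambda\big(g_\Sigma^{-1}T_\alpha\big)\in\partial\Gamma_{k-1}^+ .$$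
   Context: For a positive $C^2$ function $w$ on an open subset of $\mathbb{R}^n$, $A_w=w\nabla^2w-\frac12|\nabla w|^2I$ (Euclidean Hessian and gradient). $\lambda(M)$ is the vector of eigenvalues of $M$; $\sigma_j$ is the $j$-th elementary symmetric polynomial; $\Gamma_k^+=\{\lambda\in\mathbb{R}^n:\sigma_j(\lambda)>0,\ 1\le j\le k\}$. In $\lambda(g_\Sigma^{-1}T_\alpha)\in\partial\Gamma_{k-1}^+$, the cone is the analogous one in $\mathbb{R}^{n-1}$, $\Gamma_{k-1}^+=\{\lambda\in\mathbb{R}^{n-1}:\sigma_j(\lambda)>0,\ 1\le j\le k-1\}$, and $\partial$ is its topological boundary. Viscosity solution of $\sigma_k(\lambda(-A_w))=1$, $\lambda(-A_w)\in\Gamma_k^+$: a continuous positive $w$ such that (supersolution) whenever $\xi$ is a positive $C^2$ function near $x_0$ with $\xi\le w$ near $x_0$ and $\xi(x_0)=w(x_0)$, then $\lambda(-A_\xi(x_0))\in\Gamma_k^+$ and $\sigma_k(\lambda(-A_\xi(x_0)))\ge1$; and (subsolution) whenever $\xi\in C^2$ satisfies $\xi\ge w$ near $x_0$ and $\xi(x_0)=w(x_0)$, then either $\lambda(-A_\xi(x_0))\in\mathbb{R}^n\setminus\Gamma_k^+$ or $\sigma_k(\lambda(-A_\xi(x_0)))\le1$. Hypersurface of singular points: a positive continuous function $w$ on a domain $\Omega$, with $B_\varepsilon\Subset\Omega$ a ball, has a hypersurface $\Sigma$ of singular points in $B_\varepsilon$ if $\Sigma\subset\mathbb{R}^n$ is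 a smooth hypersurface and: (1) $B_\varepsilon\setminus\Sigma=B_\varepsilon^+\cup B_\varepsilon^-$ with $B_\varepsilon^\pm$ non-empty, disjoint, open and connected (in particular $\Sigma\cap B_\varepsilon\neq\emptyset$); (2) $w\in C^{0,1}(\overline{B_\varepsilon})\cap C^1(\overline{B_\varepsilon^\pm})\cap C^2_{\rm loc}(B_\varepsilon^\pm)$ but $w\notin C^1(U)$ for any open $U\subseteq B_\varepsilon$ with $U\cap\Sigma\ne\emptyset$; (3) $w|_{\Sigma\cap B_\varepsilon}\in C^2(\Sigma\cap B_\varepsilon)$. Convention: given $x_0\in\Sigma\cap B_\varepsilon$, after decreasing $\varepsilon$ and choosing Cartesian coordinates $(x',x_n)$ with $x_0=(0',0)$ and $\{x_n=0\}$ the tangent hyperplane of $\Sigma$ at $x_0$, $\Sigma\cap B_\varepsilon$ is a graph $x_n=\phi(x')$ and $B_\varepsilon^\pm=\{(x',x_n)\in B_\varepsilon: x_n\gtrless\phi(x')\}$. $\nu$ is the unit normal to $\Sigma$ pointing into $B_\varepsilon^+$, $w^\pm=w|_{B_\varepsilon^\pm}$, and $\nabla_\nu w^\pm$ are the one-sided derivatives on $\Sigma$ in direction $\nu$. $g_\Sigma$ is the metric on $\Sigma$ induced by the Euclidean metric, $\nabla_\Sigma$ and $\nabla_\Sigma^2$ are the gradient and Hessian with respect to $g_\Sigma$, and $\mathrm{II}_\Sigma$ is the Euclidean second fundamental form with respect to $\nu$, with sign convention that at $x_0$, in Cartesian coordinates $(x',x_n)$ with $x_0=(0',0)$, $\{x_n=0\}$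 the tangent hyperplane of $\Sigma$ at $x_0$, $\Sigma$ given near $x_0$ by the graph $x_n=\phi(x')$ and $B_\varepsilon^+$ lying on the side $x_n>\phi(x')$, one has $(\mathrm{II}_\Sigma)_{ab}=\partial_{ab}\phi(0')$ for $1\le a,b\le n-1$ (so a round sphere has negative definite $\mathrm{II}$ with respect to the outward normal). *)

(* Defs.v *)
From HB Require Import structures.
From mathcomp Require Import all_boot all_order all_algebra.
From mathcomp Require Import all_classical all_reals all_analysis.

Set Implicit Arguments.
Unset Strict Implicit.
Unset Printing Implicit Defensive.

Import Order.TTheory GRing.Theory Num.Theory.
Import numFieldNormedType.Exports.

Local Open Scope classical_set_scope.
Local Open Scope ring_scope.

(* Points of R^n are row vectors. The library norm on 'rV[R]_n is the sup norm;
   it gives the usual topology and differentiability, but Euclidean lengths and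
   balls have to be introduced separately. *)
Definition dotp (R : realType) (n : nat) (u v : 'rV[R]_n) : R :=
  \sum_i u 0 i * v 0 i.

Definition enorm (R : realType) (n : nat) (u : 'rV[R]_n) : R :=
  Num.sqrt (dotp u u).

Definition eball (R : realType) (n : nat) (c : 'rV[R]_n) (r : R) :
    set 'rV[R]_n :=
  [set x | enorm (x - c) < r].

Definition boundary (T : topologicalType) (A : set T) : set T :=
  closure A `\` interior A.

Definition partial (R : realType) (n : nat) (W : normedModType R) (i : 'I_n)
    (f : 'rV[R]_n -> W) : 'rV[R]_n -> W :=
  fun x => 'D_(delta_mx 0 i) f x.

Definition grad (R : realType) (n : nat) (f : 'rV[R]_n -> R) (x : 'rV[R]_n) :
    'rV[R]_n :=
  \row_i partial i f x.

Definition hess (R : realType) (n : nat) (f : 'rV[R]_n -> R) (x : 'rV[R]_n) :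
    'M[R]_n :=
  \matrix_(i, j) partial i (partial j f) x.

(* f is of class C^k on D; only meaningful for open D. *)
Fixpoint Ck (R : realType) (n k : nat) (D : set 'rV[R]_n)
    (f : 'rV[R]_n -> R) : Prop :=
  match k with
  | 0 => forall x, D x -> {for x, continuous f}
  | k'.+1 => (forall x, D x -> differentiable f x) /\
             forall i, Ck k' D (partial i f)
  end.

Definition smooth (R : realType) (n : nat) (D : set 'rV[R]_n)
    (f : 'rV[R]_n -> R) : Prop :=
  forall k, Ck k D f.

(* f|_D is C^1 up to the boundary: f and its gradient on the open set D extend
   continuously to the closure (f being already defined there). *)
Definition C1_closure (R : realType) (n : nat) (D : set 'rV[R]_n)
    (f : 'rV[R]_n -> R) : Prop :=
  [/\ Ck 1 D f, {within closure D, continuous f} &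
      exists G : 'rV[R]_n -> 'rV[R]_n,
        {within closure D, continuous G} /\ forall x, D x -> G x = grad f x].

(* The vector of eigenvalues with algebraic multiplicity, in an unspecified
   order (the junk value 0 if M does not have n real eigenvalues). It is only
   used inside permutation-invariant sets and functions. *)
Definition eigvals (R : realType) (n : nat) (M : 'M[R]_n) : 'rV[R]_n :=
  xget 0 [set l : 'rV[R]_n | char_poly M = \prod_i ('X - (l 0 i)%:P)].

Definition sigma (R : realType) (n j : nat) (l : 'rV[R]_n) : R :=
  \sum_(I : {set 'I_n} | #|I| == j) \prod_(i in I) l 0 i.

Definition Gamma (R : realType) (n k : nat) : set 'rV[R]_n :=
  [set l | forall j, (1 <= j <= k)%N -> 0 < sigma j l].

Definition Amx (R : realType) (n : nat) (w : 'rV[R]_n -> R) (x : 'rV[R]_n) :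
    'M[R]_n :=
  w x *: hess w x - (2^-1 * enorm (grad w x) ^+ 2)%:M.

Definition C2_near (R : realType) (n : nat) (x : 'rV[R]_n)
    (f : 'rV[R]_n -> R) : Prop :=
  exists U : set 'rV[R]_n, [/\ open U, U x & Ck 2 U f].

Definition viscosity_supersolution (R : realType) (n k : nat)
    (Omega : set 'rV[R]_n) (w : 'rV[R]_n -> R) : Prop :=
  forall (x0 : 'rV[R]_n) (xi : 'rV[R]_n -> R), Omega x0 ->
    C2_near x0 xi ->
    (\forall x \near x0, 0 < xi x) ->
    (\forall x \near x0, xi x <= w x) ->
    xi x0 = w x0 ->
    @Gamma R n k (eigvals (- Amx xi x0)) /\
    1 <= sigma k (eigvals (- Amx xi x0)).

Definition viscosity_subsolution (R : realType) (n k : nat)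
    (Omega : set 'rV[R]_n) (w : 'rV[R]_n -> R) : Prop :=
  forall (x0 : 'rV[R]_n) (xi : 'rV[R]_n -> R), Omega x0 ->
    C2_near x0 xi ->
    (\forall x \near x0, w x <= xi x) ->
    xi x0 = w x0 ->
    ~ @Gamma R n k (eigvals (- Amx xi x0)) \/
    sigma k (eigvals (- Amx xi x0)) <= 1.

Definition viscosity_solution (R : realType) (n k : nat)
    (Omega : set 'rV[R]_n) (w : 'rV[R]_n -> R) : Prop :=
  [/\ forall x, Omega x -> {for x, continuous w},
      forall x, Omega x -> 0 < w x,
      viscosity_supersolution k Omega w &
      viscosity_subsolution k Omega w].

(* Cartesian coordinates x' = x *m gc_frame^T and x_n = dotp x gc_dir, together
   with a function gc_fun of x', defined on gc_base, whose graph
   x_n = gc_fun x' describes a hypersurface inside gc_dom. *)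
Record graph_chart (R : realType) (n : nat) := GraphChart {
  gc_frame : 'M[R]_(n.-1, n);
  gc_dir : 'rV[R]_n;
  gc_dom : set 'rV[R]_n;
  gc_base : set 'rV[R]_n.-1;
  gc_fun : 'rV[R]_n.-1 -> R }.

Definition gc_coord (R : realType) (n : nat) (c : graph_chart R n)
    (x : 'rV[R]_n) : 'rV[R]_n.-1 :=
  x *m (gc_frame c)^T.

Definition gc_param (R : realType) (n : nat) (c : graph_chart R n)
    (y : 'rV[R]_n.-1) : 'rV[R]_n :=
  y *m gc_frame c + gc_fun c y *: gc_dir c.

Definition is_graph_chart (R : realType) (n : nat) (Sigma : set 'rV[R]_n)
    (c : graph_chart R n) : Prop :=
  [/\ [/\ gc_frame c *m (gc_frame c)^T = 1%:M,
          gc_frame c *m (gc_dir c)^T = 0 &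
          enorm (gc_dir c) = 1],
      open (gc_dom c) /\ open (gc_base c),
      forall x, gc_dom c x -> gc_base c (gc_coord c x),
      smooth (gc_base c) (gc_fun c) &
      forall x, gc_dom c x ->
        (Sigma x <-> dotp x (gc_dir c) = gc_fun c (gc_coord c x))].

Definition smooth_hypersurface (R : realType) (n : nat)
    (Sigma : set 'rV[R]_n) : Prop :=
  forall x, Sigma x -> exists c, is_graph_chart Sigma c /\ gc_dom c x.

(* The restriction of f to the part of Sigma in the open set B is C^2: it is so
   in every graph chart of Sigma. *)
Definition C2_on_hypersurface (R : realType) (n : nat) (Sigma B : set 'rV[R]_n)
    (f : 'rV[R]_n -> R) : Prop :=
  forall c, is_graph_chart Sigma c ->
    Ck 2 [set y | gc_base c y /\ (gc_dom c `&` B) (gc_param c y)]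
         (f \o gc_param c).

Definition singular_hypersurface (R : realType) (n : nat)
    (w : 'rV[R]_n -> R) (B Sigma Bp Bm : set 'rV[R]_n) : Prop :=
  [/\ smooth_hypersurface Sigma,
      [/\ B `\` Sigma = Bp `|` Bm,
          Bp !=set0 /\ Bm !=set0,
          Bp `&` Bm = set0,
          open Bp /\ open Bm &
          connected Bp /\ connected Bm],
      [/\ [lipschitz w x | x in closure B],
          C1_closure Bp w /\ C1_closure Bm w,
          Ck 2 Bp w /\ Ck 2 Bm w &
          forall U : set 'rV[R]_n, open U -> U `<=` B ->
            U `&` Sigma !=set0 -> ~ Ck 1 U w] &
      C2_on_hypersurface Sigma B w].

(* Riemannian quantities of an immersion psi, expressed in the coordinate frame
   at y: the induced metric, its Christoffel symbols Gamma^c_(ab), the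
   covariant Hessian and squared gradient of a function f of the coordinates,
   and the second fundamental form with respect to the unit normal nu. *)
Definition metric (R : realType) (m n : nat) (psi : 'rV[R]_m -> 'rV[R]_n)
    (y : 'rV[R]_m) : 'M[R]_m :=
  \matrix_(a, b) dotp (partial a psi y) (partial b psi y).

Definition christoffel (R : realType) (m n : nat)
    (psi : 'rV[R]_m -> 'rV[R]_n) (y : 'rV[R]_m) (c a b : 'I_m) : R :=
  2^-1 * \sum_d invmx (metric psi y) c d *
    (partial a (fun z => metric psi z b d) y
     + partial b (fun z => metric psi z a d) y
     - partial d (fun z => metric psi z a b) y).

Definition cov_hess (R : realType) (m n : nat) (psi : 'rV[R]_m -> 'rV[R]_n)
    (f : 'rV[R]_m -> R) (y : 'rV[R]_m) : 'M[R]_m :=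
  \matrix_(a, b) (partial a (partial b f) y
                  - \sum_c christoffel psi y c a b * partial c f y).

Definition grad_sqnorm (R : realType) (m n : nat)
    (psi : 'rV[R]_m -> 'rV[R]_n) (f : 'rV[R]_m -> R) (y : 'rV[R]_m) : R :=
  \sum_a \sum_b invmx (metric psi y) a b * partial a f y * partial b f y.

Definition second_form (R : realType) (m n : nat)
    (psi : 'rV[R]_m -> 'rV[R]_n) (nu : 'rV[R]_n) (y : 'rV[R]_m) : 'M[R]_m :=
  \matrix_(a, b) dotp nu (partial a (partial b psi) y).

Definition Tmx (R : realType) (m n : nat) (psi : 'rV[R]_m -> 'rV[R]_n)
    (nu : 'rV[R]_n) (w0 : 'rV[R]_m -> R) (alpha : R) (y : 'rV[R]_m) :
    'M[R]_m :=
  - (w0 y *: (cov_hess psi w0 y - alpha *: second_form psi nu y))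
  + (2^-1 * (grad_sqnorm psi w0 y + alpha ^+ 2)) *: metric psi y.

Definition inward_unit_normal (R : realType) (m n : nat)
    (psi : 'rV[R]_m -> 'rV[R]_n) (Bp : set 'rV[R]_n) (y : 'rV[R]_m)
    (nu : 'rV[R]_n) : Prop :=
  [/\ enorm nu = 1,
      forall a, dotp nu (partial a psi y) = 0 &
      \forall t \near (0 : R)^'+, Bp (psi y + t *: nu)].

(* One-sided derivatives at x in direction nu, from the side nu points into and
   from the opposite side; the latter is also taken along +nu. *)
Definition deriv_plus (R : realType) (n : nat) (w : 'rV[R]_n -> R)
    (x nu : 'rV[R]_n) : R :=
  lim ((t^-1 * (w (x + t *: nu) - w x)) @[t --> (0 : R)^'+]).

Definition deriv_minus (R : realType) (n : nat) (w : 'rV[R]_n -> R)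
    (x nu : 'rV[R]_n) : R :=
  lim ((t^-1 * (w (x + t *: nu) - w x)) @[t --> (0 : R)^'-]).

(* Main.v *)
Require Import Defs.
From HB Require Import structures.
From mathcomp Require Import all_boot all_order all_algebra all_fingroup.
From mathcomp Require Import all_classical all_reals all_analysis.
From mathcomp Require Import ring lra zify.
From mathcomp Require Import complex.
Import Order.TTheory GRing.Theory Num.Theory.
Import numFieldNormedType.Exports.
Local Open Scope classical_set_scope.
Local Open Scope ring_scope.

Set Implicit Arguments.
Unset Strict Implicit.
Unset Printing Implicit Defensive.

(* Near a point of the hypersurface S, [w] has one-sided gradients with the same
   tangential part [grad_S w0] and normal derivatives [a+], [a-].  If [a+ > a-],
   then [w] is touched from below by functions with arbitrarily large second
   normal derivative, and the trace of [- Amx] becomes negative; so [a+ <= a-].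
   If [a+ < a < a-], then [w] is touched from above by functions with normal
   derivative [a] and arbitrarily negative second normal derivative, for which
   [sigma_j (- Amx) = C * sigma_(j-1) T_a + O(1)] with [C] as large as we like;
   hence [T_a] is not in [Gamma_(k-1)].  Points with [a+ < a-] are dense in S,
   since otherwise [w] would be C^1 somewhere on S, so [T_(a+)] and [T_(a-)]
   avoid the open cone everywhere.  Conversely, minimising [w] minus
   [w0 + a+ s - K (s - h)^2 - del |p - x|^2], where [s] is the height over S and
   [K h] is small, gives test functions touching [w] from below off S, at points
   tending to [x]; the tangential block of their [- Amx], which is a compression
   of a matrix in [Gamma_k], tends to [T_(a+)], and compressions of [Gamma_k] to
   a hyperplane lie in [Gamma_(k-1)] by Newton's inequalities. *)

(** * Newton's inequalities for real-rooted polynomials *)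

(** The solution is only C^1 up to S, so the equation has no limit there; and where [a+ < a-] no C^2
    function touches from below on S. Hence the lower bound on [T] needs contact points off S. There
    the penalty weight [K] is not controlled, but apart from the slope it enters the Hessian only
    through the square of the conormal, and so it disappears from the tangential block, the one part
    of [- Amx] that converges. The limit is T_(a+) because the Euclidean Hessian on tangent vectors
    equals [nabla_S^2 w0 - a II]. One identity drives both halves: [sigma_(j+1) (N + t v^T v)] is
    affine in [t], with slope [sigma_j] of the compression of [N] to the hyperplane orthogonal to
    the unit vector [v]. Large positive [t] gives the obstruction from above; negative [t], with
    Newton's inequalities, gives the passage from Gamma_k to Gamma_(k-1). The side of [a-] is
    treated by reversing the direction of the graph chart. Where [a+ = a-] there is no slope
    strictly in between, hence the recourse to nearby points. *)

Section RealRooted.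
Variable R : rcfType.
Implicit Types (p q : {poly R}) (r : seq R).

(** The zero polynomial splits as well, so iterated derivatives need no degree condition. *)
Definition splits p := exists r, p = lead_coef p *: \prod_(x <- r) ('X - x%:P).

Local Notation C := (complex R).
Local Notation toC := (real_complex R).
Local Notation Re := complex.Re.
Local Notation Im := complex.Im.

Lemma splits_of_real_roots p :
  (forall z : C, root (map_poly toC p) z -> Im z = 0) -> splits p.
Proof.
move=> hr; have [rs hrs] := closed_field_poly_normal (map_poly toC p).
have [p0|pN0] := eqVneq p 0.
  by exists [::]; rewrite p0 lead_coef0 scale0r.
have lN0 : lead_coef (map_poly toC p) != 0.
  by rewrite lead_coef_eq0 map_poly_eq0.
exists [seq Re z | z <- rs]; apply: (@map_poly_inj _ _ toC).
rewrite {1}hrs lead_coef_map map_polyZ; congr (_ *: _).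
rewrite big_map rmorph_prod /= !big_seq; apply: eq_bigr => z zrs.
rewrite rmorphB /= map_polyX map_polyC /=; congr (_ - _%:P).
have : Im z = 0.
  by apply: hr; rewrite hrs rootZ // root_prod_XsubC.
by case: z {zrs} => a b /= ->.
Qed.

(* For [z] off the real line, [Im (P'(z) * conj (P z))] has the sign of [- Im z]:
   it is [- Im z * |P z|^2 * \sum 1 / |z - x|^2]. *)
Lemma Im_deriv_conj_prod r (z : C) (P := map_poly toC (\prod_(x <- r) ('X - x%:P))) :
  Im z != 0 ->
  [/\ P.[z] != 0, Im z * Im (P^`().[z] * conjc P.[z]) <= 0 &
   r != [::] -> Im z * Im (P^`().[z] * conjc P.[z]) < 0].
Proof.
move=> zI; rewrite {}/P; elim: r => [|x r [IH1 IH2 _]].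
  by rewrite big_nil rmorph1 -polyC1 derivC !hornerC mul0r /= mulr0 lexx oner_eq0.
rewrite big_cons rmorphM /=; set G := map_poly toC _ in IH1 IH2 *.
rewrite rmorphB /= map_polyX map_polyC /= derivM derivB derivX derivC subr0 mul1r.
rewrite hornerD !hornerM hornerD hornerX hornerN hornerC.
have zx : z - toC x != 0.
  by rewrite subr_eq0; apply: contraNneq zI => ->.
have lt0 : Im z * Im ((G.[z] + (z - toC x) * G^`().[z]) *
    conjc ((z - toC x) * G.[z])) < 0.
  move: IH1 IH2 zI zx; case: G.[z] => [g1 g2]; case: G^`().[z] => [d1 d2].
  case: z => [a b]; rewrite eq_complex /= negb_and => g12 h b0 _.
  set e := (X in X < 0).
  (* The new factor contributes [- (Im z)^2 |G z|^2], and the expression for [G] gets multiplied by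
     [|z - x|^2]. *)
  have -> : e = - b ^+ 2 * (g1 ^+ 2 + g2 ^+ 2) +
     ((a - x) ^+ 2 + b ^+ 2) * (b * (d1 * - g2 + d2 * g1)).
    by rewrite /e; ring.
  have b2 : 0 < b ^+ 2 by rewrite exprn_even_gt0 //= b0.
  have g2' : 0 < g1 ^+ 2 + g2 ^+ 2.
    have g1_ge0 := sqr_ge0 g1; have g2_ge0 := sqr_ge0 g2.
    by case/orP: g12; rewrite -sqrf_eq0 => g0; lra.
  have s2 : 0 <= (a - x) ^+ 2 + b ^+ 2 by rewrite addr_ge0 ?sqr_ge0.
  have : 0 < b ^+ 2 * (g1 ^+ 2 + g2 ^+ 2) by rewrite mulr_gt0.
  have := mulr_ge0_le0 s2 h; rewrite mulNr; lra.
split=> //; last exact: ltW.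
by rewrite mulf_neq0.
Qed.

(** At a non-real root of the derivative the quantity [Im (P'(z) * conj (P z))] would vanish,
    against its strict sign. This avoids counting multiple roots as Rolle's theorem would
    require. *)
Lemma splits_deriv p : splits p -> splits p^`().
Proof.
case=> r hr; have [p0|pN0] := eqVneq p^`() 0.
  by exists [::]; rewrite p0 lead_coef0 scale0r.
apply: splits_of_real_roots => z /rootP; rewrite -deriv_map hr linearZ /= derivZ.
have lN0 : lead_coef p != 0.
  by rewrite lead_coef_eq0; apply: contraNneq pN0 => ->; rewrite deriv0.
rewrite hornerZ => /eqP; rewrite mulf_eq0 => /orP[|/eqP h].
  by rewrite (_ : 0 = toC 0) // (inj_eq (@complexI _)) (negPf lN0).
have [//|zI] := eqVneq (Im z) 0.
case: (Im_deriv_conj_prod r zI) => _ _; rewrite h mul0r mulr0 ltxx => {}h.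
have r0 : r = [::] by case: (r) h => // x s /(_ isT).
by move: pN0; rewrite hr r0 big_nil derivZ derivC scaler0 eqxx.
Qed.

Lemma splits_derivn p n : splits p -> splits p^`(n).
Proof. by move=> ps; elim: n => // n IHn; rewrite derivnS; exact: splits_deriv. Qed.

(** Away from the roots this says that [(P'/P)' = - \sum 1 / (x - y)^2] is nonpositive; the
    induction on the roots is the division-free form of it. *)
Lemma laguerre_ineq p x : splits p -> p.[x] * p^`(2).[x] <= p^`().[x] ^+ 2.
Proof.
case=> r ->; set a := lead_coef p.
suff h : (\prod_(y <- r) ('X - y%:P)).[x] * (\prod_(y <- r) ('X - y%:P))^`()^`().[x]
   <= (\prod_(y <- r) ('X - y%:P))^`().[x] ^+ 2.
  rewrite derivnS derivn1 !derivZ !hornerZ.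
  by rewrite mulrACA -expr2 exprMn ler_wpM2l // sqr_ge0.
elim: r => [|y r]; first by rewrite big_nil -polyC1 derivC deriv0 horner0 mulr0 sqr_ge0.
rewrite big_cons; set G := \prod_(_ <- _) _ => IH.
rewrite derivM derivB derivX derivC subr0 mul1r derivD derivM derivB derivX derivC.
rewrite subr0 mul1r !(hornerD, hornerM, hornerN, hornerX, hornerC).
set g := G.[x] in IH *; set g1 := G^`().[x] in IH *; set g2 := G^`()^`().[x] in IH *.
have := mulr_ge0 (sqr_ge0 (x - y)) (_ : 0 <= g1 ^+ 2 - g * g2).
rewrite subr_ge0 => /(_ IH); have := sqr_ge0 g => ? ?.
rewrite -subr_ge0; set e := (X in 0 <= X).
have -> : e = g ^+ 2 + (x - y) ^+ 2 * (g1 ^+ 2 - g * g2) by rewrite /e; ring.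
exact: addr_ge0.
Qed.

(** Laguerre's inequality at 0 for the [m]-th derivative: its value and its first two derivatives
    there are the coefficients of index [m], [m + 1], [m + 2], up to factorials. *)
Lemma newton_coef p m : splits p ->
  m.+2%:R * (p`_m * p`_m.+2) <= m.+1%:R * p`_m.+1 ^+ 2.
Proof.
move=> ps; have := laguerre_ineq 0 (splits_derivn m ps).
have h i : (p^`(m))^`(i).[0] = p`_(m + i) * (m + i)`!%:R.
  rewrite horner_coef0 !coef_derivn addn0 ffactnn -mulrnA mulr_natr.
  by rewrite -[in RHS](@ffact_fact (m + i) m) ?leq_addr // addKn.
have := h 0%N; have := h 1%N; have := h 2%N; rewrite derivn0 derivn1 => -> -> ->.
rewrite addn0 addn1 addn2 !factS !natrM.
set f := (m`!)%:R; have f0 : 0 < f :> R by rewrite ltr0n fact_gt0.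
set a := p`_m; set b := p`_m.+1; set c := p`_m.+2.
set k1 : R := m.+1%:R; set k2 : R := m.+2%:R.
have k0 : 0 < k1 by rewrite ltr0n.
move=> h'; rewrite -(ler_pM2l (_ : 0 < f ^+ 2 * k1)) ?mulr_gt0 ?exprn_gt0 //.
have -> : f ^+ 2 * k1 * (k2 * (a * c)) = a * f * (c * (k2 * (k1 * f))) by ring.
by have -> : f ^+ 2 * k1 * (k1 * b ^+ 2) = (b * (k1 * f)) ^+ 2 by ring.
Qed.

Lemma newton_coef_weak p m : splits p -> p`_m * p`_m.+2 <= p`_m.+1 ^+ 2.
Proof.
move=> ps; have [h|h] := lerP (p`_m * p`_m.+2) 0; first exact: le_trans (sqr_ge0 _).
have := newton_coef m ps; set k : R := m.+1%:R.
have -> : m.+2%:R = k + 1 :> R by rewrite -natr1.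
have k0 : 0 < k by rewrite ltr0n.
move=> h'; rewrite -(ler_pM2l k0); apply: le_trans h'.
by rewrite mulrDl mul1r lerDl ltW.
Qed.
End RealRooted.

(** * Elementary symmetric functions of symmetric matrices *)

(** The symmetric functions of the eigenvalues, read off the characteristic polynomial: polynomial
    in the entries, hence continuous, and independent of any choice of eigenvalues. Meaningful for
    [j <= n]. *)
Definition mxsigma (R : comNzRingType) (n j : nat) (M : 'M[R]_n) : R :=
  (-1) ^+ j * (char_poly M)`_(n - j).

Section SymmetricMatrices.
Variable R : realType.

Lemma coef_prod_addX_sigma n j (l : 'rV[R]_n) : (j <= n)%N ->
  (\prod_i ('X + (l 0 i)%:P))`_(n - j) = sigma j l.
Proof.
move=> jn.
under eq_bigr do rewrite addrC.
rewrite bigA_distr coef_sum /sigma big_mkcond [RHS]big_mkcond /=.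
apply: eq_bigr => I _.
rewrite (bigID (mem I)) /=.
rewrite (eq_bigr (fun i => (l 0 i)%:P)); last by move=> i ->.
rewrite [X in _ * X](eq_bigr (fun=> 'X)); last by move=> i /negPf ->.
rewrite -rmorph_prod /= prodr_const coefCM coefXn.
have In : (#|I| <= n)%N by have := max_card (mem I); rewrite card_ord.
have -> : #|[pred i | i \notin I]| = (n - #|I|)%N.
  by apply: (@addnI #|I|); rewrite subnKC //; exact: etrans (cardC _) (card_ord n).
have -> : ((n - j)%N == (n - #|I|)%N) = (#|I| == j).
  by apply/eqP/eqP; lia.
by case: eqP => _; rewrite ?mulr1 ?mulr0.
Qed.

Lemma sigma0 n (l : 'rV[R]_n) : sigma 0 l = 1.
Proof.
rewrite /sigma (big_pred1 finset.set0) ?big_set0 // => I /=.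
by rewrite cards_eq0.
Qed.

Lemma sigmaN n j (l : 'rV[R]_n) : sigma j (- l) = (-1) ^+ j * sigma j l.
Proof.
rewrite /sigma mulr_sumr; apply: eq_bigr => I /eqP <-.
by rewrite -prodrN; apply: eq_bigr => i _; rewrite mxE.
Qed.

Lemma coef_prod_sigma n j (l : 'rV[R]_n) : (j <= n)%N ->
  (\prod_i ('X - (l 0 i)%:P))`_(n - j) = (-1) ^+ j * sigma j l.
Proof.
move=> jn; rewrite -sigmaN -coef_prod_addX_sigma //.
rewrite (eq_bigr (fun i => 'X + ((- l) 0 i)%:P)) // => i _.
by rewrite mxE polyCN.
Qed.

(** The Hermitian argument in real coordinates: for an eigenvector [a + i b] with eigenvalue
    [x + i y], symmetry of [M] equates [a M b^T] with [b M a^T], which gives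
    [y (|a|^2 + |b|^2) = 0]. *)
Lemma sym_eigenvalue_real n (M : 'M[R]_n) (z : complex R) : M^T = M ->
  root (char_poly (map_mx (real_complex R) M)) z -> complex.Im z = 0.
Proof.
move=> Ms; rewrite -eigenvalue_root_char => /eigenvalueP[v vM v0].
pose a : 'rV[R]_n := map_mx (@complex.Re R) v.
pose b : 'rV[R]_n := map_mx (@complex.Im R) v.
case: z vM => x y vM /=.
have entry (f : complex R -> R) : (forall u w, f (u + w) = f u + f w) ->
    f 0 = 0 -> (forall u (t : R), f (u * real_complex R t) = f u * t) ->
    map_mx f v *m M = map_mx f (Complex x y *: v).
  move=> fD f0 fM; rewrite -vM; apply/matrixP => i j; rewrite !mxE.
  rewrite (big_morph f fD f0); apply: eq_bigr => k _.
  by rewrite !mxE fM.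
have aM : a *m M = x *: a - y *: b.
  rewrite /a entry //; last by move=> [? ?] t /=; ring.
    by apply/matrixP => i j; rewrite !mxE; case: (v i j).
  by move=> [? ?] [? ?].
have bM : b *m M = x *: b + y *: a.
  rewrite /b entry //; last by move=> [? ?] t /=; ring.
    by apply/matrixP => i j; rewrite !mxE; case: (v i j) => ? ? /=; ring.
  by move=> [? ?] [? ?].
have : (a *m M *m b^T) 0 0 = (b *m M *m a^T) 0 0.
  have -> : b *m M *m a^T = (a *m M *m b^T)^T by rewrite !trmx_mul trmxK Ms mulmxA.
  by rewrite [RHS]mxE.
rewrite aM bM !mulmxDl !mulNmx -!scalemxAl !mxE.
have -> : \sum_j b 0 j * a^T j 0 = \sum_j a 0 j * b^T j 0.
  by apply: eq_bigr => j _; rewrite !mxE mulrC.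
have ge0 (u : 'rV[R]_n) : 0 <= \sum_j u 0 j * u^T j 0.
  by apply: sumr_ge0 => j _; rewrite mxE -expr2 sqr_ge0.
have eq0 (u : 'rV[R]_n) : \sum_j u 0 j * u^T j 0 = 0 -> u = 0.
  move/eqP; rewrite psumr_eq0 => [/allP h|j _]; last by rewrite mxE -expr2 sqr_ge0.
  apply/rowP => j; have := h j (mem_index_enum j); rewrite /= mxE -expr2 sqrf_eq0.
  by move/eqP => ->; rewrite mxE.
move: (ge0 a) (ge0 b) (@eq0 a) (@eq0 b).
set A := \sum_j a 0 j * a^T j 0; set B := \sum_j b 0 j * b^T j 0 => A0 B0 a0 b0 e.
have /eqP : y * (A + B) = 0 by lra.
rewrite mulf_eq0 => /orP[/eqP //|/eqP AB]; exfalso.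
have Ae : A = 0 by lra.
have Be : B = 0 by lra.
case/eqP: v0; apply/rowP => i; move: (a0 Ae) (b0 Be) => /rowP/(_ i) + /rowP/(_ i).
by rewrite !mxE; case: (v 0 i) => ? ? /= -> ->.
Qed.

Lemma sym_char_poly_splits n (M : 'M[R]_n) : M^T = M -> splits (char_poly M).
Proof.
move=> Ms; apply: splits_of_real_roots => z; rewrite map_char_poly.
exact: sym_eigenvalue_real.
Qed.

(** Splitting makes the set in the definition of [eigvals] nonempty, so the default value 0 is not
    taken. *)
Lemma char_poly_eigvals n (M : 'M[R]_n) : splits (char_poly M) ->
  char_poly M = \prod_i ('X - (eigvals M 0 i)%:P).
Proof.
rewrite /splits (monicP (char_poly_monic M)) => -[r]; rewrite scale1r => hr.
rewrite /eigvals; set S := [set l | _]; suff /xgetPex h : S !=set0 by exact: (h 0).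
have sr : size r = n.
  by have := size_char_poly M; rewrite hr size_prod_XsubC => -[].
exists (\row_i r`_i); rewrite /S /=.
under eq_bigr do rewrite mxE; rewrite hr.
by rewrite (big_nth 0) sr big_mkord.
Qed.

Lemma sigma_eigvals n (M : 'M[R]_n) j : splits (char_poly M) -> (j <= n)%N ->
  sigma j (eigvals M) = mxsigma j M.
Proof.
move=> Ms jn; rewrite /mxsigma (char_poly_eigvals Ms) coef_prod_sigma //.
by rewrite mulrA -exprD -signr_odd oddD addbb mul1r.
Qed.

Lemma mxsigma0 n (M : 'M[R]_n) : mxsigma 0 M = 1.
Proof.
rewrite /mxsigma expr0 mul1r subn0; have /monicP := char_poly_monic M.
by rewrite lead_coefE size_char_poly.
Qed.

Lemma newton_mxsigma n (M : 'M[R]_n) j : splits (char_poly M) -> (j.+2 <= n)%N ->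
  mxsigma j M * mxsigma j.+2 M <= mxsigma j.+1 M ^+ 2.
Proof.
move=> Ms jn; have := newton_coef_weak (n - j.+2) Ms.
rewrite /mxsigma (_ : (n - j.+2).+1 = (n - j.+1)%N); last by lia.
rewrite (_ : (n - j.+1).+1 = (n - j)%N); last by lia.
have sg : (-1) ^+ j * (-1) ^+ j.+2 = 1 :> R.
  by rewrite -exprD !addnS addnn -signr_odd /= odd_double.
by rewrite exprMn sqrr_sign mul1r mulrACA sg mul1r mulrC.
Qed.

End SymmetricMatrices.

Lemma char_poly_conj (K : comNzRingType) n (A P Q : 'M[K]_n) :
  P *m Q = 1%:M -> char_poly (P *m A *m Q) = char_poly A.
Proof.
move=> PQ; rewrite /char_poly.
have -> : char_poly_mx (P *m A *m Q) =
    map_mx polyC P *m char_poly_mx A *m map_mx polyC Q.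
  rewrite /char_poly_mx !map_mxM mulmxBr mulmxBl; congr (_ - _).
  by rewrite mul_mx_scalar -scalemxAl -map_mxM PQ map_mx1 scalemx1.
rewrite !det_mulmx mulrAC -det_mulmx -map_mxM PQ map_mx1 det1 mul1r //.
Qed.

Lemma det_add_delta (K : comNzRingType) m (A : 'M[K]_(1 + m)) (t : K) :
  \det (A + t *: delta_mx 0 0) = \det A + t * \det (drsubmx A).
Proof.
(* The determinant is linear in row 0, which is row 0 of [A] plus [t] times the first basis vector;
   [C] has that basis vector as row 0 and agrees with [A] below. *)
pose C : 'M[K]_(1 + m) := block_mx 1%:M 0 (dlsubmx A) (drsubmx A).
have -> : \det (drsubmx A) = \det C by rewrite det_lblock det1 mul1r.
rewrite -[\det A]mul1r; apply: (determinant_multilinear (i0 := 0)).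
- apply/rowP => j; rewrite !mxE eqxx mul1r.
  rewrite split1 unlift_none /= !mxE split1.
  by case: unliftP => [j' ->|->] /=; rewrite !mxE.
- by apply/matrixP => i j; rewrite !mxE /= mulr0 addr0.
- apply/matrixP => i j; rewrite !mxE /= mulr0 addr0 split1 liftK /= !mxE.
  rewrite split1; case: unliftP => [j' ->|->] /=; rewrite !mxE; congr (A _ _);
  exact/val_inj.
Qed.

(** * Rank-one perturbations and compression to a hyperplane *)

Section Compression.
Variable (R : realType).

(** In the orthonormal basis formed by [v] and the rows of [E] the perturbation changes only the
    entry (0, 0). The determinant is affine in that entry, with the complementary minor, here the
    characteristic polynomial of the compression, as coefficient. *)
Lemma mxsigma_add_rank1 m (N : 'M[R]_m.+1) (E : 'M[R]_(m, m.+1)) (v : 'rV[R]_m.+1) t j :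
  E *m E^T = 1%:M -> E *m v^T = 0 -> v *m v^T = 1%:M -> (j <= m)%N ->
  mxsigma j.+1 (N + t *: (v^T *m v)) = mxsigma j.+1 N + t * mxsigma j (E *m N *m E^T).
Proof.
move=> EE Ev vv jm; pose O : 'M[R]_(1 + m, m.+1) := col_mx v E.
have vE : v *m E^T = 0 by rewrite -[RHS]trmx0 -Ev trmx_mul trmxK.
have OO : O *m O^T = 1%:M.
  by rewrite tr_col_mx mul_col_row EE Ev vv vE -scalar_mx_block.
rewrite /mxsigma -(char_poly_conj _ OO) -(char_poly_conj N OO).
have -> : O *m (N + t *: (v^T *m v)) *m O^T =
    O *m N *m O^T + t *: delta_mx 0 0 :> 'M[R]_(1 + m).
  rewrite mulmxDr mulmxDl; congr (_ + _).
  rewrite -scalemxAr -scalemxAl; congr (_ *: _).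
  have -> : O *m (v^T *m v) *m O^T = (O *m v^T) *m (v *m O^T) by rewrite !mulmxA.
  have -> : O *m v^T = col_mx 1%:M 0 by rewrite mul_col_mx vv Ev.
  have -> : v *m O^T = row_mx 1%:M 0 by rewrite tr_col_mx mul_mx_row vv vE.
  rewrite mul_col_row !mul1mx mulmx0 !mul0mx.
  apply/matrixP => i k.
  by case: (unliftP 0 i) => [i' ->|->]; case: (unliftP 0 k) => [k' ->|->];
    rewrite !mxE split1 ?liftK ?unlift_none /= !mxE ?split1 ?liftK ?unlift_none /= ?mxE.
have -> : E *m N *m E^T = drsubmx (O *m N *m O^T).
  by rewrite tr_col_mx mul_col_mx mul_col_row block_mxKdr.
set A := O *m N *m O^T.
rewrite /char_poly.
have -> : char_poly_mx (A + t *: delta_mx 0 0 : 'M[R]_(1 + m)) =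
    char_poly_mx A + (- t%:P) *: delta_mx 0 0 :> 'M[{poly R}]_(1 + m).
  apply/matrixP => i k; rewrite !mxE polyCD polyCM opprD addrA mulNr.
  by case: (_ && _).
rewrite det_add_delta coefD mulrDr; congr (_ + _).
have -> : drsubmx (char_poly_mx A) = char_poly_mx (drsubmx A).
  apply/matrixP => i k; rewrite !mxE.
  by congr ('X *+ _ - _); rewrite -!(inj_eq val_inj) /= eqn_add2l.
rewrite mulNr coefN coefCM subSS exprS; ring.
Qed.

End Compression.

Lemma mx_entry_norm_le (R : realType) m n (x : 'M[R]_(m, n)) i j : `|x i j| <= `|x|.
Proof.
rewrite [leRHS]/Num.norm /= mx_normrE.
by apply/bigmax_geP; right => /=; exists (i, j).
Qed.

Lemma mx_norm_le (R : realType) m n (x : 'M[R]_(m, n)) (e : R) :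
  0 <= e -> (forall i j, `|x i j| <= e) -> `|x| <= e.
Proof.
move=> e0 h; rewrite [leLHS]/Num.norm /= mx_normrE.
by apply/bigmax_leP; split=> // -[i j] _; exact: h.
Qed.

(** * The cones Gamma_k: compression and closure *)

Section GardingCone.
Variable R : realType.

(* For [t <= 0], as long as [A 1 t, ..., A j t > 0], the Newton inequalities
   propagate [A j.+1 t >= c * A j t] down to [A i t >= c ^+ i]; so these
   quantities cannot reach 0, although [A 1 (- a 1) = 0]. *)
Lemma newton_pencil (a b : nat -> R) (j : nat)
    (A := fun i t => if i is i'.+1 then a i + t * b i' else 1) :
  (forall i t, (i.+2 <= j.+1)%N -> A i t * A i.+2 t <= A i.+1 t ^+ 2) ->
  (forall i, (1 <= i <= j.+1)%N -> 0 < a i) -> b 0 = 1 ->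
  (forall i, (i < j)%N -> 0 <= b i) -> 0 <= b j.
Proof.
move=> newton apos b0 bpos; case: j newton apos bpos => [|j] newton apos bpos.
  by rewrite b0 ler01.
rewrite leNgt; apply/negP => bneg.
(* For [t <= 0] the negative [b j.+1] keeps [A j.+2 t] above [a j.+2], while [b j >= 0] keeps
   [A j.+1 t] below [a j.+1]; so the ratio at the top never falls below this value. *)
pose c := a j.+2 / a j.+1.
have c0 : 0 < c by rewrite divr_gt0 // apos //; lia.
have cj : a j.+2 = c * a j.+1 by rewrite divfK // gt_eqF // apos //; lia.
have step t : t <= 0 -> (forall i, (i <= j.+1)%N -> 0 < A i t) ->
    forall i, (i <= j.+1)%N -> c ^+ i <= A i t.
  move=> t0 At0.
  have ratio d : (d <= j.+1)%N -> c * A (j.+1 - d)%N t <= A (j.+1 - d).+1 t.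
    elim: d => [_|d IH dj].
      rewrite subn0 /A -/A; apply: (@le_trans _ _ (a j.+2)); last first.
        by rewrite lerDl mulr_le0 // ltW.
      rewrite cj ler_wpM2l ?(ltW c0) // gerDl mulr_le0_ge0 //.
      by apply: bpos; lia.
    have := IH (ltnW dj).
    set e := (j.+1 - d.+1)%N; have -> : (j.+1 - d = e.+1)%N by rewrite /e; lia.
    move=> h; have ej : (e.+2 <= j.+2)%N by rewrite /e; lia.
    have p0 : 0 < A e t by apply: At0; lia.
    have p1 : 0 < A e.+1 t by apply: At0; rewrite /e; lia.
    rewrite -(ler_pM2l p1) -expr2; apply: le_trans (newton _ _ ej).
    have -> : A e.+1 t * (c * A e t) = A e t * (c * A e.+1 t) by ring.
    exact: ler_wpM2l (ltW p0) _ _ h.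
  elim=> [_|i IH ij]; first by rewrite expr0.
  rewrite exprS; apply: (@le_trans _ _ (c * A i t)).
    by rewrite ler_wpM2l ?(ltW c0) // IH // ltnW.
  by have := ratio (j.+1 - i)%N; rewrite subKn; [apply; lia|lia].
have a1 : 0 < a 1%N by apply: apos.
(* A discretised continuity argument: going from 0 to [- a 1] in [n] equal steps with [n > S], each
   [A i.+1] drops per step by less than its lower bound [c ^+ i.+1], so positivity carries over to
   the next step, where [step] restores the bound. *)
pose S := \sum_(i < j.+1) (a 1%N * b i / c ^+ i.+1).
have Sge0 (i : 'I_j.+1) : 0 <= a 1%N * b i / c ^+ i.+1.
  by rewrite divr_ge0 ?mulr_ge0 ?(ltW a1) ?exprn_ge0 ?(ltW c0) // bpos.
have [n nS] : exists n : nat, S < n%:R.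
  by exists (Num.bound S); rewrite archi_boundP // sumr_ge0.
have n0 : 0 < n%:R :> R by apply: le_lt_trans nS; rewrite sumr_ge0.
have main m : forall i, (i <= j.+1)%N -> c ^+ i <= A i (- (m%:R * (a 1%N / n%:R))).
  elim: m => [|m IH].
    apply: step => [|i ij]; first by rewrite mul0r oppr0.
    by case: i ij => [|i] ij; rewrite /A ?ltr01 // mul0r oppr0 mul0r addr0 apos //; lia.
  apply: step => [|i ij].
    by rewrite oppr_le0 mulr_ge0 // divr_ge0 // ltW.
  case: i ij => [|i] ij; first exact: ltr01.
  have := IH _ ij; rewrite /A -natr1 => h.
  have hb : a 1%N / n%:R * b i < c ^+ i.+1.
    rewrite mulrAC ltr_pdivrMr // -ltr_pdivrMl ?exprn_gt0 // mulrC.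
    apply: le_lt_trans nS; rewrite /S (bigD1 (Ordinal ij)) //= lerDl.
    by apply: sumr_ge0 => l _.
  move: h hb; set u := m%:R * _ ; rewrite mulrDl mul1r -/u; set x := a 1%N / _.
  by rewrite opprD mulrDl !mulNr; lra.
have := main n 1%N isT; rewrite /A b0 mulrCA divff ?gt_eqF // !mulr1 subrr.
by rewrite leNgt exprn_gt0.
Qed.

(** Every matrix of the pencil [N + t v^T v] is symmetric, so Newton's inequalities hold along all
    of it, and its symmetric functions are the affine functions of [newton_pencil]. The strong
    induction provides the signs of the lower slopes. *)
Lemma mxsigma_compression_ge0 m k (N : 'M[R]_m.+1) (E : 'M[R]_(m, m.+1)) (v : 'rV[R]_m.+1) :
  N^T = N -> E *m E^T = 1%:M -> E *m v^T = 0 -> v *m v^T = 1%:M -> (k <= m.+1)%N ->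
  (forall j, (1 <= j <= k)%N -> 0 < mxsigma j N) ->
  forall j, (j < k)%N -> 0 <= mxsigma j (E *m N *m E^T).
Proof.
move=> Ns EE Ev vv km Npos; elim/ltn_ind => j IH jk.
apply: (@newton_pencil (fun i => mxsigma i N) (fun i => mxsigma i (E *m N *m E^T))).
- move=> i t ij.
  have AE l : (l <= j.+1)%N -> mxsigma l (N + t *: (v^T *m v)) =
      (if l is l'.+1 then mxsigma l N + t * mxsigma l' (E *m N *m E^T) else 1).
    case: l => [|l] lj; first exact: mxsigma0.
    by rewrite (mxsigma_add_rank1 _ _ EE Ev vv) //; lia.
  have sp : splits (char_poly (N + t *: (v^T *m v))).
    apply: sym_char_poly_splits.
    by rewrite linearD linearZ /= trmx_mul trmxK Ns.
  have im : (i.+2 <= m.+1)%N by lia.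
  have := newton_mxsigma sp im.
  by rewrite (AE i) ?(AE i.+1) ?(AE i.+2) //; lia.
- by move=> i ij; apply: Npos; lia.
- exact: mxsigma0.
- by move=> i ij; apply: IH => //; lia.
Qed.

(** The shift substitutes [X + t] for [X] in the product of the [X + l_i]. The new coefficient is a
    combination of the [sigma i l], [i <= j], with nonnegative weights, in which [sigma 0 l = 1] has
    the positive weight ['C(n, n - j) t^j]. *)
Lemma sigma_add_cst_gt0 n j (l : 'rV[R]_n) t :
  0 < t -> (j <= n)%N -> (forall i, (i <= j)%N -> 0 <= sigma i l) ->
  0 < sigma j (l + const_mx t).
Proof.
move=> t0 jn lpos; rewrite -coef_prod_addX_sigma //.
pose Q := \prod_i ('X + (l 0 i)%:P) : {poly R}.
have -> : \prod_i ('X + ((l + const_mx t) 0 i)%:P) = Q \Po ('X + t%:P).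
  rewrite /Q rmorph_prod /=; apply: eq_bigr => i _.
  by rewrite comp_polyD comp_polyX comp_polyC !mxE polyCD addrAC addrA.
have sQ : size Q = n.+1.
  have -> : Q = \prod_(i <- enum 'I_n) ('X - (- l 0 i)%:P).
    by rewrite big_enum; apply: eq_bigr => i _; rewrite polyCN opprK.
  by rewrite size_prod_XsubC size_enum_ord.
have coefX i q : (('X + t%:P) ^+ i)`_q = t ^+ (i - q) *+ 'C(i, q) :> R.
  rewrite addrC exprDn coef_sum.
  have [iq|qi] := ltnP i q.
    rewrite bin_small // mulr0n big1 // => -[h hi] _ /=.
    by rewrite coefMn -rmorphXn coefCM coefXn; case: eqP => [|_]; [lia|rewrite mulr0 mul0rn].
  rewrite (bigD1 (Ordinal (_ : q < i.+1)%N)) //= big1 ?addr0 => [|[h hi] hq].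
    by rewrite coefMn -rmorphXn coefCM coefXn eqxx mulr1.
  rewrite coefMn -rmorphXn coefCM coefXn; case: eqP => [qh|_]; last by rewrite mulr0 mul0rn.
  by case/eqP: hq; apply: val_inj.
rewrite coef_comp_poly sQ big_ord_recr /= coefX subKn //.
have Qn : Q`_n = 1 by rewrite -[n in LHS]subn0 coef_prod_addX_sigma // sigma0.
rewrite Qn mul1r; apply: ltr_wpDl; last first.
  by rewrite pmulrn_lgt0 ?exprn_gt0 // bin_gt0; lia.
apply: sumr_ge0 => -[i im] _ /=; rewrite coefX.
have [h|h] := ltnP i (n - j)%N; first by rewrite bin_small // mulr0n mulr0.
rewrite mulr_ge0 //; last by rewrite mulrn_wge0 // exprn_ge0 // ltW.
rewrite (_ : i = (n - (n - i)))%N; last by lia.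
by rewrite coef_prod_addX_sigma ?lpos; lia.
Qed.

Lemma closure_Gamma n k (l : 'rV[R]_n) : (k <= n)%N ->
  (forall j, (j <= k)%N -> 0 <= sigma j l) -> closure (@Gamma R n k) l.
Proof.
move=> kn lpos B /nbhs_ballP[e /= e0 eB].
exists (l + const_mx (e / 2)); split.
  move=> j /andP[_ jk]; apply: sigma_add_cst_gt0; [lra|lia|].
  by move=> i ij; apply: lpos; lia.
apply: eB; rewrite -ball_normE /= opprD addNKr normrN.
apply: le_lt_trans (_ : e / 2 < e); last by lra.
apply: mx_norm_le => [|i j]; first by lra.
by rewrite mxE ger0_norm //; lra.
Qed.

End GardingCone.

(** Here [g^-1 = Q^T Q], so conjugation by [Q^T] turns [g^-1 S] into [Q S Q^T]. The latter is
    symmetric when [S] is, which makes the spectrum of [g^-1 S] accessible. *)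
Lemma char_poly_pencil (K : fieldType) m (g S Q : 'M[K]_m) :
  Q *m g *m Q^T = 1%:M -> char_poly (invmx g *m S) = char_poly (Q *m S *m Q^T).
Proof.
move=> QgQ.
have QTQg : Q^T *m Q *m g = 1%:M.
  by rewrite -mulmxA; apply: mulmx1C.
have [gu giE] : g \in unitmx /\ invmx g = Q^T *m Q.
  have gu : g \in unitmx by case: (mulmx1_unit QTQg).
  by split=> //; rewrite -[LHS]mul1mx -QTQg mulmxK.
have QTu : Q^T \in unitmx by case: (mulmx1_unit QgQ).
rewrite giE -(@char_poly_conj _ _ (Q^T *m Q *m S) (invmx Q^T) Q^T); last exact: mulVmx.
by rewrite -!mulmxA mulKmx.
Qed.

(** * Continuity of the symmetric functions in the matrix entries *)

Section MxsigmaContinuity.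
Variables (R : realType) (T : topologicalType) (x : T).

Lemma continuous_sum_for (I : Type) (r : seq I) (F : I -> T -> R) :
  (forall i, {for x, continuous (F i)}) ->
  {for x, continuous (fun t => \sum_(i <- r) F i t)}.
Proof.
move=> Fc; elim: r => [|i r IH].
  rewrite (_ : (fun _ => _) = cst 0); first exact: cst_continuous.
  by apply/funext => t; rewrite big_nil.
rewrite (_ : (fun _ => _) = F i \+ (fun t => \sum_(j <- r) F j t)).
  exact: continuousD.
by apply/funext => t; rewrite big_cons.
Qed.

Let coef_cts (p : T -> {poly R}) := forall i, {for x, continuous (fun t => (p t)`_i)}.

Let coef_cts_cst p : coef_cts (fun=> p).
Proof. by move=> i; exact: cst_continuous. Qed.

Let coef_ctsM p q : coef_cts p -> coef_cts q -> coef_cts (fun t => p t * q t).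
Proof.
move=> pc qc i.
rewrite (_ : (fun t => _) = fun t => \sum_(j < i.+1) (p t)`_j * (q t)`_(i - j)).
  by apply: continuous_sum_for => j; apply: continuousM.
by apply/funext => t; rewrite coefM.
Qed.

Let coef_cts_prod (I : Type) (r : seq I) (F : I -> T -> {poly R}) :
  (forall i, coef_cts (F i)) -> coef_cts (fun t => \prod_(i <- r) F i t).
Proof.
move=> Fc; elim: r => [|i r IH].
  rewrite (_ : (fun _ => _) = cst 1); first exact: coef_cts_cst.
  by apply/funext => t; rewrite big_nil.
rewrite (_ : (fun _ => _) = fun t => F i t * \prod_(j <- r) F j t).
  exact: coef_ctsM.
by apply/funext => t; rewrite big_cons.
Qed.

Lemma mxsigma_continuous n k (M : T -> 'M[R]_n) :
  (forall i j, {for x, continuous (fun t => M t i j)}) ->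
  {for x, continuous (fun t => mxsigma k (M t))}.
Proof.
move=> Mc; apply: continuousM; first exact: cst_continuous.
rewrite /char_poly /determinant.
rewrite (_ : (fun t => _) = fun t => \sum_(s : 'S_n)
    ((-1) ^+ s * \prod_i char_poly_mx (M t) i (s i))`_(n - k)); last first.
  by apply/funext => t; rewrite coef_sum.
apply: continuous_sum_for => s; apply: coef_ctsM; first exact: coef_cts_cst.
apply: coef_cts_prod => i l.
rewrite (_ : (fun t => _) = fun t =>
    ('X *+ (i == s i))`_l - (if l == 0%N then M t i (s i) else 0)); last first.
  by apply/funext => t; rewrite !mxE coefB coefC.
apply: continuousB; first exact: cst_continuous.
case: eqP => _; first exact: Mc.
exact: cst_continuous.
Qed.

End MxsigmaContinuity.

(** * Gradients and functions of class C^2 *)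

Lemma continuous_at_near (T U : topologicalType) (f g : T -> U) x :
  {near x, f =1 g} -> {for x, continuous f} -> {for x, continuous g}.
Proof.
move=> fg; rewrite /prop_for /continuous_at (nbhs_singleton fg).
by apply: cvg_trans; apply: near_eq_cvg; apply: filterS fg => y ->.
Qed.

Section Gradients.
Variable R : realType.

Section dotp_lemmas.
Variable n : nat.
Implicit Types u v w : 'rV[R]_n.

Lemma dotpE u v : dotp u v = (u *m v^T) 0 0.
Proof. by rewrite mxE; apply: eq_bigr => i _; rewrite mxE. Qed.

Lemma dotpC u v : dotp u v = dotp v u.
Proof. by apply: eq_bigr => i _; rewrite mulrC. Qed.

Lemma dotpDl u v w : dotp (u + v) w = dotp u w + dotp v w.
Proof. by rewrite !dotpE mulmxDl mxE. Qed.

Lemma dotpDr u v w : dotp u (v + w) = dotp u v + dotp u w.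
Proof. by rewrite !(dotpC u) dotpDl. Qed.

Lemma dotpZl a u v : dotp (a *: u) v = a * dotp u v.
Proof. by rewrite !dotpE -scalemxAl mxE. Qed.

Lemma dotpZr a u v : dotp u (a *: v) = a * dotp u v.
Proof. by rewrite !(dotpC u) dotpZl. Qed.

Lemma dotpNl u v : dotp (- u) v = - dotp u v.
Proof. by rewrite -scaleN1r dotpZl mulN1r. Qed.

Lemma dotpNr u v : dotp u (- v) = - dotp u v.
Proof. by rewrite !(dotpC u) dotpNl. Qed.

Lemma dotpBl u v w : dotp (u - v) w = dotp u w - dotp v w.
Proof. by rewrite dotpDl dotpNl. Qed.

Lemma dotpBr u v w : dotp u (v - w) = dotp u v - dotp u w.
Proof. by rewrite dotpDr dotpNr. Qed.

Lemma dotp_ge0 u : 0 <= dotp u u.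
Proof. by apply: sumr_ge0 => i _; rewrite -expr2 sqr_ge0. Qed.

Lemma dotp_delta u i : dotp u (delta_mx 0 i) = u 0 i.
Proof.
rewrite /dotp (bigD1 i) //= big1 => [|j ji].
  by rewrite mxE !eqxx mulr1 addr0.
by rewrite mxE (negPf ji) andbF mulr0.
Qed.

Lemma dotp_normr u v : `|dotp u v| <= n%:R * `|u| * `|v|.
Proof.
apply: (le_trans (ler_norm_sum _ _ _)).
apply: (@le_trans _ _ (\sum_(i < n) `|u| * `|v|)).
  by apply: ler_sum => i _; rewrite normrM ler_pM // mx_entry_norm_le.
by rewrite sumr_const card_ord -mulrA mulr_natl.
Qed.

Lemma norm_sqr_le_dotp u : `|u| ^+ 2 <= dotp u u.
Proof.
have h i : u 0 i ^+ 2 <= dotp u u.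
  rewrite /dotp (bigD1 i) //= -expr2 lerDl.
  by apply: sumr_ge0 => j _; rewrite -expr2 sqr_ge0.
rewrite -[leRHS]sqr_sqrtr ?dotp_ge0 // ler_pXn2r ?nnegrE ?sqrtr_ge0 //.
apply: mx_norm_le => [|i j]; first exact: sqrtr_ge0.
by rewrite ord1 -sqrtr_sqr ler_wsqrtr.
Qed.

Lemma enorm_sqr u : enorm u ^+ 2 = dotp u u.
Proof. by rewrite sqr_sqrtr ?dotp_ge0. Qed.

End dotp_lemmas.

Lemma dotp_mulmx m n (u : 'rV[R]_m) (A : 'M[R]_(m, n)) v : dotp (u *m A) v = dotp u (v *m A^T).
Proof. by rewrite !dotpE trmx_mul trmxK mulmxA. Qed.

(** A named function, so that it can carry the linear structure that uniqueness of the differential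
    asks for. *)
Definition dotl n (g v : 'rV[R]_n) : R := dotp v g.

Lemma dotl_linear n (g : 'rV[R]_n) : linear (dotl g).
Proof. by move=> a u v; rewrite /dotl dotpDl dotpZl. Qed.

HB.instance Definition _ n (g : 'rV[R]_n) :=
  GRing.isLinear.Build R 'rV[R]_n R _ (dotl g) (dotl_linear g).

Lemma dotl_continuous n (g : 'rV[R]_n) : continuous (dotl g).
Proof.
move=> x; apply: continuous_sum_for => i; apply: continuousM.
  exact: coord_continuous.
exact: cst_continuous.
Qed.

(** Differentiability and the value of the gradient travel together, since [grad] is defined even
    where [f] is not differentiable. *)
Definition has_grad n (f : 'rV[R]_n -> R) (x g : 'rV[R]_n) :=
  differentiable f x /\ forall v, 'D_v f x = dotp v g.

Lemma has_gradP n (f : 'rV[R]_n -> R) (x g : 'rV[R]_n) :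
  has_grad f x g <->
  forall e : R, 0 < e -> \forall y \near x, `|f y - f x - dotp (y - x) g| <= e * `|y - x|.
Proof.
split=> [[fd fg] e e0|h].
  have /eqaddoP/(_ _ e0) h := diff_locally fd.
  have {}h : \forall z \near (0 : 'rV[R]_n), `|f (z + x) - (f x + 'd f x z)| <= e * `|z| by [].
  move: h; rewrite (near_shift x 0); apply: filterS => y /=.
  by rewrite sub0r -deriveE // fg opprD addrA subrK.
have dxf : f \o shift x = cst (f x) + (dotl g : 'rV[R]_n -> R) +o_ (0 : 'rV[R]_n) id.
  apply/eqaddoP => e e0.
  suff : \forall z \near (0 : 'rV[R]_n), `|f (z + x) - (f x + dotp z g)| <= e * `|z| by [].
  have := h e e0; rewrite (near_shift 0 x); apply: filterS => y /=.
  by rewrite subr0 addrK opprD addrA.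
have dE := diff_unique (@dotl_continuous n g) dxf.
have fd : differentiable f x.
  by apply/diff_locallyP; rewrite dE; split=> //; exact: dotl_continuous.
by split=> // v; rewrite deriveE // dE.
Qed.

Section rules.
Variable n : nat.
Implicit Types (f : 'rV[R]_n -> R) (x g : 'rV[R]_n).

Lemma has_grad_near f1 f2 x g : {near x, f1 =1 f2} -> has_grad f1 x g -> has_grad f2 x g.
Proof.
move=> f12 /has_gradP h; apply/has_gradP => e e0.
move: (h e e0); rewrite (nbhs_singleton f12).
by apply: filterS2 f12 => y ->.
Qed.

Lemma has_grad_grad f x : differentiable f x -> has_grad f x (grad f x).
Proof.
move=> fd; split=> // v; rewrite deriveE // {1}(row_sum_delta v) linear_sum /=.
by apply: eq_bigr => i _; rewrite linearZ /= mxE /partial deriveE.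
Qed.

Lemma has_grad_partial f x g i : has_grad f x g -> partial i f x = g 0 i.
Proof. by case=> _ h; rewrite /partial h dotpC dotp_delta. Qed.

Lemma has_gradE f x g : has_grad f x g -> grad f x = g.
Proof. by move=> h; apply/rowP => i; rewrite mxE (has_grad_partial i h). Qed.

Lemma has_grad_cst a x : has_grad (fun=> a) x 0.
Proof.
split=> [|v]; first exact: differentiable_cst.
by rewrite derive_cst /dotp big1 // => i _; rewrite mxE mulr0.
Qed.

Lemma has_grad_dotp u x : has_grad (fun y => dotp y u) x u.
Proof.
apply/has_gradP => e e0; near=> y.
by rewrite -dotpBl subrr normr0 mulr_ge0 // ltW.
Unshelve. all: by end_near. Qed.

Lemma has_gradD f1 f2 x g1 g2 :
  has_grad f1 x g1 -> has_grad f2 x g2 -> has_grad (fun y => f1 y + f2 y) x (g1 + g2).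
Proof.
case=> d1 h1 [d2 h2]; split=> [|v]; first exact: differentiableD.
by rewrite deriveD ?h1 ?h2 ?dotpDr //; exact: diff_derivable.
Qed.

Lemma has_gradM f1 f2 x g1 g2 : has_grad f1 x g1 -> has_grad f2 x g2 ->
  has_grad (fun y => f1 y * f2 y) x (f1 x *: g2 + f2 x *: g1).
Proof.
case=> d1 h1 [d2 h2]; split=> [|v]; first exact: differentiableM.
by rewrite deriveM ?h1 ?h2 ?dotpDr ?dotpZr //; exact: diff_derivable.
Qed.

Lemma has_gradZ a f x g : has_grad f x g -> has_grad (fun y => a * f y) x (a *: g).
Proof.
move=> h; have := has_gradM (has_grad_cst a x) h.
by rewrite scaler0 addr0.
Qed.

Lemma has_gradN f x g : has_grad f x g -> has_grad (fun y => - f y) x (- g).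
Proof.
move=> /(has_gradZ (-1)); rewrite scaleN1r.
by apply: has_grad_near; near=> y; rewrite mulN1r.
Unshelve. all: by end_near. Qed.

Lemma has_gradB f1 f2 x g1 g2 :
  has_grad f1 x g1 -> has_grad f2 x g2 -> has_grad (fun y => f1 y - f2 y) x (g1 - g2).
Proof. by move=> h1 h2; apply: has_gradD => //; exact: has_gradN. Qed.

Lemma has_grad_sum (I : Type) (r : seq I) (F : I -> 'rV[R]_n -> R)
    (G : I -> 'rV[R]_n) x : (forall i, has_grad (F i) x (G i)) ->
  has_grad (fun y => \sum_(i <- r) F i y) x (\sum_(i <- r) G i).
Proof.
move=> h; elim: r => [|i r IH].
  rewrite big_nil (_ : (fun _ => _) = fun=> 0); first exact: has_grad_cst.
  by apply/funext => y; rewrite big_nil.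
rewrite big_cons (_ : (fun _ => _) = fun y => F i y + \sum_(j <- r) F j y).
  exact: has_gradD.
by apply/funext => y; rewrite big_cons.
Qed.

End rules.

Lemma mulmx_norm_le m n (u : 'rV[R]_m) (A : 'M[R]_(m, n)) :
  `|u *m A| <= m%:R * `|A| * `|u|.
Proof.
apply: mx_norm_le => [|i j]; first by rewrite !mulr_ge0.
rewrite mxE; apply: (le_trans (ler_norm_sum _ _ _)).
apply: (@le_trans _ _ (\sum_(k < m) `|A| * `|u|)).
  by apply: ler_sum => k _; rewrite normrM mulrC ler_pM // mx_entry_norm_le.
by rewrite sumr_const card_ord -mulrA mulr_natl.
Qed.

Lemma mulmxr_continuous m n (A : 'M[R]_(m, n)) : continuous (fun u : 'rV[R]_m => u *m A).
Proof.
move=> u; apply/(@cvgrPdist_le _ _ _ (nbhs u) _) => e e0.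
pose C := m%:R * `|A| + 1.
have C0 : 0 < C by rewrite ltr_wpDl // mulr_ge0.
apply/nbhs_ballP; exists (e / C) => /=; first by rewrite divr_gt0.
move=> v; rewrite -ball_normE /= => /ltW uv.
rewrite -mulmxBl; apply: (le_trans (mulmx_norm_le _ _)).
apply: (@le_trans _ _ (C * `|u - v|)).
  by rewrite ler_wpM2r // lerDl.
by rewrite -ler_pdivlMl // mulrC.
Qed.

Lemma has_grad_comp_lin m n (f : 'rV[R]_m -> R) (A : 'M[R]_(n, m)) x g :
  has_grad f (x *m A) g -> has_grad (fun y => f (y *m A)) x (g *m A^T).
Proof.
move=> /has_gradP h; apply/has_gradP => e e0.
pose C := n%:R * `|A| + 1.
have C0 : 0 < C by rewrite ltr_wpDl // mulr_ge0.
have h2 : \forall y \near x, `|f (y *m A) - f (x *m A) - dotp (y *m A - x *m A) g|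
    <= e / C * `|y *m A - x *m A|.
  exact: (@mulmxr_continuous _ _ A x _ (h _ (divr_gt0 e0 C0))).
near=> y.
have := near h2 y; rewrite -mulmxBl dotp_mulmx => /(_ _)/le_trans; apply => //.
rewrite -mulrA ler_pM2l // ler_pdivrMl //.
apply: (le_trans (mulmx_norm_le _ _)).
by rewrite ler_wpM2r // lerDl.
Unshelve. all: by end_near. Qed.

(** Reduces class C^2 to explicit candidates for gradient and Hessian. They need to agree with the
    partial derivatives only on [D]; openness lets that agreement be differentiated again. *)
Lemma Ck2_intro n (D : set 'rV[R]_n) (f : 'rV[R]_n -> R)
    (G : 'rV[R]_n -> 'rV[R]_n) (H : 'rV[R]_n -> 'M[R]_n) : open D ->
  (forall x, D x -> has_grad f x (G x)) ->
  (forall x j, D x -> has_grad (fun y => G y 0 j) x (col j (H x))^T) ->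
  (forall x i j, D x -> {for x, continuous (fun y => H y i j)}) ->
  Ck 2 D f /\ forall x, D x -> hess f x = H x.
Proof.
move=> oD fG GH Hc.
have nearD x (P : 'rV[R]_n -> Prop) : D x -> (forall y, D y -> P y) -> \forall y \near x, P y.
  by move=> Dx h; apply: filterS h _; exact: open_nbhs_nbhs.
have pG x j : D x -> has_grad (partial j f) x (col j (H x))^T.
  move=> Dx; apply: has_grad_near (GH x j Dx).
  by apply: nearD Dx _ => y Dy; rewrite (has_grad_partial j (fG y Dy)).
split; last first.
  by move=> x Dx; apply/matrixP => i j; rewrite !mxE (has_grad_partial i (pG x j Dx)) !mxE.
split=> [x Dx|j]; first by case: (fG x Dx).
split=> [x Dx|i x Dx]; first by case: (pG x j Dx).
apply: (continuous_at_near _ (Hc x i j Dx)).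
by apply: nearD Dx _ => y Dy; rewrite (has_grad_partial i (pG y j Dy)) !mxE.
Qed.

End Gradients.

Lemma continuous_near (R : realType) (T : topologicalType) (f : T -> R) x (e : R) :
  {for x, continuous f} -> 0 < e -> \forall y \near x, `|f y - f x| < e.
Proof.
move=> fc e0; have /cvgrPdist_lt/(_ _ e0) := fc.
by apply: filterS => y; rewrite distrC.
Qed.

(** * Mean values along segments and symmetry of the Hessian *)

Section MeanValue.
Variables (R : realType) (n : nat).
Implicit Types (f : 'rV[R]_n -> R) (x u v : 'rV[R]_n).

Lemma near_ballP x (P : 'rV[R]_n -> Prop) :
  (\forall y \near x, P y) <-> exists2 e : R, 0 < e & forall y, `|y - x| < e -> P y.
Proof.
split=> [/nbhs_ballP[e /= e0 h]|[e e0 h]].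
  by exists e => // y yx; apply: h; rewrite -ball_normE /= distrC.
by apply/nbhs_ballP; exists e => //= y; rewrite -ball_normE /= distrC; exact: h.
Qed.

Lemma continuous_line x v : continuous (fun t : R => x + t *: v).
Proof.
by move=> t; apply: cvgD; [exact: cvg_cst|exact: scalel_continuous].
Qed.

(** The gradient is required on the open segment only: an endpoint may lie on the singular
    hypersurface, where just continuity is available. *)
Lemma line_MVT f x v (g : 'rV[R]_n -> 'rV[R]_n) :
  (forall t : R, 0 < t < 1 -> has_grad f (x + t *: v) (g (x + t *: v))) ->
  (forall t : R, 0 <= t <= 1 -> {for x + t *: v, continuous f}) ->
  exists2 t : R, 0 < t < 1 & f (x + v) - f x = dotp v (g (x + t *: v)).
Proof.
move=> fg fc; pose F t := f (x + t *: v).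
have Fd (t : R) : t \in `]0, 1[ -> is_derive t 1 F (dotp v (g (x + t *: v))).
  rewrite in_itv /= => t01; have [fd fv] := fg t t01.
  have e : (fun h => h^-1 *: ((F \o shift t) (h *: (1 : R)) - F t)) =
      (fun h => h^-1 *: ((f \o shift (x + t *: v)) (h *: v) - f (x + t *: v))).
    apply/funext => h; rewrite /= /F; congr (_ *: (f _ - _)).
    by rewrite scalerDl -[h *: 1]/(h * 1) mulr1 addrCA.
  apply: DeriveDef; first by rewrite /derivable e; exact: diff_derivable.
  by rewrite /derive e; exact: fv.
have Fc : {within `[0, 1], continuous F}.
  apply: continuous_in_subspaceT => t; rewrite inE /= in_itv /= => t01.
  apply: (@continuous_comp _ _ _ (fun t : R => x + t *: v) f).
    exact: continuous_line.
  exact: fc.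
have [t t01] := MVT ltr01 Fd Fc.
rewrite /F scale1r scale0r addr0 subr0 mulr1 => ->.
by exists t => //; move: t01; rewrite in_itv.
Qed.

Lemma has_grad_shift f x u g :
  has_grad f (x + u) g -> has_grad (fun y => f (y + u)) x g.
Proof.
move=> /has_gradP h; apply/has_gradP => e e0.
have /near_ballP[d d0 hd] := h e e0; apply/near_ballP; exists d => // y yx.
have := hd (y + u); rewrite opprD addrACA subrr addr0; exact.
Qed.

Lemma has_grad_continuous f x g : has_grad f x g -> {for x, continuous f}.
Proof. by case=> fd _; exact: differentiable_continuous. Qed.

(** The mean value theorem is applied to [z |-> f (z + v) - f z] along [u], and then to the [i]-th
    partial derivative along [v]. *)
Lemma second_difference f x i j (e h : R) : 0 < h -> h + h < e ->
  (forall y, `|y - x| < e -> differentiable f y /\ differentiable (partial i f) y) ->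
  exists2 y, `|y - x| < e &
    f (x + h *: delta_mx 0 i + h *: delta_mx 0 j) - f (x + h *: delta_mx 0 i)
     - (f (x + h *: delta_mx 0 j) - f x) = h ^+ 2 * partial j (partial i f) y.
Proof.
move=> h0 he fd; set u := h *: delta_mx 0 i; set v := h *: delta_mx 0 j.
have nd (k : 'I_n) (t : R) : 0 <= t <= 1 -> `|t *: (h *: delta_mx 0 k : 'rV[R]_n)| <= h.
  move=> /andP[t0 t1]; apply: mx_norm_le => [|a b]; first exact: ltW.
  rewrite !mxE; case: (_ && _); rewrite ?mulr0 ?normr0 ?(ltW h0) // mulr1.
  by rewrite normrM !ger0_norm ?(ltW h0) // ler_piMl // ltW.
have close (t s : R) : 0 <= t <= 1 -> 0 <= s <= 1 -> `|x + t *: u + s *: v - x| < e.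
  move=> t01 s01; rewrite -[x + _ + _]addrA (addrC x) addrK.
  by apply: le_lt_trans he; apply: (le_trans (ler_normD _ _)); rewrite lerD // nd.
have close0 (t : R) : 0 <= t <= 1 -> `|x + t *: u - x| < e.
  by move=> t01; have := close t 0 t01; rewrite scale0r addr0; apply; rewrite lexx ler01.
have close1 (t : R) : 0 <= t <= 1 -> `|x + t *: u + v - x| < e.
  by move=> t01; have := close t 1 t01; rewrite scale1r; apply; rewrite lexx ler01.
pose F z := f (z + v) - f z.
have Fg (t : R) : 0 <= t <= 1 ->
    has_grad F (x + t *: u) (grad f (x + t *: u + v) - grad f (x + t *: u)).
  move=> t01; apply: has_gradB; last by apply: has_grad_grad; case: (fd _ (close0 t t01)).
  by apply: has_grad_shift; apply: has_grad_grad; case: (fd _ (close1 t t01)).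
have [t t01 Ft] := line_MVT (x := x) (v := u) (f := F)
  (g := fun y => grad f (y + v) - grad f y)
  (fun t t01 => Fg t (ltac:(case/andP: t01 => *; apply/andP; split; exact: ltW)))
  (fun t t01 => has_grad_continuous (Fg t t01)).
have {}t01 : 0 <= t <= 1 by case/andP: t01 => *; apply/andP; split; exact: ltW.
have pg (s : R) : 0 <= s <= 1 -> has_grad (partial i f) (x + t *: u + s *: v)
    (grad (partial i f) (x + t *: u + s *: v)).
  by move=> s01; apply: has_grad_grad; case: (fd _ (close t s t01 s01)).
have [s s01 Ps] := line_MVT (x := x + t *: u) (v := v) (f := partial i f)
  (g := grad (partial i f))
  (fun t t01 => pg t (ltac:(case/andP: t01 => *; apply/andP; split; exact: ltW)))
  (fun t t01 => has_grad_continuous (pg t t01)).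
have {}s01 : 0 <= s <= 1 by case/andP: s01 => *; apply/andP; split; exact: ltW.
exists (x + t *: u + s *: v); first exact: close.
have -> : f (x + u + v) - f (x + u) - (f (x + v) - f x) = F (x + u) - F x by [].
rewrite Ft {1}/u dotpZl dotpC dotp_delta !mxE.
by rewrite Ps {1}/v dotpZl dotpC dotp_delta mxE mulrA expr2.
Qed.

(** The second difference is symmetric in [i] and [j], so the two mixed derivatives coincide at a
    pair of points arbitrarily close to [x]; continuity moves both to [x]. *)
Lemma hess_sym (D : set 'rV[R]_n) f x : open D -> D x -> Ck 2 D f ->
  (hess f x)^T = hess f x.
Proof.
move=> oD Dx [fd fp]; apply/matrixP => i j; rewrite !mxE.
set p := partial j _ x; set q := partial i _ x.
apply/eqP; rewrite -subr_eq0 -normr_le0; apply/ler_addgt0Pr => e e0.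
have [_ cij] := fp i; have [_ cji] := fp j.
have h2 : 0 < e / 2 by rewrite divr_gt0.
have n1 := continuous_near (cij j x Dx) h2.
have n2 := continuous_near (cji i x Dx) h2.
have nD : \forall y \near x, D y by exact: open_nbhs_nbhs.
have nA : \forall y \near x, D y /\ `|partial j (partial i f) y - p| < e / 2 /\
  `|partial i (partial j f) y - q| < e / 2.
  by apply: filterI nD _; apply: filterI n1 n2.
have /near_ballP[d d0 hd] := nA.
have h0 : 0 < d / 3 by rewrite divr_gt0.
have hh : d / 3 + d / 3 < d by lra.
have df k y : `|y - x| < d -> differentiable f y /\ differentiable (partial k f) y.
  by case/hd => Dy _; split; [exact: fd|case: (fp k) => h _; exact: h].
have [y yx e1] := second_difference j h0 hh (df i).
have [z zx e2] := second_difference i h0 hh (df j).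
have pq : partial j (partial i f) y = partial i (partial j f) z.
  have h20 : (d / 3) ^+ 2 != 0 by rewrite expf_neq0 // gt_eqF.
  by apply: (mulfI h20); rewrite -e1 -e2 [x + _ + _]addrAC; ring.
have [_ [py _]] := hd _ yx; have [_ [_ qz]] := hd _ zx.
rewrite -pq in qz; rewrite add0r.
have -> : p - q = (partial j (partial i f) y - q) - (partial j (partial i f) y - p) by ring.
rewrite (splitr e); apply: le_trans (ler_normB _ _) _.
exact: lerD (ltW qz) (ltW py).
Qed.

End MeanValue.

(** * Graph charts and test functions *)

Section EntrywiseContinuity.
Variables (R : realType) (T : topologicalType) (x : T).

Definition mx_cts p q (M : T -> 'M[R]_(p, q)) :=
  forall i j, {for x, continuous (fun t => M t i j)}.

Lemma mx_cts_cst p q (A : 'M[R]_(p, q)) : mx_cts (fun=> A).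
Proof. by move=> i j; exact: cst_continuous. Qed.

Lemma mx_ctsD p q (M N : T -> 'M[R]_(p, q)) :
  mx_cts M -> mx_cts N -> mx_cts (fun t => M t + N t).
Proof.
move=> Mc Nc i j; rewrite (_ : (fun _ => _) = fun t => M t i j + N t i j).
  exact: continuousD.
by apply/funext => t; rewrite mxE.
Qed.

Lemma mx_ctsZ p q (a : T -> R) (M : T -> 'M[R]_(p, q)) :
  {for x, continuous a} -> mx_cts M -> mx_cts (fun t => a t *: M t).
Proof.
move=> ac Mc i j; rewrite (_ : (fun _ => _) = fun t => a t * M t i j).
  exact: continuousM.
by apply/funext => t; rewrite mxE.
Qed.

Lemma mx_ctsN p q (M : T -> 'M[R]_(p, q)) : mx_cts M -> mx_cts (fun t => - M t).
Proof.
move=> Mc i j; rewrite (_ : (fun _ => _) = fun t => - M t i j).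
  exact: continuousN.
by apply/funext => t; rewrite mxE.
Qed.

Lemma mx_ctsB p q (M N : T -> 'M[R]_(p, q)) :
  mx_cts M -> mx_cts N -> mx_cts (fun t => M t - N t).
Proof. by move=> Mc Nc; apply: mx_ctsD => //; exact: mx_ctsN. Qed.

Lemma mx_ctsM p q r (M : T -> 'M[R]_(p, q)) (N : T -> 'M[R]_(q, r)) :
  mx_cts M -> mx_cts N -> mx_cts (fun t => M t *m N t).
Proof.
move=> Mc Nc i j; rewrite (_ : (fun _ => _) = fun t => \sum_k M t i k * N t k j).
  by apply: continuous_sum_for => k; exact: continuousM.
by apply/funext => t; rewrite mxE.
Qed.

Lemma mx_cts_tr p q (M : T -> 'M[R]_(p, q)) : mx_cts M -> mx_cts (fun t => (M t)^T).
Proof.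
move=> Mc i j; rewrite (_ : (fun _ => _) = fun t => M t j i); first exact: Mc.
by apply/funext => t; rewrite mxE.
Qed.

Lemma mx_cts_dotp p (M N : T -> 'rV[R]_p) :
  mx_cts M -> mx_cts N -> {for x, continuous (fun t => dotp (M t) (N t))}.
Proof. by move=> Mc Nc; apply: continuous_sum_for => k; exact: continuousM. Qed.

Lemma mx_cts_of p q (M : T -> 'M[R]_(p, q)) : {for x, continuous M} -> mx_cts M.
Proof.
move=> Mc i j; apply: (@continuous_comp _ _ _ M (fun A : 'M[R]_(p, q) => A i j)).
  exact: Mc.
exact: coord_continuous.
Qed.

End EntrywiseContinuity.

Lemma mx_cts_comp (R : realType) (T U : topologicalType) (g : T -> U) x p q
    (M : U -> 'M[R]_(p, q)) :
  {for x, continuous g} -> mx_cts (g x) M -> mx_cts x (M \o g).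
Proof. by move=> gc Mc i j; exact: (continuous_comp gc (Mc i j)). Qed.

Section Chart.
Variables (R : realType) (m : nat) (c : graph_chart R m.+1).
Implicit Types (p x : 'rV[R]_m.+1) (y u : 'rV[R]_m).

Local Notation F := (gc_frame c).
Local Notation phi := (gc_fun c).
Local Notation dir := (gc_dir c).
Local Notation Y := (gc_coord c).

(** Measured along [gc_dir] instead of as a distance: it is exactly additive on vertical lines and
    as regular as [gc_fun]. *)
Definition height p : R := dotp p dir - phi (Y p).

(** The gradient of [height]: a normal to the graph, of length [slope_norm]. *)
Definition conormal y : 'rV[R]_m.+1 := dir - grad phi y *m F.

(** The rows are the coordinate tangent vectors of [gc_param] at [y]. *)
Definition tangent y : 'M[R]_(m, m.+1) := F + (grad phi y)^T *m dir.

(* The induced metric is [1 + u^T u] with [u = grad phi]; [orthonormalizer] is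
   its inverse square root. *)
Definition slope_norm y : R := Num.sqrt (1 + dotp (grad phi y) (grad phi y)).

Definition orthonormalizer y : 'M[R]_m :=
  1%:M - (slope_norm y * (1 + slope_norm y))^-1 *: ((grad phi y)^T *m grad phi y).

Definition tangent_frame y : 'M[R]_(m, m.+1) := orthonormalizer y *m tangent y.

Definition unit_normal y : 'rV[R]_m.+1 := (slope_norm y)^-1 *: conormal y.

Hypothesis FF : F *m F^T = 1%:M.
Hypothesis Fdir : F *m dir^T = 0.
Hypothesis dd : enorm dir = 1.

Lemma dirF : dir *m F^T = 0.
Proof. by rewrite -[LHS]trmxK trmx_mul trmxK Fdir trmx0. Qed.

Lemma dirdir : dir *m dir^T = 1%:M.
Proof.
by rewrite [LHS]mx11_scalar -dotpE -enorm_sqr dd expr1n.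
Qed.

Lemma dotp_dirdir : dotp dir dir = 1.
Proof. by rewrite -enorm_sqr dd expr1n. Qed.

Lemma frame_decomp : F^T *m F + dir^T *m dir = 1%:M.
Proof.
pose O : 'M[R]_(1 + m, m.+1) := col_mx dir F.
have OO : O *m O^T = 1%:M.
  by rewrite tr_col_mx mul_col_row FF Fdir dirF dirdir -scalar_mx_block.
have := mulmx1C OO; rewrite tr_col_mx mul_row_col addrC; exact.
Qed.

Lemma vec_decomp p : p = Y p *m F + dotp p dir *: dir.
Proof.
rewrite -[LHS]mulmx1 -frame_decomp mulmxDr !mulmxA; congr (_ + _).
by rewrite [p *m dir^T]mx11_scalar -dotpE mul_scalar_mx.
Qed.

Lemma slope_norm_sqr y : slope_norm y ^+ 2 = 1 + dotp (grad phi y) (grad phi y).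
Proof. by rewrite sqr_sqrtr // addr_ge0 // dotp_ge0. Qed.

Lemma slope_norm_ge1 y : 1 <= slope_norm y.
Proof.
rewrite -[leLHS]sqrtr1 ler_wsqrtr // lerDl dotp_ge0 //.
Qed.

Lemma slope_norm_gt0 y : 0 < slope_norm y.
Proof. exact: lt_le_trans ltr01 (slope_norm_ge1 y). Qed.

Lemma tangent_frameT y : tangent y *m F^T = 1%:M.
Proof. by rewrite mulmxDl FF -mulmxA dirF mulmx0 addr0. Qed.

Lemma tangent_dir y : tangent y *m dir^T = (grad phi y)^T.
Proof. by rewrite mulmxDl Fdir -mulmxA dirdir mulmx1 add0r. Qed.

Lemma tangent_conormal y : tangent y *m (conormal y)^T = 0.
Proof.
by rewrite linearB /= trmx_mul mulmxBr tangent_dir mulmxA tangent_frameT mul1mx subrr.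
Qed.

Lemma tangent_metric y : tangent y *m (tangent y)^T = 1%:M + (grad phi y)^T *m grad phi y.
Proof.
by rewrite {2}/tangent linearD /= trmx_mul trmxK mulmxDr tangent_frameT mulmxA tangent_dir.
Qed.

Lemma slope_rank1 y (u := grad phi y) :
  (u^T *m u) *m (u^T *m u) = dotp u u *: (u^T *m u).
Proof.
by rewrite mulmxA -(mulmxA _ u) [u *m u^T]mx11_scalar -dotpE mul_mx_scalar scalemxAl.
Qed.

Lemma orthonormalizer_sym y : (orthonormalizer y)^T = orthonormalizer y.
Proof. by rewrite linearB linearZ /= trmx1 trmx_mul trmxK. Qed.

Lemma orthonormalizerP y :
  orthonormalizer y *m (tangent y *m (tangent y)^T) *m (orthonormalizer y)^T = 1%:M.
Proof.
rewrite orthonormalizer_sym tangent_metric /orthonormalizer.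
set u := grad phi y; set a := (X in X *: _); set P := u^T *m u.
have PP : P *m P = dotp u u *: P by exact: slope_rank1.
(* As [P *m P] is a multiple of [P], all factors lie in the span of [1] and [P], and the claim
   becomes one scalar identity in [slope_norm]. *)
have mulE (b d : R) : (1%:M + b *: P) *m (1%:M + d *: P) =
    1%:M + (b + d + b * d * dotp u u) *: P.
  rewrite mulmxDl mul1mx mulmxDr mulmx1 -scalemxAl -scalemxAr PP !scalerA.
  by apply/matrixP => i j; rewrite !mxE; ring.
have r1 := slope_norm_ge1 y; have r2 := slope_norm_sqr y.
have -> : 1%:M + P = 1%:M + 1 *: P by rewrite scale1r.
rewrite -scaleNr !mulE.
rewrite -[RHS]addr0 -[X in _ = _ + X](scale0r P); congr (_ + _ *: _).
rewrite -/u in r2; have -> : dotp u u = slope_norm y ^+ 2 - 1 by rewrite r2 addrC addKr.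
rewrite /a; field.
by rewrite !gt_eqF //; lra.
Qed.

Lemma tangent_frame_orth y : tangent_frame y *m (tangent_frame y)^T = 1%:M.
Proof. by rewrite trmx_mul -!mulmxA (mulmxA (tangent y)) mulmxA orthonormalizerP. Qed.

Lemma tangent_frame_conormal y : tangent_frame y *m (conormal y)^T = 0.
Proof. by rewrite -mulmxA tangent_conormal mulmx0. Qed.

Lemma tangent_frame_normal y : tangent_frame y *m (unit_normal y)^T = 0.
Proof. by rewrite linearZ /= -scalemxAr tangent_frame_conormal scaler0. Qed.

Lemma conormal_sqr y : conormal y *m (conormal y)^T = (slope_norm y ^+ 2)%:M.
Proof.
rewrite {1}/conormal mulmxBl -mulmxA.
have -> : F *m (conormal y)^T = - (grad phi y)^T.
  by rewrite linearB /= mulmxBr Fdir trmx_mul mulmxA FF mul1mx sub0r.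
rewrite mulmxN opprK linearB /= mulmxBr dirdir trmx_mul mulmxA dirF mul0mx subr0.
by rewrite [_ *m _]mx11_scalar -dotpE -raddfD /= slope_norm_sqr.
Qed.

Lemma unit_normalP y : unit_normal y *m (unit_normal y)^T = 1%:M.
Proof.
rewrite linearZ /= -scalemxAr -scalemxAl conormal_sqr scalerA -scalemx1 scalerA.
rewrite -invfM -expr2 mulVf ?scale1r // expf_neq0 // gt_eqF // slope_norm_gt0 //.
Qed.

Lemma conormal_rank1 y :
  (conormal y)^T *m conormal y = slope_norm y ^+ 2 *: ((unit_normal y)^T *m unit_normal y).
Proof.
rewrite /unit_normal [(_ *: conormal y)^T]linearZ /= -scalemxAr -scalemxAl !scalerA.
have r0 : slope_norm y != 0 by rewrite gt_eqF // slope_norm_gt0.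
rewrite -[LHS]scale1r; congr (_ *: _); field; exact: r0.
Qed.

Lemma coord_dir p t : Y (p + t *: dir) = Y p.
Proof. by rewrite /gc_coord mulmxDl -scalemxAl dirF scaler0 addr0. Qed.

Lemma height_dir p t : height (p + t *: dir) = height p + t.
Proof.
by rewrite /height coord_dir dotpDl dotpZl -enorm_sqr dd expr1n mulr1 addrAC.
Qed.

Lemma height_param y : height (gc_param c y) = 0.
Proof.
rewrite height_dir /height {1}dotpE -mulmxA Fdir mulmx0 mxE.
by rewrite /gc_coord -mulmxA FF mulmx1 sub0r addNr.
Qed.

Lemma param_coord p : gc_param c (Y p) = p - height p *: dir.
Proof.
by rewrite [X in _ = X - _](vec_decomp p) /height scalerBl opprB addrA addrAC addrK.
Qed.

End Chart.

Section C2Facts.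
Variables (R : realType) (n : nat) (D : set 'rV[R]_n) (f : 'rV[R]_n -> R).
Hypotheses (oD : open D) (f2 : Ck 2 D f).

Lemma C2_has_grad y : D y -> has_grad f y (grad f y).
Proof. by case: f2 => fd _ Dy; apply: has_grad_grad; exact: fd. Qed.

Lemma C2_has_grad_partial y j : D y -> has_grad (partial j f) y (col j (hess f y))^T.
Proof.
case: f2 => _ fp Dy; have [fd _] := fp j.
have -> : (col j (hess f y))^T = grad (partial j f) y.
  by apply/rowP => i; rewrite !mxE.
by apply: has_grad_grad; exact: fd.
Qed.

Lemma C2_grad_cts y : D y -> mx_cts y (grad f).
Proof.
case: f2 => _ fp Dy i j; have [fd _] := fp j.
rewrite (_ : (fun _ => _) = partial j f); last by apply/funext => z; rewrite mxE.
exact: differentiable_continuous (fd _ Dy).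
Qed.

Lemma C2_hess_cts y : D y -> mx_cts y (hess f).
Proof.
case: f2 => _ fp Dy i j; have [_ fc] := fp j.
rewrite (_ : (fun _ => _) = partial i (partial j f)); last by apply/funext => z; rewrite mxE.
exact: fc.
Qed.

End C2Facts.

Lemma has_grad_sqdist (R : realType) n (x p : 'rV[R]_n) :
  has_grad (fun q => dotp (q - x) (q - x)) p (2 *: (p - x)).
Proof.
have sqD (u v : 'rV[R]_n) : dotp (v + u) (v + u) - dotp u u - 2 * dotp v u = dotp v v :> R.
  by rewrite dotpDl !dotpDr (dotpC u v); ring.
apply/has_gradP => e e0; apply/near_ballP.
have n0 : 0 < n%:R + 1 :> R by rewrite ltr_wpDl.
exists (e / (n%:R + 1)); first by rewrite divr_gt0.
move=> q qp; rewrite dotpZr; have -> : q - x = (q - p) + (p - x) by rewrite addrA subrK.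
rewrite sqD; apply: (le_trans (dotp_normr _ _)); rewrite ler_wpM2r //.
apply: le_trans (ltW (_ : (n%:R + 1) * `|q - p| < e)); last by rewrite mulrC -ltr_pdivlMr.
by rewrite ler_wpM2r // lerDl.
Qed.

(** * Derivatives and tangential block of the test functions *)

Section TestFunction.
Variables (R : realType) (m : nat) (c : graph_chart R m.+1).
Implicit Types (p x : 'rV[R]_m.+1) (y u : 'rV[R]_m).

Local Notation F := (gc_frame c).
Local Notation phi := (gc_fun c).
Local Notation dir := (gc_dir c).
Local Notation Y := (gc_coord c).

Hypothesis FF : F *m F^T = 1%:M.
Hypothesis Fdir : F *m dir^T = 0.
Hypothesis dd : enorm dir = 1.

Variables (D : set 'rV[R]_m) (f : 'rV[R]_m -> R).
Hypotheses (oD : open D) (phi2 : Ck 2 D phi) (f2 : Ck 2 D f).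

Lemma coord_continuous_fun : continuous Y.
Proof. exact: mulmxr_continuous. Qed.

Lemma open_coord_preimage : open [set p | D (Y p)].
Proof. by apply: open_comp => // p _; exact: coord_continuous_fun. Qed.

Lemma has_grad_height p : D (Y p) -> has_grad (height c) p (conormal c (Y p)).
Proof.
move=> Dp; apply: has_gradB; first exact: has_grad_dotp.
rewrite -[F in _ *m F]trmxK; apply: has_grad_comp_lin.
exact: (C2_has_grad phi2).
Qed.

Lemma has_grad_pullback_grad (e : 'rV[R]_m -> R) p j : Ck 2 D e -> D (Y p) ->
  has_grad (fun q => (grad e (Y q) *m F) 0 j) p (col j (F^T *m hess e (Y p) *m F))^T.
Proof.
move=> e2 Dp.
rewrite (_ : (fun q => _) = fun q => \sum_a F a j * partial a e (Y q)); last first.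
  by apply/funext => q; rewrite mxE; apply: eq_bigr => a _; rewrite mxE mulrC.
have -> : (col j (F^T *m hess e (Y p) *m F))^T =
    \sum_a F a j *: ((col a (hess e (Y p)))^T *m F).
  apply/rowP => i; rewrite summxE !mxE; apply: eq_bigr => a _.
  rewrite !mxE mulrC; congr (_ * _); apply: eq_bigr => b _.
  by rewrite !mxE mulrC.
apply: has_grad_sum => a; apply: has_gradZ; rewrite -[F in _ *m F]trmxK.
by apply: (@has_grad_comp_lin _ _ _ (partial a e)); exact: (C2_has_grad_partial e2).
Qed.

Variables (beta K h del : R) (x : 'rV[R]_m.+1) (k : R).

(** One family for all tests: [h = del = k = 0] gives functions touching at a point of the
    hypersurface, while positive [h] and [del] localise the contact above it. The additive constant
    [k] adjusts the value at the contact. *)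
Definition test_fun p : R :=
  f (Y p) + beta * height c p - K * (height c p - h) ^+ 2 - del * dotp (p - x) (p - x) + k.

(** The derivative of [beta s - K (s - h)^2] with respect to the height [s]. *)
Definition test_slope p : R := beta - 2 * K * (height c p - h).

Definition test_grad p : 'rV[R]_m.+1 :=
  grad f (Y p) *m F + test_slope p *: conormal c (Y p) - (2 * del) *: (p - x).

Definition test_hess p : 'M[R]_m.+1 :=
  F^T *m (hess f (Y p) - test_slope p *: hess phi (Y p)) *m F
  - (2 * K) *: ((conormal c (Y p))^T *m conormal c (Y p)) - (2 * del)%:M.

Lemma has_grad_test_slope p : D (Y p) ->
  has_grad test_slope p (- (2 * K) *: conormal c (Y p)).
Proof.
move=> Dp; rewrite scaleNr -[- (_ *: _)]add0r -[in X in _ - X *: _](subr0 (2 * K)).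
have hs := has_gradB (has_grad_height Dp) (has_grad_cst h p).
have := has_gradB (has_grad_cst beta p) (has_gradZ (2 * K) hs).
by rewrite !subr0.
Qed.

Lemma has_grad_test p : D (Y p) -> has_grad test_fun p (test_grad p).
Proof.
move=> Dp.
have hf : has_grad (fun q => f (Y q)) p (grad f (Y p) *m F).
  rewrite -[F in _ *m F]trmxK; apply: has_grad_comp_lin; exact: (C2_has_grad f2).
have hh := has_grad_height Dp.
have hhh := has_gradB hh (has_grad_cst h p).
have hsq := has_gradM hhh hhh.
have hd := has_grad_sqdist x p.
have := has_gradD (has_gradB (has_gradB (has_gradD hf (has_gradZ beta hh))
  (has_gradZ K hsq)) (has_gradZ del hd)) (has_grad_cst k p).
rewrite -[F]/(gc_frame c); set g := (X in has_grad _ _ X).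
have -> : g = test_grad p.
  rewrite /g /test_grad /test_slope; set C := conormal _ _; set A := grad f _ *m _.
  by apply/rowP => i; rewrite !mxE; ring.
by apply: has_grad_near; near=> q; rewrite /test_fun expr2.
Unshelve. all: by end_near. Qed.

Lemma test_grad_col (A B : 'M[R]_m.+1) (C : 'rV[R]_m.+1) j (s cj a b : R) : C 0 j = cj ->
  (col j A)^T + (s *: (0 - (col j B)^T) + cj *: (- a *: C)) - b *: (delta_mx 0 j - 0)
  = (col j (A - s *: B - a *: (C^T *m C) - b%:M))^T.
Proof.
move=> <-; apply/rowP => i; rewrite !mxE big_ord1 !mxE !eqxx /=.
by case: (i == j); rewrite ?mulr1n ?mulr0n; ring.
Qed.

Lemma has_grad_test_grad p j : D (Y p) ->
  has_grad (fun q => test_grad q 0 j) p (col j (test_hess p))^T.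
Proof.
move=> Dp.
have hf := has_grad_pullback_grad j f2 Dp.
have hphi := has_grad_pullback_grad j phi2 Dp.
have hC := has_gradB (has_grad_cst (dir 0 j) p) hphi.
have hs := has_gradM (has_grad_test_slope Dp) hC.
have hx := has_gradB (has_grad_dotp (delta_mx 0 j) p) (has_grad_cst (x 0 j) p).
have := has_gradB (has_gradD hf hs) (has_gradZ (2 * del) hx).
have -> : test_hess p = F^T *m hess f (Y p) *m F -
    test_slope p *: (F^T *m hess phi (Y p) *m F) -
    (2 * K) *: ((conormal c (Y p))^T *m conormal c (Y p)) - (2 * del)%:M.
  by rewrite /test_hess mulmxBr mulmxBl -scalemxAr -scalemxAl.
rewrite -(@test_grad_col _ _ _ _ _ (dir 0 j - (grad phi (Y p) *m F) 0 j)); last by rewrite !mxE.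
by apply: has_grad_near; near=> q; rewrite dotp_delta !mxE.
Unshelve. all: by end_near. Qed.

Lemma test_slope_cts p : D (Y p) -> {for p, continuous test_slope}.
Proof. by move=> Dp; apply: has_grad_continuous; exact: has_grad_test_slope. Qed.

Lemma conormal_cts p : D (Y p) -> mx_cts p (conormal c \o Y).
Proof.
move=> Dp; apply: (@mx_cts_comp _ _ _ Y _ _ _ (conormal c)); first exact: coord_continuous_fun.
apply: mx_ctsB; first exact: mx_cts_cst.
by apply: mx_ctsM; [exact: (C2_grad_cts phi2)|exact: mx_cts_cst].
Qed.

Lemma test_hess_cts p : D (Y p) -> mx_cts p test_hess.
Proof.
move=> Dp; have Yc := @coord_continuous_fun p.
apply: mx_ctsB; last exact: mx_cts_cst.
apply: mx_ctsB; last first.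
  apply: mx_ctsZ; first exact: cst_continuous.
  by apply: mx_ctsM; [apply: mx_cts_tr|]; exact: conormal_cts.
apply: mx_ctsM; last exact: mx_cts_cst.
apply: mx_ctsM; first exact: mx_cts_cst.
apply: mx_ctsB; first exact: (mx_cts_comp Yc (C2_hess_cts f2 Dp)).
by apply: mx_ctsZ; [exact: test_slope_cts|exact: (mx_cts_comp Yc (C2_hess_cts phi2 Dp))].
Qed.

Lemma test_fun_C2 : Ck 2 [set p | D (Y p)] test_fun /\
  forall p, D (Y p) -> hess test_fun p = test_hess p.
Proof.
apply: Ck2_intro => [|p Dp|p j Dp|p i j Dp]; first exact: open_coord_preimage.
- exact: has_grad_test.
- exact: has_grad_test_grad.
- exact: test_hess_cts.
Qed.

Lemma test_Amx p : D (Y p) -> Amx test_fun p =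
  test_fun p *: test_hess p - (2^-1 * dotp (test_grad p) (test_grad p))%:M.
Proof.
move=> Dp; have [_ hE] := test_fun_C2.
by rewrite /Amx hE // enorm_sqr (has_gradE (has_grad_test Dp)).
Qed.

Lemma test_hess_sym p : D (Y p) -> (test_hess p)^T = test_hess p.
Proof.
move=> Dp.
have Xs : (hess f (Y p) - test_slope p *: hess phi (Y p))^T =
    hess f (Y p) - test_slope p *: hess phi (Y p).
  by rewrite linearB linearZ /= (hess_sym oD Dp f2) (hess_sym oD Dp phi2).
rewrite /test_hess; set X := hess f _ - _ in Xs *.
by rewrite 2!linearB /= tr_scalar_mx linearZ /= !trmx_mul !trmxK Xs mulmxA.
Qed.

Lemma Amx_test_sym p : D (Y p) -> (- Amx test_fun p)^T = - Amx test_fun p.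
Proof.
move=> Dp; rewrite test_Amx // linearN linearB linearZ /= tr_scalar_mx.
by rewrite test_hess_sym.
Qed.

(* In the orthonormal frame, the tangential block of [- Amx] at the point with
   coordinates [y]; [a] is the value, [g] the gradient, [b] the slope along
   [gc_dir] of the test function. *)
Definition tangent_block y (a : R) (g : 'rV[R]_m.+1) (b d : R) : 'M[R]_m :=
  orthonormalizer c y *m
  ((2^-1 * dotp g g) *: (tangent c y *m (tangent c y)^T)
   - a *: (hess f y - b *: hess phi y - d *: (tangent c y *m (tangent c y)^T)))
  *m (orthonormalizer c y)^T.

(** The tangent rows annihilate the conormal, which removes the second normal derivative [2 K]: in
    the block, [K] survives only through the value, the gradient and the slope. *)
Lemma compress_Amx p : D (Y p) ->
  tangent_frame c (Y p) *m (- Amx test_fun p) *m (tangent_frame c (Y p))^T =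
  tangent_block (Y p) (test_fun p) (test_grad p) (test_slope p) (2 * del).
Proof.
move=> Dp; rewrite test_Amx // /tangent_block /tangent_frame trmx_mul !mulmxA.
rewrite -!(mulmxA (orthonormalizer c (Y p))); congr (_ *m _).
congr (_ *m _).
set J := tangent c (Y p); set C := conormal c (Y p).
have JF : J *m F^T = 1%:M by exact: tangent_frameT.
have FJ : F *m J^T = 1%:M by rewrite -[F]trmxK -trmx_mul JF trmx1.
have JC : J *m C^T = 0 by exact: tangent_conormal.
rewrite mulmxN mulNmx mulmxBr mulmxBl opprB mul_mx_scalar -scalemxAl; congr (_ - _).
rewrite -scalemxAr -scalemxAl; congr (_ *: _).
rewrite /test_hess -/C mulmxBr mulmxBl mulmxBr mulmxBl mul_mx_scalar -scalemxAl; congr (_ - _).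
rewrite -scalemxAr !mulmxA JC !mul0mx scaler0 mul0mx subr0.
by rewrite JF !mul1mx -!mulmxA FJ !mulmx1.
Qed.

End TestFunction.

(** * One-sided expansions along the hypersurface *)

Lemma segment_ball (R : realType) n (x p v : 'rV[R]_n) (r t : R) :
  `|p - x| < r -> `|p + v - x| < r -> 0 <= t <= 1 -> `|p + t *: v - x| < r.
Proof.
move=> pr pvr /andP[t0 t1].
have -> : p + t *: v - x = (1 - t) *: (p - x) + t *: (p + v - x).
  by apply/rowP => i; rewrite !mxE; ring.
apply: (le_lt_trans (ler_normD _ _)); rewrite !normrZ !ger0_norm ?subr_ge0 //.
have [->|tn0] := eqVneq t 0; first by rewrite mul0r addr0 subr0 mul1r.
have tp : 0 < t by rewrite lt_neqAle eq_sym tn0.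
have : (1 - t) * `|p - x| <= (1 - t) * r by rewrite ler_wpM2l ?subr_ge0 // ltW.
have : t * `|p + v - x| < t * r by rewrite ltr_pM2l.
lra.
Qed.

Lemma mx_cts_norm (R : realType) (T : topologicalType) n (g : T -> 'rV[R]_n) x (e : R) :
  mx_cts x g -> 0 < e -> \forall y \near x, `|g y - g x| <= e.
Proof.
move=> gc e0; have h j : \forall y \near x, `|g y 0 j - g x 0 j| < e.
  exact: (continuous_near (gc 0 j) e0).
have nh : \forall y \near x, forall j, `|g y 0 j - g x 0 j| < e by exact: filter_forall.
apply: filterS nh => y hy; apply: mx_norm_le => [|i j]; first exact: ltW.
by rewrite ord1 !mxE ltW.
Qed.

Lemma within_continuous_near (R : realType) (T : topologicalType) (V : normedModType R)
    (f : T -> V) (A : set T) x (e : R) :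
  {within A, continuous f} -> A x -> 0 < e -> \forall y \near x, A y -> `|f y - f x| <= e.
Proof.
move=> /subspace_continuousP/(_ x) fc Ax e0.
have /cvgrPdist_le/(_ _ e0) := fc Ax.
rewrite near_withinE; apply: filterS => y h Ay; rewrite distrC; exact: h.
Qed.

Lemma strict_differentiability (R : realType) n (f : 'rV[R]_n -> R)
    (g : 'rV[R]_n -> 'rV[R]_n) x (e : R) :
  (\forall y \near x, has_grad f y (g y)) -> mx_cts x g -> 0 < e ->
  exists2 r : R, 0 < r & forall p q, `|p - x| < r -> `|q - x| < r ->
    `|f q - f p - dotp (q - p) (g x)| <= e * `|q - p|.
Proof.
move=> fg gc e0; have n0 : 0 < n%:R + 1 :> R by rewrite ltr_wpDl.
have gn := mx_cts_norm gc (divr_gt0 e0 n0).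
have /near_ballP[r r0 hr] : \forall y \near x, has_grad f y (g y) /\ `|g y - g x| <= e / (n%:R + 1).
  exact: (@filterI _ (nbhs x) _ _ _ fg gn).
exists r => // p q pr qr.
have seg (t : R) : 0 <= t <= 1 -> `|p + t *: (q - p) - x| < r.
  by move=> t01; apply: segment_ball => //; rewrite subrKC.
have [t t01] := line_MVT (f := f) (x := p) (v := q - p) (g := g)
  (fun t t01 => (hr _ (seg t (ltac:(case/andP: t01 => *; apply/andP; split; exact: ltW)))).1)
  (fun t t01 => has_grad_continuous (hr _ (seg t t01)).1).
have {}t01 : 0 <= t <= 1 by case/andP: t01 => *; apply/andP; split; exact: ltW.
rewrite subrKC => ->; rewrite -dotpBr.
apply: (le_trans (dotp_normr _ _)).
have [_ gt] := hr _ (seg t t01).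
rewrite mulrAC ler_wpM2r //; apply: (@le_trans _ _ (n%:R * (e / (n%:R + 1)))).
  by rewrite ler_wpM2l.
by rewrite mulrCA ler_piMr ?(ltW e0) // ler_pdivrMr // mul1r lerDl.
Qed.

(** The set of parameters sent into [A] is open and, being the complement of those sent into [B],
    closed in the connected unit interval. *)
Lemma segment_stays (R : realType) n (A B : set 'rV[R]_n) (p v : 'rV[R]_n) :
  open A -> open B -> A `&` B = set0 ->
  (forall t : R, 0 <= t <= 1 -> A (p + t *: v) \/ B (p + t *: v)) ->
  A p -> A (p + v).
Proof.
move=> oA oB AB0 AB Ap; pose l (t : R) := p + t *: v.
have lc : continuous l by exact: continuous_line.
have AnB y : A y -> ~ B y by move=> Ay By; have : (A `&` B) y by []; rewrite AB0.
pose I := [set t : R | 0 <= t <= 1].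
have -> : p + v = l 1 by rewrite /l scale1r.
have cI : connected I.
  have -> : I = `[0, 1]%classic by apply/seteqP; split => t /=; rewrite in_itv.
  exact: segment_connected.
have /(_ _ _ _)/= := cI (I `&` l @^-1` A).
have h0 : (I `&` l @^-1` A) !=set0.
  by exists 0; split; rewrite /I /l /= ?lexx ?ler01 // scale0r addr0.
have h1 : exists2 C : set R, open C & I `&` l @^-1` A = I `&` C.
  exists (l @^-1` A) => //; apply: open_comp => // t _; exact: lc.
have h2 : exists2 C : set R, closed C & I `&` l @^-1` A = I `&` C.
  exists (~` (l @^-1` B)).
    by apply: open_closedC; apply: open_comp => // t _; exact: lc.
  apply/seteqP; split => t /= [It h]; split => //; first exact: AnB.
  by case: (AB t It).
move=> /(_ h0 h1 h2) E; have : I 1 by rewrite /I /= ler01 lexx.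
by rewrite -E => -[].
Qed.

Section OneSided.
Variables (R : realType) (m : nat) (c : graph_chart R m.+1).
Implicit Types (p q x : 'rV[R]_m.+1).

Local Notation F := (gc_frame c).
Local Notation phi := (gc_fun c).
Local Notation dir := (gc_dir c).
Local Notation Y := (gc_coord c).

Hypothesis FF : F *m F^T = 1%:M.
Hypothesis Fdir : F *m dir^T = 0.
Hypothesis dd : enorm dir = 1.

Variables (D : set 'rV[R]_m) (U : set 'rV[R]_m.+1).
Hypotheses (oD : open D) (phi2 : Ck 2 D phi) (oU : open U).
Hypothesis UD : forall p, U p -> D (Y p).

Lemma dir_norm_le1 : `|dir| <= 1.
Proof.
have := norm_sqr_le_dotp dir; rewrite -enorm_sqr dd expr1n.
by rewrite -[leRHS](expr1n _ 2) ler_pXn2r ?nnegrE.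
Qed.

Lemma near_U x : U x -> \forall y \near x, U y.
Proof. by move=> Ux; exact: open_nbhs_nbhs. Qed.

Lemma height_lipschitz x : U x -> exists r L : R, [/\ 0 < r, 0 < L,
  forall p, `|p - x| < r -> U p &
  forall p q, `|p - x| < r -> `|q - x| < r ->
    `|height c q - height c p| <= L * `|q - p|].
Proof.
move=> Ux; have nU := near_U Ux.
have hg : \forall y \near x, has_grad (height c) y (conormal c (Y y)).
  by apply: filterS nU => y Uy; apply: (has_grad_height phi2); exact: UD.
have hc : mx_cts x (conormal c \o Y) by apply: (conormal_cts phi2); exact: UD.
have [r1 r10 h1] := strict_differentiability hg hc ltr01.
have /near_ballP[r2 r20 h2] := nU.
exists (Num.min r1 r2), (m.+1%:R * `|conormal c (Y x)| + 1); split.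
- by rewrite lt_min r10 r20.
- by rewrite ltr_wpDl // mulr_ge0.
- by move=> p; rewrite lt_min => /andP[_]; exact: h2.
- move=> p q; rewrite !lt_min => /andP[p1 _] /andP[q1 _].
  have := h1 p q p1 q1; rewrite mul1r => h.
  have -> : height c q - height c p = (height c q - height c p -
    dotp (q - p) ((conormal c \o Y) x)) + dotp (q - p) (conormal c (Y x)) by rewrite subrK.
  apply: (le_trans (ler_normD _ _)); rewrite addrC mulrDl mul1r lerD //.
  by rewrite dotpC dotp_normr.
Qed.

Definition upper_side x (r : R) (A : set 'rV[R]_m.+1) :=
  forall p, `|p - x| < r -> 0 < height c p -> A p.

(* Two points on or above the hypersurface are joined by a path of controlled
   length above it: up along [gc_dir], across, and down again. *)
Lemma detour x : U x -> exists2 M : R, 0 < M & forall r : R, 0 < r ->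
  exists2 r' : R, 0 < r' & forall p q, `|p - x| < r' -> `|q - x| < r' -> 0 <= height c p -> 0 <= height c q ->
  p != q -> forall t : R, 0 <= t <= 1 ->
  let T := M * `|q - p| in
  [/\ `|p + t *: (T *: dir) - x| < r, `|q + t *: (T *: dir) - x| < r &
      `|p + T *: dir + t *: (q - p) - x| < r] /\
  [/\ 0 < t -> 0 < height c (p + t *: (T *: dir)),
      0 < t -> 0 < height c (q + t *: (T *: dir)) &
      0 < height c (p + T *: dir + t *: (q - p))].
Proof.
move=> Ux; have [r1 [L [r10 L0 h1 h2]]] := height_lipschitz Ux.
(* A lift by [(L + 1) |q - p|] outweighs the loss of height on the way across, which is at most
   [L |q - p|]. *)
pose M := L + 1; have M0 : 0 < M by rewrite /M; lra.
exists M => // r r0.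
pose r2 := Num.min r r1; have r20 : 0 < r2 by rewrite lt_min r0 r10.
have M20 : 0 < 2 + 2 * M by lra.
(* The radius leaves room for the lift, whose length is below [2 M] times it. *)
have r'0 : 0 < r2 / (2 + 2 * M) by rewrite divr_gt0.
set rho := r2 / _ in r'0; have rE : rho * (2 + 2 * M) = r2 by rewrite divfK ?gt_eqF.
have r2r : r2 <= r by rewrite ge_min lexx.
have r2r1 : r2 <= r1 by rewrite ge_min lexx orbT.
exists rho => // p q px qx hp hq pq t t01 T.
have TE : T = M * `|q - p| by []; clearbody T.
have qp : `|q - p| < 2 * rho.
  have -> : q - p = (q - x) - (p - x) by rewrite opprB addrA subrK.
  by apply: (le_lt_trans (ler_normB _ _)); lra.
have qp0 : 0 < `|q - p| by rewrite normr_gt0 subr_eq0 eq_sym.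
have T0 : 0 < T by rewrite TE mulr_gt0.
have Tr : T < M * (2 * rho) by rewrite TE ltr_pM2l.
have up (z : 'rV[R]_m.+1) (s : R) : `|z - x| < rho -> 0 <= s <= 1 ->
    `|z + s *: (T *: dir) - x| < r2.
  move=> zx /andP[s0 s1]; rewrite addrAC; apply: (le_lt_trans (ler_normD _ _)).
  have : `|s *: (T *: dir)| <= T.
    rewrite !normrZ (ger0_norm s0) (gtr0_norm T0).
    rewrite -[leRHS]mul1r ler_pM ?mulr_ge0 ?(ltW T0) //.
    by rewrite -[leRHS]mulr1 ler_wpM2l ?(ltW T0) // dir_norm_le1.
  by lra.
have hup (z : 'rV[R]_m.+1) (s : R) : height c (z + s *: (T *: dir)) = height c z + s * T.
  by rewrite scalerA height_dir.
have across : `|p + T *: dir + t *: (q - p) - x| < r2.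
  have e1 : 0 <= (1 : R) <= 1 by apply/andP; split; lra.
  have := up p 1 px e1; have := up q 1 qx e1; rewrite !scale1r => qT pT.
  apply: segment_ball => //.
  by have -> : p + T *: dir + (q - p) = q + T *: dir by rewrite addrAC subrKC.
split; first by split; apply: lt_le_trans r2r; [exact: up|exact: up|exact: across].
split=> [t0|t0|]; [by rewrite hup ltr_wpDl // mulr_gt0|by rewrite hup ltr_wpDl // mulr_gt0|].
rewrite addrAC height_dir //.
have rho1 : rho < r1 by apply: lt_le_trans r2r1; rewrite -rE; nra.
have pt : `|p + t *: (q - p) - x| < r1.
  apply: segment_ball => //; last by rewrite subrKC; lra.
  by lra.
have := h2 _ _ (lt_trans px rho1) pt.
have -> : p + t *: (q - p) - p = t *: (q - p) by rewrite addrC addKr.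
rewrite normrZ; case/andP: t01 => t0 t1; rewrite (ger0_norm t0) ler_norml => /andP[h _].
have : L * (t * `|q - p|) <= L * `|q - p|.
  by rewrite ler_wpM2l ?(ltW L0) // ler_piMl.
rewrite TE /M mulrDl mul1r; lra.
Qed.

Variables (w : 'rV[R]_m.+1 -> R) (G : 'rV[R]_m.+1 -> 'rV[R]_m.+1) (A : set 'rV[R]_m.+1).
Hypothesis wc : forall p, U p -> {for p, continuous w}.
Hypothesis wG : forall p, A p -> has_grad w p (G p).
Hypothesis Gc : {within closure A, continuous G}.

Lemma upper_closure x r : 0 < r -> upper_side x r A -> 0 <= height c x -> closure A x.
Proof.
move=> r0 xA hx V /near_ballP[d d0 hd].
have min0 : 0 < Num.min d r by rewrite lt_min d0 r0.
pose t := Num.min d r / 2; have t0 : 0 < t by rewrite divr_gt0.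
have td : t < Num.min d r by rewrite /t; lra.
have nt : `|x + t *: dir - x| < Num.min d r.
  have -> : x + t *: dir - x = t *: dir by rewrite addrC addKr.
  rewrite normrZ gtr0_norm //; apply: le_lt_trans td; rewrite ler_piMr ?(ltW t0) //; exact: dir_norm_le1.
move: nt; rewrite lt_min => /andP[nd nr].
exists (x + t *: dir); split; last exact: hd.
by apply: xA => //; rewrite height_dir // ltr_wpDl.
Qed.

(** The segment from [p] to [q] may cross the hypersurface, so the mean value theorem is applied on
    the three legs of [detour]. The two vertical legs cancel up to the oscillation of [G] near [x],
    and all legs have length O([|q - p|]). *)
Lemma one_sided_expansion x (r e : R) : U x -> 0 <= height c x -> 0 < r ->
  upper_side x r A -> 0 < e ->
  exists2 r' : R, 0 < r' & forall p q, `|p - x| < r' -> `|q - x| < r' ->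
    0 <= height c p -> 0 <= height c q ->
    `|w q - w p - dotp (q - p) (G x)| <= e * `|q - p|.
Proof.
move=> Ux hx r0 xA e0; have Ax := upper_closure r0 xA hx.
have [r1 [L [r10 _ U1 _]]] := height_lipschitz Ux.
have [M M0 detourM] := detour Ux.
set n := m.+1%:R : R; have n0 : 0 < n by rewrite ltr0n.
(* Each vertical leg costs [M n om |q - p|] and the horizontal one [n om |q - p|], where [om] bounds
   the oscillation of [G]. *)
pose C := n * (2 * M + 1); have C0 : 0 < C by rewrite mulr_gt0 //; lra.
pose om := e / C; have om0 : 0 < om by rewrite divr_gt0.
have /near_ballP[r2 r20 hr2] := within_continuous_near Gc Ax om0.
pose r3 := Num.min r (Num.min r1 r2).
have r30 : 0 < r3 by rewrite !lt_min r0 r10 r20.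
have [r' r'0 path] := detourM r3 r30.
exists r' => // p q px qx hp hq.
have [->|pq] := eqVneq p q; first by rewrite !subrr /dotp big1 ?subrr ?normr0 ?mulr0 // => i _; rewrite mxE mul0r.
have {}path := path p q px qx hp hq pq; cbv zeta in path.
set T := M * `|q - p| in path.
have r3P z : `|z - x| < r3 -> [/\ `|z - x| < r, U z & `|z - x| < r2].
  by rewrite !lt_min => /and3P[? ? ?]; split => //; exact: U1.
have AP z : `|z - x| < r3 -> 0 < height c z -> has_grad w z (G z) /\ `|G z - G x| <= om.
  case/r3P => zr Uz zr2 hz; have Az : A z by exact: xA.
  by split; [exact: wG|apply: hr2 => //; exact: subset_closure].
have cP z : `|z - x| < r3 -> {for z, continuous w} by case/r3P => _ Uz _; exact: wc.
have lew (t : R) : 0 < t < 1 -> 0 <= t <= 1 by move=> /andP[/ltW -> /ltW ->].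
have gt0w (t : R) : 0 < t < 1 -> 0 < t by case/andP.
have [t1 t1P e1] := line_MVT (f := w) (x := p) (v := T *: dir) (g := G)
  (fun t tP => (AP _ (let: conj (And3 a _ _) _ := path t (lew t tP) in a)
     (let: conj _ (And3 a _ _) := path t (lew t tP) in a (gt0w t tP))).1)
  (fun t tP => cP _ (let: conj (And3 a _ _) _ := path t tP in a)).
have [t2 t2P e2] := line_MVT (f := w) (x := q) (v := T *: dir) (g := G)
  (fun t tP => (AP _ (let: conj (And3 _ a _) _ := path t (lew t tP) in a)
     (let: conj _ (And3 _ a _) := path t (lew t tP) in a (gt0w t tP))).1)
  (fun t tP => cP _ (let: conj (And3 _ a _) _ := path t tP in a)).
have [t3 t3P e3] := line_MVT (f := w) (x := p + T *: dir) (v := q - p) (g := G)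
  (fun t tP => (AP _ (let: conj (And3 _ _ a) _ := path t (lew t tP) in a)
     (let: conj _ (And3 _ _ a) := path t (lew t tP) in a)).1)
  (fun t tP => cP _ (let: conj (And3 _ _ a) _ := path t tP in a)).
have [[c1 _ _] [/(_ (gt0w _ t1P)) h1 _ _]] := path _ (lew _ t1P).
have [[_ c2 _] [_ /(_ (gt0w _ t2P)) h2 _]] := path _ (lew _ t2P).
have [[_ _ c3] [_ _ h3]] := path _ (lew _ t3P).
have [_ g1] := AP _ c1 h1; have [_ g2] := AP _ c2 h2; have [_ g3] := AP _ c3 h3.
set z1 := p + t1 *: _ in e1 g1; set z2 := q + t2 *: _ in e2 g2.
set z3 := p + T *: dir + t3 *: _ in e3 g3.
have eqT : p + T *: dir + (q - p) = q + T *: dir by rewrite addrAC subrKC.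
rewrite eqT in e3.
have -> : w q - w p - dotp (q - p) (G x) =
    T * dotp dir (G z1 - G x) - T * dotp dir (G z2 - G x) + dotp (q - p) (G z3 - G x).
  rewrite !dotpBr -e3; have := e1; have := e2; rewrite !dotpZl; lra.
have T0 : 0 <= T by rewrite mulr_ge0 // ltW.
have bd z : `|G z - G x| <= om -> `|T * dotp dir (G z - G x)| <= T * (n * om).
  move=> gz; rewrite normrM (ger0_norm T0) ler_wpM2l //.
  apply: (le_trans (dotp_normr _ _)); rewrite -/n.
  rewrite ler_pM ?mulr_ge0 ?(ltW n0) // -[leRHS]mulr1 ler_wpM2l ?(ltW n0) //.
  exact: dir_norm_le1.
have bd3 : `|dotp (q - p) (G z3 - G x)| <= n * `|q - p| * om.
  by apply: (le_trans (dotp_normr _ _)); rewrite -/n ler_wpM2l // mulr_ge0 // ltW.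
have -> : e * `|q - p| = T * (n * om) + T * (n * om) + n * `|q - p| * om.
  by rewrite -[e](divfK (_ : C != 0)) ?gt_eqF // -/om /C /T; ring.
apply: (le_trans (ler_normD _ _)); rewrite lerD //.
by apply: (le_trans (ler_normB _ _)); rewrite lerD // bd.
Qed.

Variable B : set 'rV[R]_m.+1.
Hypotheses (oA : open A) (oB : open B) (AB0 : A `&` B = set0).
Hypothesis coverAB : forall p, U p -> height c p != 0 -> A p \/ B p.

(** Points of positive height near [x] are joined by detours that avoid the hypersurface, so they
    all lie in the same one of the two sets; a point vertically above [x] decides which. *)
Lemma upper_side_dichotomy x : U x -> 0 <= height c x -> exists2 r : R, 0 < r &
  upper_side x r A \/ upper_side x r B.
Proof.
move=> Ux hx; have [M M0 detourM] := detour Ux.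
have [r1 [L [r10 _ U1 _]]] := height_lipschitz Ux.
have [r' r'0 path] := detourM r1 r10.
have move S1 S2 p q : open S1 -> open S2 -> S1 `&` S2 = set0 ->
    (forall z, U z -> height c z != 0 -> S1 z \/ S2 z) ->
    `|p - x| < r' -> `|q - x| < r' -> 0 < height c p -> 0 < height c q ->
    S1 p -> S1 q.
  move=> o1 o2 S12 cov px qx hp hq Sp.
  have [<-//|pq] := eqVneq p q.
  have {}path := path p q px qx (ltW hp) (ltW hq) pq; cbv zeta in path.
  set T := M * `|q - p| in path.
  have T0 : 0 <= T by rewrite mulr_ge0 // ltW.
  have cov' z : `|z - x| < r1 -> 0 < height c z -> S1 z \/ S2 z.
    by move=> zx hz; apply: cov; [exact: U1|rewrite gt_eqF].
  have up z (t : R) : 0 < height c z -> 0 <= t <= 1 -> 0 < height c (z + t *: (T *: dir)).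
    move=> hz /andP[t0 _]; rewrite scalerA height_dir //.
    by rewrite ltr_pwDl // mulr_ge0.
  have S1a : S1 (p + T *: dir).
    apply: (segment_stays o1 o2 S12 _ Sp) => t tP.
    by have [[a _ _] _] := path t tP; apply: cov' => //; exact: up.
  have S1b : S1 (q + T *: dir).
    have <- : p + T *: dir + (q - p) = q + T *: dir by rewrite addrAC subrKC.
    apply: (segment_stays o1 o2 S12 _ S1a) => t tP.
    by have [[_ _ a] [_ _ b]] := path t tP; exact: cov'.
  (* The last leg leads down from [q + T *: dir] to [q]; it is the upward leg of [detour] with [t]
     replaced by [1 - t]. *)
  rewrite -(addrK (T *: dir) q).
  apply: (segment_stays o1 o2 S12 _ S1b) => t tP.
  have t'P : 0 <= 1 - t <= 1 by case/andP: tP => *; apply/andP; split; lra.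
  have -> : q + T *: dir + t *: - (T *: dir) = q + (1 - t) *: (T *: dir).
    by rewrite scalerN -addrA scalerBl scale1r.
  by have [[_ a _] _] := path _ t'P; apply: cov' => //; exact: up.
pose s := r' / 2; have s0 : 0 < s by rewrite divr_gt0.
have sx : `|x + s *: dir - x| < r'.
  have -> : x + s *: dir - x = s *: dir by rewrite addrC addKr.
  rewrite normrZ gtr0_norm //; apply: le_lt_trans (_ : s < r'); last by rewrite /s; lra.
  by rewrite ler_piMr ?(ltW s0) // dir_norm_le1.
have hs : 0 < height c (x + s *: dir) by rewrite height_dir // ltr_wpDl.
have Us : U (x + s *: dir).
  have e1 : x != x + s *: dir.
    by apply: contraTneq s0 => e; have := height_dir Fdir dd x s; rewrite -e; lra.
  (* At parameter 0 the second leg is at its starting point, so this only yields that the reference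
     point lies in the ball contained in [U]. *)
  have [[_ a _] _] := path x (x + s *: dir) (ltac:(by rewrite subrr normr0)) sx hx (ltW hs) e1 0
     (ltac:(by rewrite lexx ler01)).
  by apply: U1; rewrite scale0r addr0 in a.
exists r' => //; case: (coverAB Us (lt0r_neq0 hs)) => h; [left|right] => p px hp.
  exact: (move A B _ p oA oB AB0 coverAB sx px hs hp h).
apply: (move B A _ p oB oA _ _ sx px hs hp h); first by rewrite setIC.
by move=> z Uz hz; case: (coverAB Uz hz); [right|left].
Qed.

End OneSided.

(** * Kinks *)

Section Kink.
Variables (R : realType) (m : nat) (c : graph_chart R m.+1).
Implicit Types (p q x : 'rV[R]_m.+1).

Local Notation F := (gc_frame c).
Local Notation phi := (gc_fun c).
Local Notation dir := (gc_dir c).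
Local Notation Y := (gc_coord c).
Local Notation psi := (gc_param c).

Hypothesis FF : F *m F^T = 1%:M.
Hypothesis Fdir : F *m dir^T = 0.
Hypothesis dd : enorm dir = 1.

Variables (D : set 'rV[R]_m) (w : 'rV[R]_m.+1 -> R).
Local Notation f := (w \o psi).
Hypotheses (oD : open D) (phi2 : Ck 2 D phi) (f2 : Ck 2 D f).

(** Strict differentiability from above, with both points moving: later a point is compared with its
    foot on the graph, not with [x]. *)
Definition upper_expansion x (g : 'rV[R]_m.+1) := forall e : R, 0 < e ->
  exists2 r : R, 0 < r & forall p q, `|p - x| < r -> `|q - x| < r ->
    0 <= height c p -> 0 <= height c q ->
    `|w q - w p - dotp (q - p) g| <= e * `|q - p|.

Definition lower_expansion x (g : 'rV[R]_m.+1) := forall e : R, 0 < e ->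
  exists2 r : R, 0 < r & forall p q, `|p - x| < r -> `|q - x| < r ->
    height c p <= 0 -> height c q <= 0 ->
    `|w q - w p - dotp (q - p) g| <= e * `|q - p|.

Lemma param_coord0 x : height c x = 0 -> psi (Y x) = x.
Proof. by move=> hx; rewrite (param_coord FF Fdir dd) hx scale0r subr0. Qed.

Lemma param_lipschitz y : D y -> exists r C : R, [/\ 0 < r, 0 < C & forall z, `|z - y| < r ->
  `|psi z - psi y| <= C * `|z - y|].
Proof.
move=> Dy; have := (has_gradP _ _ _).1 (C2_has_grad phi2 Dy) 1 ltr01.
move=> /near_ballP[r r0 hr].
exists r, (m%:R * `|F| + (m%:R * `|grad phi y| + 1)); split.
- exact: r0.
- by rewrite ltr_wpDl ?ltr_wpDl ?mulr_ge0.
move=> z zy.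
rewrite /gc_param opprD addrACA -mulmxBl -scalerBl mulrDl.
apply: (le_trans (ler_normD _ _)); rewrite lerD ?mulmx_norm_le // normrZ.
apply: (@le_trans _ _ `|phi z - phi y|).
  by rewrite ler_piMr // dir_norm_le1.
have -> : phi z - phi y = (phi z - phi y - dotp (z - y) (grad phi y)) + dotp (z - y) (grad phi y).
  by rewrite subrK.
apply: (le_trans (ler_normD _ _)); rewrite addrC mulrDl mul1r lerD //.
  by rewrite dotpC dotp_normr.
by have := hr z zy; rewrite mul1r.
Qed.

(** The chain rule along the graph, using only points of height 0, where either expansion applies.
    Consequently the two one-sided gradients have the same tangential part. *)
Lemma trace_grad x g : D (Y x) -> height c x = 0 ->
  (upper_expansion x g \/ lower_expansion x g) ->
  grad f (Y x) = g *m (tangent c (Y x))^T.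
Proof.
move=> Dy hx hg; set y := Y x in Dy *.
have px : psi y = x by exact: param_coord0.
have zero z : height c (psi z) = 0 by exact: height_param.
have {}hg (e : R) : 0 < e -> exists2 r : R, 0 < r & forall z, `|psi z - x| < r ->
    `|f z - f y - dotp (psi z - psi y) g| <= e * `|psi z - psi y|.
  move=> e0; have [r r0 hr] : exists2 r : R, 0 < r & forall p q, `|p - x| < r ->
    `|q - x| < r -> height c p = 0 -> height c q = 0 ->
    `|w q - w p - dotp (q - p) g| <= e * `|q - p|.
    by case: hg => /(_ e e0)[r r0 hr]; exists r => // p q px' qx hp hq; apply: hr => //;
      rewrite ?hp ?hq.
  exists r => // z zx; apply: hr => //; by rewrite px subrr normr0.
have [r1 [C [r10 C0 lip]]] := param_lipschitz Dy.
apply: has_gradE; apply/has_gradP => e e0; apply/near_ballP.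
set b := dotp dir g.
have b0 : 0 < `|b| + 1 by rewrite ltr_wpDl.
have [r2 r20 h2] := hg (e / 2 / C) (divr_gt0 (divr_gt0 e0 (ltr0n _ 2)) C0).
have /near_ballP[r3 r30 h3] := (has_gradP _ _ _).1 (C2_has_grad phi2 Dy)
  (e / 2 / (`|b| + 1)) (divr_gt0 (divr_gt0 e0 (ltr0n _ 2)) b0).
exists (Num.min r1 (Num.min (r2 / C) r3)).
  by rewrite !lt_min r10 r30 divr_gt0.
move=> z; rewrite !lt_min => /and3P[z1 z2 z3].
have lz := lip z z1.
have zx : `|psi z - x| < r2.
  by rewrite -px; apply: (le_lt_trans lz); rewrite mulrC -ltr_pdivlMr.
(* Replacing [psi z - psi y] by its linear part costs the Taylor remainder of [phi] times
   [dotp dir g]. *)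
have E : dotp (psi z - psi y) g - dotp (z - y) (g *m (tangent c y)^T) =
    (phi z - phi y - dotp (z - y) (grad phi y)) * b.
  rewrite -dotp_mulmx /tangent mulmxDr /gc_param opprD addrACA -mulmxBl -scalerBl.
  rewrite !dotpDl dotpZl mulmxA [(z - y) *m (grad phi y)^T]mx11_scalar -dotpE mul_scalar_mx dotpZl -/b.
  rewrite -dotpDl; ring.
have -> : f z - f y - dotp (z - y) (g *m (tangent c y)^T) =
  (f z - f y - dotp (psi z - psi y) g) + (phi z - phi y - dotp (z - y) (grad phi y)) * b.
  by rewrite -E; ring.
have -> : e * `|z - y| = e / 2 * `|z - y| + e / 2 * `|z - y| by rewrite -mulrDl -splitr.
apply: (le_trans (ler_normD _ _)); apply: lerD.
  apply: (le_trans (h2 z zx)); apply: (@le_trans _ _ (e / 2 / C * (C * `|z - y|))).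
    by rewrite ler_wpM2l // !divr_ge0 // ltW.
  by rewrite mulrA divfK // gt_eqF.
rewrite normrM; apply: (@le_trans _ _ (e / 2 / (`|b| + 1) * `|z - y| * (`|b| + 1))).
  by rewrite ler_pM ?h3 // lerDl.
by rewrite mulrAC divfK // gt_eqF.
Qed.

(** An oblique splitting: a vector is recovered from its products with the tangent rows and its
    component along [gc_dir]. With equal tangential parts only the latter can differ between the two
    sides. *)
Lemma normal_decomp y (g : 'rV[R]_m.+1) :
  g = g *m (tangent c y)^T *m F + dotp g dir *: conormal c y.
Proof.
rewrite /tangent /conormal linearD /= trmx_mul trmxK mulmxDr mulmxDl scalerBr.
rewrite mulmxA [g *m dir^T]mx11_scalar -dotpE mul_scalar_mx -scalemxAl.
rewrite addrA addrAC addrK; exact: (vec_decomp FF Fdir dd g).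
Qed.

Lemma near_proj x (r : R) : D (Y x) -> height c x = 0 -> 0 < r ->
  \forall p \near x, [/\ `|p - x| < r, `|p - height c p *: dir - x| < r,
    `|height c p| < r & D (Y p)].
Proof.
move=> Dy hx r0; have r20 : 0 < r / 2 by rewrite divr_gt0.
have nD : \forall p \near x, D (Y p).
  by apply: open_nbhs_nbhs; split => //; exact: open_coord_preimage.
have hc := continuous_near (has_grad_continuous (has_grad_height phi2 Dy)) r20.
have nr : \forall p \near x, `|p - x| < r / 2 by apply/near_ballP; exists (r / 2).
have n2 : \forall p \near x, `|height c p - height c x| < r / 2 /\ `|p - x| < r / 2.
  exact: filterI.
have n3 : \forall p \near x, D (Y p) /\ `|height c p - height c x| < r / 2 /\ `|p - x| < r / 2.
  exact: filterI.
apply: filterS n3 => p [Dp [h1 h2]].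
rewrite hx subr0 in h1.
split=> //; [by lra| |by lra].
rewrite addrAC; apply: (le_lt_trans (ler_normB _ _)).
have : `|height c p *: dir| <= `|height c p|.
  by rewrite normrZ ler_piMr // dir_norm_le1.
by lra.
Qed.

(** Since [f (Y p)] is the value of [w] at the foot of [p], the error is a multiple of the height
    and not of the distance to [x]; only so can it be beaten by a difference of slopes. *)
Lemma upper_vertical_expansion x g (e : R) : D (Y x) -> height c x = 0 ->
  upper_expansion x g -> 0 < e -> \forall p \near x,
    0 <= height c p -> `|w p - f (Y p) - height c p * dotp g dir| <= e * height c p.
Proof.
move=> Dy hx /[swap] e0 /(_ e e0) [r r0 h].
apply: filterS (near_proj Dy hx r0) => p [p1 q1 _ _] hs.
have hq : height c (p - height c p *: dir) = 0.
  by rewrite -scaleNr (height_dir Fdir dd) subrr.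
rewrite /= (param_coord FF Fdir dd); set s := height c p in q1 hq hs *.
have pq : p - (p - s *: dir) = s *: dir by rewrite opprB addrC subrK.
have := h (p - s *: dir) p q1 p1; rewrite hq pq dotpZl (dotpC dir) => /(_ (lexx _) hs).
move/le_trans; apply; rewrite ler_wpM2l ?(ltW e0) // normrZ ger0_norm //.
by rewrite ler_piMr // dir_norm_le1.
Qed.

Lemma lower_vertical_expansion x g (e : R) : D (Y x) -> height c x = 0 ->
  lower_expansion x g -> 0 < e -> \forall p \near x,
    height c p <= 0 -> `|w p - f (Y p) - height c p * dotp g dir| <= e * - height c p.
Proof.
move=> Dy hx /[swap] e0 /(_ e e0) [r r0 h].
apply: filterS (near_proj Dy hx r0) => p [p1 q1 _ _] hs.
have hq : height c (p - height c p *: dir) = 0.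
  by rewrite -scaleNr (height_dir Fdir dd) subrr.
rewrite /= (param_coord FF Fdir dd); set s := height c p in q1 hq hs *.
have pq : p - (p - s *: dir) = s *: dir by rewrite opprB addrC subrK.
have := h (p - s *: dir) p q1 p1; rewrite hq pq dotpZl (dotpC dir) => /(_ (lexx _) hs).
move/le_trans; apply; rewrite ler_wpM2l ?(ltW e0) // normrZ ler0_norm //.
by rewrite ler_piMr ?oppr_ge0 // dir_norm_le1.
Qed.

Lemma vertical_expansion x g1 g2 (e : R) : D (Y x) -> height c x = 0 ->
  upper_expansion x g1 -> lower_expansion x g2 -> 0 < e ->
  \forall p \near x,
    (0 <= height c p -> `|w p - f (Y p) - height c p * dotp g1 dir| <= e * height c p) /\
    (height c p <= 0 -> `|w p - f (Y p) - height c p * dotp g2 dir| <= e * - height c p).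
Proof.
move=> Dy hx h1 h2 e0.
apply: filterS2 (upper_vertical_expansion Dy hx h1 e0)
  (lower_vertical_expansion Dy hx h2 e0) => p u l.
by split.
Qed.

Section AtPoint.
Variable (x : 'rV[R]_m.+1).
Hypotheses (Dx : D (Y x)) (hx : height c x = 0).

Definition kink_test (beta K : R) := test_fun c f beta K 0 0 x 0.

Lemma kink_testE beta K p :
  kink_test beta K p = f (Y p) + beta * height c p - K * height c p ^+ 2.
Proof. by rewrite /kink_test /test_fun mul0r !subr0 addr0. Qed.

Lemma kink_test_x beta K : kink_test beta K x = w x.
Proof. by rewrite kink_testE hx /= param_coord0 //; ring. Qed.

Lemma kink_test_C2 beta K : C2_near x (kink_test beta K).
Proof.
exists [set p | D (Y p)]; split => //; first exact: open_coord_preimage.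
by have [] := test_fun_C2 oD phi2 f2 beta K 0 0 x 0.
Qed.

Lemma kink_Amx beta K : - Amx (kink_test beta K) x = - Amx (kink_test beta 0) x +
  (2 * K * w x * slope_norm c (Y x) ^+ 2) *: ((unit_normal c (Y x))^T *m unit_normal c (Y x)).
Proof.
rewrite /kink_test !(test_Amx oD phi2 f2) // -/(kink_test _ _) -/(kink_test _ _).
rewrite !kink_test_x /test_hess /test_grad /test_slope hx.
have -> : beta - 2 * K * (0 - 0) = beta - 2 * 0 * (0 - 0) by ring.
rewrite conormal_rank1.
set A := _ *m _ *m F; set P := _ *m unit_normal c _; set I := (_ * dotp _ _)%:M.
by apply/matrixP => i j; rewrite !mxE; ring.
Qed.

Lemma kink_compress beta :
  tangent_frame c (Y x) *m (- Amx (kink_test beta 0) x) *m (tangent_frame c (Y x))^T =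
  tangent_block c f (Y x) (w x) (grad f (Y x) *m F + beta *: conormal c (Y x)) beta 0.
Proof.
rewrite (compress_Amx FF Fdir dd oD phi2 f2) // -/(kink_test _ _) kink_test_x.
by rewrite /test_grad /test_slope !mulr0 mul0r scale0r !subr0.
Qed.

Lemma kink_mxsigma beta K j : (j <= m)%N ->
  mxsigma j.+1 (- Amx (kink_test beta K) x) = mxsigma j.+1 (- Amx (kink_test beta 0) x) +
  (2 * K * w x * slope_norm c (Y x) ^+ 2) *
  mxsigma j (tangent_block c f (Y x) (w x) (grad f (Y x) *m F + beta *: conormal c (Y x)) beta 0).
Proof.
move=> jm; set t := 2 * K * _ * _.
have E := mxsigma_add_rank1 (- Amx (kink_test beta 0) x) t (tangent_frame_orth FF Fdir dd (Y x))
  (tangent_frame_normal FF Fdir dd (Y x)) (unit_normalP FF Fdir dd (Y x)) jm.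
rewrite kink_compress in E.
rewrite -[RHS]E.
congr (mxsigma _ _).
exact: kink_Amx.
Qed.

Lemma kink_sigma beta K j : (j <= m.+1)%N ->
  sigma j (eigvals (- Amx (kink_test beta K) x)) = mxsigma j (- Amx (kink_test beta K) x).
Proof.
move=> jm; apply: sigma_eigvals => //; apply: sym_char_poly_splits.
exact: (Amx_test_sym oD phi2 f2).
Qed.

Variables (k : nat) (Omega : set 'rV[R]_m.+1).
Hypotheses (k_gt0 : (0 < k)%N) (km : (k <= m.+1)%N) (wpos : 0 < w x) (Ox : Omega x).
Hypotheses (wsup : viscosity_supersolution k Omega w) (wsub : viscosity_subsolution k Omega w).
Variables (g1 g2 : 'rV[R]_m.+1).
Hypotheses (h1 : upper_expansion x g1) (h2 : lower_expansion x g2).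

Lemma kink_scale_gt0 : 0 < w x * slope_norm c (Y x) ^+ 2.
Proof. by rewrite mulr_gt0 ?exprn_gt0 // slope_norm_gt0. Qed.

(* A convex kink is touched from below with an arbitrarily large second normal
   derivative, which makes the trace of [- Amx] negative. *)
Lemma no_convex_kink : dotp g1 dir <= dotp g2 dir.
Proof.
rewrite leNgt; apply/negP => b21.
(* With the mean slope, [w - f - beta s] is at least [gam |s|] up to the expansion error. *)
pose beta := (dotp g1 dir + dotp g2 dir) / 2.
pose gam := (dotp g1 dir - dotp g2 dir) / 2.
have gam0 : 0 < gam by rewrite divr_gt0 // subr_gt0.
set a := mxsigma 1 (- Amx (kink_test beta 0) x).
have s0 := kink_scale_gt0; set s := w x * _ in s0.
(* Makes the rank-one contribution to the trace equal to [- (|a| + 1)], whatever the trace [a] for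
   [K = 0] is. *)
pose K := (`|a| + 1) / (2 * s); 
have a0 : 0 < `|a| + 1 by rewrite ltr_wpDl.
have s20 : 0 < 2 * s by lra.
have K0 : 0 < K by exact: divr_gt0.
have gam20 : 0 < gam / 2 by rewrite divr_gt0.
have K20 : 0 < 2 * K by lra.
(* At heights below this value [K s^2 <= gam / 2 * |s|]; the other half of [gam |s|] absorbs the
   expansion error. *)
have rK : 0 < gam / (2 * K) by rewrite divr_gt0.
have ve := vertical_expansion Dx hx h1 h2 gam20.
have np := near_proj Dx hx rK.
have below : \forall p \near x, kink_test beta (- K) p <= w p.
  apply: filterS2 np ve => p [_ _ hp _] [up low].
  rewrite kink_testE; set t := height c p in hp up low *.
  have Kt : K * t ^+ 2 <= gam / 2 * `|t|.
    rewrite -real_normK ?num_real // expr2 mulrA ler_wpM2r //.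
    rewrite -ler_pdivlMl // mulrC; apply: le_trans (ltW hp) _.
    by rewrite le_eqVlt; apply/orP; left; apply/eqP; field; rewrite gt_eqF.
  have [t0|t0] := lerP 0 t.
    have := up t0; rewrite ler_norml => /andP[h _]; rewrite ger0_norm // in Kt.
    by move: h Kt; rewrite /beta /gam; lra.
  have := low (ltW t0); rewrite ler_norml => /andP[h _]; rewrite ltr0_norm // in Kt.
  by move: h Kt; rewrite /beta /gam; lra.
have posn : \forall p \near x, 0 < kink_test beta (- K) p.
  have cx : {for x, continuous (kink_test beta (- K))}.
    exact: has_grad_continuous (has_grad_test phi2 f2 _ _ _ _ _ _ Dx).
  apply: filterS (continuous_near cx wpos) => p.
  by rewrite kink_test_x ltr_norml => /andP[h _]; lra.
have [G _] := wsup Ox (kink_test_C2 beta (- K)) posn below (kink_test_x _ _).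
have := G 1%N; rewrite k_gt0 => /(_ isT).
rewrite kink_sigma // kink_mxsigma // mxsigma0 mulr1 -/a.
have -> : 2 * - K * w x * slope_norm c (Y x) ^+ 2 = - (`|a| + 1).
  by rewrite /K /s; field; rewrite !gt_eqF ?slope_norm_gt0.
have := ler_norm a; lra.
Qed.

(* A concave kink is touched from above with an arbitrarily negative second
   normal derivative. *)
Lemma concave_kink beta : dotp g1 dir < beta < dotp g2 dir ->
  ~ (forall j, (j < k)%N -> 0 < mxsigma j (tangent_block c f (Y x) (w x)
       (grad f (Y x) *m F + beta *: conormal c (Y x)) beta 0)).
Proof.
move=> /andP[b1 b2] tb.
have s0 := kink_scale_gt0; set s := w x * _ in s0.
pose gam := Num.min (beta - dotp g1 dir) (dotp g2 dir - beta).
have gam0 : 0 < gam by rewrite lt_min !subr_gt0 b1 b2.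
have gam1 : gam <= beta - dotp g1 dir by rewrite ge_min lexx.
have gam2 : gam <= dotp g2 dir - beta by rewrite ge_min lexx orbT.
pose a j := mxsigma j.+1 (- Amx (kink_test beta 0) x).
pose b j := mxsigma j (tangent_block c f (Y x) (w x)
       (grad f (Y x) *m F + beta *: conormal c (Y x)) beta 0).
(* A sum of nonnegative terms dominates each of the [k] individual requirements; the summand 2 lifts
   every symmetric function above 1. *)
pose K := \sum_(j < k) (`|a j| + 2) / (2 * s * b j).
have term0 (j : 'I_k) : 0 <= (`|a j| + 2) / (2 * s * b j).
  have bj := tb j (ltn_ord j).
  by rewrite divr_ge0 ?addr_ge0 // mulr_ge0 ?(ltW bj) // mulr_ge0 // ltW.
have K0 : 0 < K.
  rewrite /K (bigD1 (Ordinal k_gt0)) //=; apply: ltr_pwDl; last by apply: sumr_ge0 => j _.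
  apply: divr_gt0; first by rewrite ltr_wpDl.
  by apply: mulr_gt0; [lra|exact: tb].
have big j : (j < k)%N -> 1 < mxsigma j.+1 (- Amx (kink_test beta K) x).
  move=> jk; have bj : 0 < b j by exact: tb.
  rewrite kink_mxsigma; last by lia.
  rewrite -/(a j) -/(b j).
  have KE : (`|a j| + 2) / (2 * s * b j) <= K.
    by rewrite /K (bigD1 (Ordinal jk)) //= lerDl; apply: sumr_ge0 => i _.
  have sb : 0 < 2 * s * b j by apply: mulr_gt0 => //; lra.
  rewrite ler_pdivrMr // in KE.
  have -> : 2 * K * w x * slope_norm c (Y x) ^+ 2 * b j = K * (2 * s * b j) by rewrite /s; ring.
  have := ler_norm (- a j); rewrite normrN; lra.
have gam20 : 0 < gam / 2 by rewrite divr_gt0.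
have K20 : 0 < 2 * K by lra.
have rK : 0 < gam / (2 * K) by rewrite divr_gt0.
have ve := vertical_expansion Dx hx h1 h2 gam20.
have np := near_proj Dx hx rK.
have above : \forall p \near x, w p <= kink_test beta K p.
  apply: filterS2 np ve => p [_ _ hp _] [up low].
  rewrite kink_testE; set t := height c p in hp up low *.
  have Kt : K * t ^+ 2 <= gam / 2 * `|t|.
    rewrite -real_normK ?num_real // expr2 mulrA ler_wpM2r //.
    rewrite -ler_pdivlMl // mulrC; apply: le_trans (ltW hp) _.
    by rewrite le_eqVlt; apply/orP; left; apply/eqP; field; rewrite gt_eqF.
  have [t0|t0] := lerP 0 t.
    have := up t0; rewrite ler_norml => /andP[_ h]; rewrite ger0_norm // in Kt.
    have : gam * t <= (beta - dotp g1 dir) * t by rewrite ler_wpM2r.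
    by move: h Kt; lra.
  have := low (ltW t0); rewrite ler_norml => /andP[_ h]; rewrite ltr0_norm // in Kt.
  have : gam * - t <= (dotp g2 dir - beta) * - t by rewrite ler_wpM2r // oppr_ge0 ltW.
  by move: h Kt; lra.
(* Both alternatives of the subsolution property fail: the symmetric functions of orders 1 to [k]
   all exceed 1. *)
case: (wsub Ox (kink_test_C2 beta K) above (kink_test_x _ _)) => [|le1].
  apply => j /andP[j0 jk]; rewrite kink_sigma; last by lia.
  by case: j j0 jk => // j _ jk; apply: lt_trans (big j jk).
move: le1; rewrite kink_sigma // leNgt => /negP; apply.
by have := big k.-1; rewrite prednK //; apply.
Qed.

End AtPoint.

End Kink.

(** * Touching from below off the hypersurface *)

Lemma tangent_block_cts (R : realType) m (c : graph_chart R m.+1) (f : 'rV[R]_m -> R)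
    (T : topologicalType) (t0 : T) (y : T -> 'rV[R]_m) (a b d : T -> R)
    (g : T -> 'rV[R]_m.+1) :
  mx_cts t0 (grad (gc_fun c) \o y) -> mx_cts t0 (hess f \o y) ->
  mx_cts t0 (hess (gc_fun c) \o y) -> {for t0, continuous a} -> {for t0, continuous b} ->
  {for t0, continuous d} -> mx_cts t0 g ->
  mx_cts t0 (fun t => tangent_block c f (y t) (a t) (g t) (b t) (d t)).
Proof.
move=> uc fc pc ac bc dc gc.
have Jc : mx_cts t0 (fun t => tangent c (y t)).
  apply: mx_ctsD; first exact: mx_cts_cst.
  by apply: mx_ctsM; [exact: mx_cts_tr|exact: mx_cts_cst].
have JJ : mx_cts t0 (fun t => tangent c (y t) *m (tangent c (y t))^T).
  by apply: mx_ctsM => //; exact: mx_cts_tr.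
have nc : {for t0, continuous (fun t => slope_norm c (y t))}.
  apply: (@continuous_comp _ _ _ (fun t => 1 + dotp (grad (gc_fun c) (y t)) (grad (gc_fun c) (y t))) Num.sqrt).
    by apply: continuousD; [exact: cst_continuous|exact: mx_cts_dotp].
  exact: sqrt_continuous.
have Qc : mx_cts t0 (fun t => orthonormalizer c (y t)).
  apply: mx_ctsB; first exact: mx_cts_cst.
  apply: mx_ctsZ; last by apply: mx_ctsM => //; exact: mx_cts_tr.
  have n0 := slope_norm_gt0 c (y t0).
  apply: continuousV; first by rewrite mulf_neq0 // gt_eqF // addr_gt0.
  apply: continuousM; first exact: nc.
  by apply: continuousD; [exact: cst_continuous|exact: nc].
have h1 : mx_cts t0 (fun t => b t *: hess (gc_fun c) (y t)) := mx_ctsZ bc pc.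
have h2 : mx_cts t0 (fun t => d t *: (tangent c (y t) *m (tangent c (y t))^T)) :=
  mx_ctsZ dc JJ.
have h3 : mx_cts t0 (fun t => hess f (y t) - b t *: hess (gc_fun c) (y t)) := mx_ctsB fc h1.
have h4 := mx_ctsZ ac (mx_ctsB h3 h2).
have gg : {for t0, continuous (fun t => 2^-1 * dotp (g t) (g t))}.
  by apply: continuousM; [exact: cst_continuous|exact: mx_cts_dotp].
have h5 := mx_ctsM Qc (mx_ctsB (mx_ctsZ gg JJ) h4).
exact: mx_ctsM h5 (mx_cts_tr Qc).
Qed.

Lemma closed_preimage_on (T U : topologicalType) (s : T -> U) (K : set T) (E : set U) :
  closed K -> closed E -> (forall p, K p -> {for p, continuous s}) ->
  closed (K `&` s @^-1` E).
Proof.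
move=> cK cE sc p clp.
have Kp : K p by apply: cK; apply: closureS clp => q [].
split=> //=; apply: contrapT => nE.
have oE : nbhs (s p) (~` E) by apply: open_nbhs_nbhs; split=> //; exact: closed_openC.
have [q [[_ Eq] nEq]] := clp _ (sc p Kp _ oE).
exact: nEq.
Qed.

Lemma near_centre_itv (R : realDomainType) (s h t : R) :
  `|t - s| < h - `|s - h| -> 0 <= t <= 2 * h.
Proof.
have n1 := ler_norm (s - h); have n2 := ler_norm (h - s); rewrite distrC in n2.
by rewrite ltr_norml => /andP[h1 h2]; apply/andP; split; lra.
Qed.

Lemma neg_of_near (R : realDomainType) (v v0 : R) : `|v - v0| < - v0 -> v < 0.
Proof. by rewrite ltr_norml => /andP[_]; lra. Qed.

Lemma ball_tripleP (R : realType) n (x p : 'rV[R]_n) (b b' d d' e : R) :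
  `|p - x| < e -> `|b' - b| < e -> `|d' - d| < e -> ball (x, (b, d)) e (p, (b', d')).
Proof.
move=> h1 h2 h3; split; first by rewrite -ball_normE /= distrC.
by split; rewrite -ball_normE /= distrC.
Qed.

(* With [T = w - f - b s >= - om s] at the minimum and [Tq <= om h] at the
   comparison point, where the penalty in [s - h] vanishes. *)
Lemma penalty_bounds (R : realDomainType) (T Tq om s h P Q delh : R) :
  - (om * s) <= T -> Tq <= om * h -> T + P + Q <= Tq + delh -> delh <= om * h ->
  om * s <= om * (2 * h) -> 0 <= P -> 0 <= Q -> P <= 4 * (om * h) /\ Q <= 4 * (om * h).
Proof. by move=> *; split; lra. Qed.

Lemma lt_of_eighth (R : realDomainType) (om h e : R) :
  0 < om * h -> h * (8 * om) <= e -> 4 * (om * h) < e.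
Proof. by move=> *; lra. Qed.

Section Touch.
Variables (R : realType) (m : nat) (c : graph_chart R m.+1).
Implicit Types (p q x : 'rV[R]_m.+1).

Local Notation F := (gc_frame c).
Local Notation phi := (gc_fun c).
Local Notation dir := (gc_dir c).
Local Notation Y := (gc_coord c).
Local Notation psi := (gc_param c).

Hypothesis FF : F *m F^T = 1%:M.
Hypothesis Fdir : F *m dir^T = 0.
Hypothesis dd : enorm dir = 1.

Variables (D : set 'rV[R]_m) (w : 'rV[R]_m.+1 -> R).
Local Notation f := (w \o psi).
Hypotheses (oD : open D) (phi2 : Ck 2 D phi) (f2 : Ck 2 D f).

Lemma closed_sqdist_ball x (r : R) : closed [set p | dotp (p - x) (p - x) <= r].
Proof.
apply: (@closed_comp _ _ (fun p => dotp (p - x) (p - x)) [set t | t <= r]); last exact: closed_le.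
by move=> p _; exact: has_grad_continuous (has_grad_sqdist x p).
Qed.

Lemma sqdist_norm x p (r : R) : 0 <= r -> dotp (p - x) (p - x) <= r ^+ 2 -> `|p - x| <= r.
Proof.
move=> r0 h; have := le_trans (norm_sqr_le_dotp _) h.
by rewrite ler_pXn2r ?nnegrE.
Qed.

Variables (k : nat) (Omega : set 'rV[R]_m.+1) (x : 'rV[R]_m.+1).
Hypotheses (km : (k <= m.+1)%N) (oO : open Omega) (Ox : Omega x).
Hypotheses (wpos : forall p, Omega p -> 0 < w p)
  (wc : forall p, Omega p -> {for p, continuous w}).
Hypothesis wsup : viscosity_supersolution k Omega w.
Hypotheses (Dx : D (Y x)) (hx : height c x = 0).
Variable g : 'rV[R]_m.+1.
Hypothesis hg : upper_expansion c w x g.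

(** The supersolution property puts [- Amx] in Gamma_k at the contact point, and compression to the
    tangent hyperplane of the level set of [height] lowers the order by one. *)
Lemma touching_block_ge0 p (b K h del a : R) : D (Y p) -> Omega p ->
  (\forall q \near p, test_fun c f b K h del x a q <= w q) ->
  test_fun c f b K h del x a p = w p ->
  forall j, (j < k)%N -> 0 <= mxsigma j (tangent_block c f (Y p) (w p)
    (test_grad c f b K h del x p) (test_slope c b K h p) (2 * del)).
Proof.
move=> Dp Op below eqp j jk; set xi := test_fun _ _ _ _ _ _ _ _ in below eqp.
have xi2 : C2_near p xi.
  exists [set q | D (Y q)]; split => //; first exact: open_coord_preimage.
  by have [] := test_fun_C2 oD phi2 f2 b K h del x a.
have xpos : \forall q \near p, 0 < xi q.
  have cx : {for p, continuous xi}.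
    exact: has_grad_continuous (has_grad_test phi2 f2 _ _ _ _ _ _ Dp).
  apply: filterS (continuous_near cx (wpos Op)) => q.
  by rewrite eqp ltr_norml => /andP[h1 _]; lra.
have [G _] := wsup Op xi2 xpos below eqp.
have As := Amx_test_sym oD phi2 f2 b K h del x a Dp.
have sp := sym_char_poly_splits As.
have := mxsigma_compression_ge0 As (tangent_frame_orth FF Fdir dd (Y p))
  (tangent_frame_normal FF Fdir dd (Y p)) (unit_normalP FF Fdir dd (Y p)) km _ jk.
rewrite (compress_Amx FF Fdir dd oD phi2 f2) // -/xi eqp; apply => i ik.
by rewrite -sigma_eigvals //; [exact: G|lia].
Qed.

(* Near [x], [w - (f + b s) >= - om s] with [s] the height, while the penalty
   [K (s - h)^2 + del |p - x|^2] with [K = 8 om / h] forces an interior minimum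
   at distance [o(1)] from [x] where the slope has changed by at most [16 om]. *)
Lemma touch_near (del om eta : R) : 0 < del -> 0 < om -> 0 < eta ->
  exists p b K h a, [/\ D (Y p), Omega p, `|p - x| < eta,
    `|test_slope c b K h p - dotp g dir| <= 16 * om &
    (\forall q \near p, test_fun c f b K h del x a q <= w q) /\
    test_fun c f b K h del x a p = w p].
Proof.
move=> del0 om0 eta0.
have nO : \forall p \near x, Omega p by exact: open_nbhs_nbhs.
have nD : \forall p \near x, D (Y p).
  by apply: open_nbhs_nbhs; split => //; exact: open_coord_preimage.
have nv := upper_vertical_expansion FF Fdir dd oD phi2 Dx hx hg om0.
have [rho rho0 hrho] : exists2 rho : R, 0 < rho & forall p, `|p - x| < rho ->
    [/\ Omega p, D (Y p) & 0 <= height c p ->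
      `|w p - f (Y p) - height c p * dotp g dir| <= om * height c p].
  by apply/near_ballP; apply: filterS3 nO nD nv => p ? ? ?; split.
pose b := dotp g dir.
have min0 : 0 < Num.min rho eta by rewrite lt_min rho0 eta0.
pose r := Num.min rho eta / 2; have r0 : 0 < r by rewrite divr_gt0.
have rr : r < Num.min rho eta by rewrite /r; lra.
have r20 : 0 < r ^+ 2 by rewrite exprn_gt0.
(* The three bounds in turn: the comparison point [x + h *: dir] stays in the ball, its penalty
   [del h^2] is at most [om h], and [4 om h < del r^2] keeps the minimum off the sphere. *)
pose h := Num.min r (Num.min (om / del) (del * r ^+ 2 / (8 * om))).
have om80 : 0 < 8 * om by lra.
have h0 : 0 < h by rewrite !lt_min r0 divr_gt0 //= divr_gt0 // mulr_gt0.
have hr : h <= r by rewrite ge_min lexx.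
have hod : h <= om / del by rewrite !ge_min lexx orbT.
have hdr : h <= del * r ^+ 2 / (8 * om) by rewrite !ge_min lexx !orbT.
rewrite ler_pdivlMr // in hod; rewrite ler_pdivlMr // in hdr.
pose K := 8 * om / h; have Kh : K * h = 8 * om by rewrite divfK // gt_eqF.
have K0 : 0 < K by rewrite divr_gt0.
clearbody K.
pose C := [set p | dotp (p - x) (p - x) <= r ^+ 2] `&` height c @^-1` [set t | 0 <= t <= 2 * h].
have Cx p : dotp (p - x) (p - x) <= r ^+ 2 -> `|p - x| < rho /\ `|p - x| < eta.
  move=> /(sqdist_norm (ltW r0)) px; have := le_lt_trans px rr.
  by rewrite lt_min => /andP[].
have hc p : `|p - x| < rho -> {for p, continuous (height c)}.
  by move=> /hrho[_ Dp _]; exact: has_grad_continuous (has_grad_height phi2 Dp).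
pose test a := test_fun c f b K h del x a.
have tc a p : `|p - x| < rho -> {for p, continuous (test a)}.
  by move=> /hrho[_ Dp _]; exact: has_grad_continuous (has_grad_test phi2 f2 _ _ _ _ _ _ Dp).
have Ccl : closed C.
  apply: closed_preimage_on.
  - exact: closed_sqdist_ball.
  - rewrite (_ : mkset _ = `[0, 2 * h]%classic); first exact: itv_closed.
    by apply/seteqP; split => t /=; rewrite in_itv.
  - by move=> p /Cx[px _]; exact: hc.
have Ccomp : compact C.
  apply: bounded_closed_compact => //.
  exists (`|x| + r); split; first exact: num_real.
  move=> M hM p [/(sqdist_norm (ltW r0)) px _].
  have -> : p = (p - x) + x by rewrite subrK.
  by apply: (le_trans (ler_normD _ _)); lra.
have hq : height c (x + h *: dir) = h by rewrite (height_dir Fdir dd) hx add0r.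
have sqq : dotp (x + h *: dir - x) (x + h *: dir - x) = h ^+ 2.
  have -> : x + h *: dir - x = h *: dir by rewrite addrC addKr.
  by rewrite dotpZl dotpZr (dotp_dirdir dd) mulr1 expr2.
have Cq : C (x + h *: dir).
  split; rewrite /= ?sqq ?hq; last by apply/andP; split; lra.
  by rewrite ler_pXn2r // nnegrE ltW.
pose zeta p := w p - test 0 p.
have zc : {within C, continuous zeta}.
  apply: continuous_in_subspaceT => p; rewrite inE => -[/Cx[px _] _].
  by apply: continuousB; [apply: wc; case: (hrho p px)|exact: tc].
have [p Cp pmin] := EVT_min_rV (ex_intro _ _ Cq) Ccomp zc.
rewrite inE in Cp; have [Cp1 /andP[s0 s2h]] := Cp.
have [pr pe] := Cx _ Cp1; have [Op Dp vp] := hrho _ pr.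
have zE q : zeta q = (w q - f (Y q) - height c q * b) + K * (height c q - h) ^+ 2
    + del * dotp (q - x) (q - x) by rewrite /zeta /test /test_fun; ring.
have := pmin _ (mem_set Cq); rewrite !zE sqq hq subrr expr0n mulr0 addr0.
have [qr _] := Cx (x + h *: dir) Cq.1; have [_ _ vq] := hrho _ qr.
have := vq; rewrite hq => /(_ (ltW h0)); rewrite ler_norml => /andP[_ vq1].
have := vp s0; rewrite ler_norml => /andP[vp1 _].
move: vp1 vq1; rewrite -/b; set vp' := w p - _ - _; set vq' := w _ - _ - _.
set s := height c p in s0 s2h *; set d := dotp (p - x) (p - x) in Cp1 *.
move=> vp1 vq1 m1.
have d0 : 0 <= d by exact: dotp_ge0.
have oms : om * s <= om * (2 * h) by rewrite ler_wpM2l // ltW.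
have hh : del * h ^+ 2 <= om * h.
  by rewrite expr2 mulrA ler_wpM2r ?(ltW h0) // mulrC.
have sq0 : 0 <= (s - h) ^+ 2 by exact: sqr_ge0.
have deld : 0 <= del * d by rewrite mulr_ge0 // ltW.
have Ksq : 0 <= K * (s - h) ^+ 2 by rewrite mulr_ge0 // ltW.
have [b1 b2] := penalty_bounds vp1 vq1 m1 hh oms Ksq deld.
have omh0 : 0 < om * h by rewrite mulr_gt0.
(* At heights 0 and [2 h] the penalty is [K h^2 = 8 om h], twice what is allowed at the minimum; so
   the minimum avoids both faces of [C], and in particular the hypersurface. *)
have sh : (s - h) ^+ 2 < h ^+ 2.
  rewrite -(ltr_pM2l K0); apply: le_lt_trans b1 _.
  have -> : K * h ^+ 2 = 8 * (om * h) by transitivity (K * h * h); [ring|rewrite Kh; ring].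
  by rewrite ltr_pM2r // ltr_nat.
have nsh : `|s - h| < h.
  by rewrite -(ltr_pXn2r (_ : (0 < 2)%N)) ?nnegrE ?(ltW h0) // real_normK ?num_real.
have dr : d < r ^+ 2.
  rewrite -(ltr_pM2l del0); apply: le_lt_trans b2 _.
  exact: lt_of_eighth hdr.
(* Adding the minimal value [zeta p] of [w - test 0] raises the test function to contact at [p]. *)
exists p, b, K, h, (zeta p); split => //.
(* The slope deviates by [2 K |s - h|], at most [2 K h = 16 om]. *)
- rewrite /test_slope -/b addrAC subrr add0r normrN !normrM.
  rewrite (gtr0_norm K0) ger0_norm //.
  rewrite -/s -mulrA (_ : 16 * om = 2 * (K * h)); last by rewrite Kh mulrA -natrM.
  by rewrite ler_pM2l // ler_pM2l // ltW.
- split; last by rewrite /zeta /test /test_fun; ring.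
have nC : \forall q \near p, C q.
  have sh0 : 0 < h - `|s - h| by rewrite subr_gt0.
  have dr0 : 0 < r ^+ 2 - d by rewrite subr_gt0.
  have sc := continuous_near (hc _ pr) sh0.
  have dc := continuous_near (has_grad_continuous (has_grad_sqdist x p)) dr0.
  apply: filterS2 sc dc => q.
  rewrite -/s -/d => h1 h2; split => /=.
    by move: h2; rewrite ltr_norml ltrD2r => /andP[_ /ltW].
  exact: near_centre_itv h1.
apply: filterS nC => q Cq'; have := pmin _ (mem_set Cq').
rewrite -[in X in X -> _](lerD2l (test 0 q)) /zeta [test 0 q + (w q - _)]addrC subrK.
by rewrite /test /test_fun addr0.
Qed.

(** The block at a contact point, as a function of the point, the slope and [del]. Since [K] and [h]
    act through the slope alone, continuity of this map at one parameter controls all the test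
    functions, however large [K] is. *)
Definition slope_block (z : 'rV[R]_m.+1 * (R * R)) := tangent_block c f (Y z.1) (w z.1)
  (grad f (Y z.1) *m F + z.2.1 *: conormal c (Y z.1) - (2 * z.2.2) *: (z.1 - x)) z.2.1 (2 * z.2.2).

Lemma slope_block_cts (b d : R) : mx_cts (x, (b, d)) slope_block.
Proof.
pose P : 'rV[R]_m.+1 * (R * R) := (x, (b, d)).
have c1 : {for P, continuous (fun z : 'rV[R]_m.+1 * (R * R) => z.1)} by exact: cvg_fst.
have c2 : {for P, continuous (fun z : 'rV[R]_m.+1 * (R * R) => z.2)} by exact: cvg_snd.
have cb : {for P, continuous (fun z : 'rV[R]_m.+1 * (R * R) => z.2.1)}.
  by apply: (continuous_comp c2); exact: cvg_fst.
have cd : {for P, continuous (fun z : 'rV[R]_m.+1 * (R * R) => z.2.2)}.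
  by apply: (continuous_comp c2); exact: cvg_snd.
have cY : {for P, continuous (fun z : 'rV[R]_m.+1 * (R * R) => Y z.1)}.
  by apply: (continuous_comp c1); exact: coord_continuous_fun.
have c2d : {for P, continuous (fun z : 'rV[R]_m.+1 * (R * R) => 2 * z.2.2)}.
  by apply: continuousM => //; exact: cst_continuous.
have gphi := mx_cts_comp cY (C2_grad_cts phi2 Dx).
have gf := mx_cts_comp cY (C2_grad_cts f2 Dx).
have Cc := mx_cts_comp c1 (conormal_cts phi2 Dx).
have Fc : mx_cts P (fun=> F) by exact: mx_cts_cst.
have x0c : mx_cts P (fun=> x) by exact: mx_cts_cst.
have xc : mx_cts P (fun z => z.1 - x) := mx_ctsB (mx_cts_of c1) x0c.
have gc := mx_ctsB (mx_ctsD (mx_ctsM gf Fc) (mx_ctsZ cb Cc)) (mx_ctsZ c2d xc).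
have wcc : {for P, continuous (fun z : 'rV[R]_m.+1 * (R * R) => w z.1)}.
  by apply: (continuous_comp c1); exact: wc.
exact: (tangent_block_cts gphi (mx_cts_comp cY (C2_hess_cts f2 Dx))
  (mx_cts_comp cY (C2_hess_cts phi2 Dx)) wcc cb c2d gc).
Qed.

(** A negative value would persist for all parameters close to [(x, (dotp g dir, 0))], and
    [touch_near] produces a contact point with such parameters. *)
Lemma upper_block_ge0 j : (j < k)%N ->
  0 <= mxsigma j (tangent_block c f (Y x) (w x) g (dotp g dir) 0).
Proof.
move=> jk; rewrite leNgt; apply/negP => neg.
pose b0 := dotp g dir.
have TB0 : slope_block (x, (b0, 0)) = tangent_block c f (Y x) (w x) g (dotp g dir) 0.
  rewrite /slope_block /= mulr0 subrr scaler0 subr0; congr (tangent_block _ _ _ _ _ _ _).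
  rewrite (trace_grad FF Fdir dd phi2 Dx hx (or_introl hg)).
  by rewrite -(normal_decomp FF Fdir dd).
have TBc := @slope_block_cts b0 0.
have e0 : 0 < - mxsigma j (slope_block (x, (b0, 0))) by rewrite TB0 oppr_gt0.
have /nbhs_ballP[eta /= eta0 heta] := continuous_near (mxsigma_continuous (k := j) TBc) e0.
(* With [om = eta / 32] the slope error [16 om] is [eta / 2]; both it and [del] stay below the
   radius [eta]. *)
have del0 : 0 < eta / 4 by rewrite divr_gt0.
have om0 : 0 < eta / 32 by rewrite divr_gt0.
have [p [b [K [h [a [Dp Op px sl [below eqp]]]]]]] := touch_near del0 om0 eta0.
have := touching_block_ge0 Dp Op below eqp jk.
have sle : `|test_slope c b K h p - b0| < eta by apply: (le_lt_trans sl); rewrite mulrCA gtr_pMr // ltr_pdivrMr // mul1r ltr_nat.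
have dle : `|eta / 4 - 0| < eta by rewrite subr0 gtr0_norm // ltr_pdivrMr // ltr_pMr // ltr1n.
have /neg_of_near := heta _ (ball_tripleP px sle dle).
by rewrite ltNge => /negP.
Qed.

End Touch.

(** * Density of kinks *)

Section Flip.
Variables (R : realType) (m : nat) (c : graph_chart R m.+1).
Implicit Types (p x : 'rV[R]_m.+1) (y : 'rV[R]_m).

(** Reversing [gc_dir] exchanges the two sides while keeping the parametrisation, so every statement
    about the upper side yields one about the lower side. *)
Definition flip : graph_chart R m.+1 := GraphChart (gc_frame c) (- gc_dir c)
  (gc_dom c) (gc_base c) (fun y => - gc_fun c y).

Lemma flip_param : gc_param flip = gc_param c.
Proof. by apply/funext => y; rewrite /gc_param /= scalerN scaleNr opprK. Qed.

Lemma flip_height p : height flip p = - height c p.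
Proof. by rewrite /height /= dotpNr opprB opprK addrC. Qed.

Lemma flip_frame_dir : gc_frame c *m (gc_dir c)^T = 0 -> gc_frame flip *m (gc_dir flip)^T = 0.
Proof. by move=> h; rewrite /= linearN /= mulmxN h oppr0. Qed.

Lemma flip_enorm : enorm (gc_dir c) = 1 -> enorm (gc_dir flip) = 1.
Proof. by rewrite /enorm /= dotpNl dotpNr opprK. Qed.

Lemma C2_opp (D : set 'rV[R]_m) (f : 'rV[R]_m -> R) : open D -> Ck 2 D f ->
  Ck 2 D (fun y => - f y) /\ forall y, D y -> hess (fun y => - f y) y = - hess f y.
Proof.
move=> oD f2; apply: (@Ck2_intro _ _ _ _ (fun y => - grad f y)) => //.
- by move=> y Dy; apply: has_gradN; exact: (C2_has_grad f2).
- move=> y j Dy; have := has_gradN (C2_has_grad_partial f2 j Dy).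
  rewrite -linearN /= -linearN /=; apply: has_grad_near.
  by apply: filterE => z; rewrite !mxE.
- by move=> y i j Dy; exact: (mx_ctsN (C2_hess_cts f2 Dy)).
Qed.

Variable D : set 'rV[R]_m.
Hypotheses (oD : open D) (phi2 : Ck 2 D (gc_fun c)).

Lemma flip_C2 : Ck 2 D (gc_fun flip).
Proof. by case: (C2_opp oD phi2). Qed.

Lemma lower_expansion_flip (w : 'rV[R]_m.+1 -> R) x g :
  upper_expansion flip w x g -> lower_expansion c w x g.
Proof.
move=> h e /h[r r0 hr]; exists r => // p q px qx hp hq.
by apply: hr => //; rewrite flip_height oppr_ge0.
Qed.

End Flip.

Lemma continuous_of_near (R : realType) (T : topologicalType) (f : T -> R) x :
  (forall e : R, 0 < e -> \forall y \near x, `|f y - f x| <= e) -> {for x, continuous f}.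
Proof.
move=> h; apply/cvgrPdist_le => e /h; apply: filterS => y; by rewrite distrC.
Qed.

(** The continuous extension [G] supplies the one-sided gradient at boundary points of [A]. *)
Definition side_field (R : realType) n (w : 'rV[R]_n -> R) (A : set 'rV[R]_n)
    (G : 'rV[R]_n -> 'rV[R]_n) :=
  (forall p, A p -> has_grad w p (G p)) /\ {within closure A, continuous G}.

Lemma C1_closure_side_field (R : realType) n (w : 'rV[R]_n -> R) (A : set 'rV[R]_n) :
  C1_closure A w -> exists G, side_field w A G.
Proof.
case=> -[wd _] _ [G [Gc GE]]; exists G; split=> // p Ap.
by rewrite GE //; apply: has_grad_grad; exact: wd.
Qed.

Lemma pos_of_near (R : realDomainType) (v v0 : R) : `|v - v0| < v0 -> 0 < v.
Proof. by rewrite ltr_norml => /andP[+ _]; lra. Qed.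

Lemma half_step (R : realFieldType) (b b1 mn eta : R) :
  `|b1 - b| <= eta / 2 -> 0 < mn -> mn <= eta / 2 -> `|b1 + mn / 2 - b| < eta.
Proof.
by rewrite ler_norml ltr_norml => /andP[? ?] ? ?; apply/andP; split; lra.
Qed.

Lemma half_step_between (R : realFieldType) (b1 b2 mn : R) :
  0 < mn -> mn <= b2 - b1 -> b1 < b1 + mn / 2 < b2.
Proof. by move=> ? ?; apply/andP; split; lra. Qed.

Section LocalSides.
Variables (R : realType) (m : nat) (c : graph_chart R m.+1).
Implicit Types (p q : 'rV[R]_m.+1).

Local Notation F := (gc_frame c).
Local Notation phi := (gc_fun c).
Local Notation dir := (gc_dir c).
Local Notation Y := (gc_coord c).
Local Notation psi := (gc_param c).

Hypothesis FF : F *m F^T = 1%:M.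
Hypothesis Fdir : F *m dir^T = 0.
Hypothesis dd : enorm dir = 1.

Variables (D : set 'rV[R]_m) (w : 'rV[R]_m.+1 -> R) (U : set 'rV[R]_m.+1).
Local Notation f := (w \o psi).
Hypotheses (oD : open D) (phi2 : Ck 2 D phi) (f2 : Ck 2 D f).
Hypotheses (oU : open U) (UD : forall p, U p -> D (Y p)).
Hypothesis wc : forall p, U p -> {for p, continuous w}.
Hypothesis nonC1 : forall V : set 'rV[R]_m.+1, open V -> V `<=` U ->
  (exists2 p, V p & height c p = 0) -> ~ Ck 1 V w.

Variables (x : 'rV[R]_m.+1) (r : R) (A1 A2 : set 'rV[R]_m.+1) (G1 G2 : 'rV[R]_m.+1 -> 'rV[R]_m.+1).
Hypotheses (Ux : U x) (r0 : 0 < r) (hx : height c x = 0).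
Hypotheses (s1 : upper_side c x r A1) (s2 : upper_side (flip c) x r A2).
Hypotheses (f1 : side_field w A1 G1) (f2' : side_field w A2 G2).

Let Fdir' := flip_frame_dir Fdir.
Let dd' := flip_enorm dd.
Let phi2' := flip_C2 oD phi2.

Lemma sub_upper_side (c' : graph_chart R m.+1) A p :
  upper_side c' x r A -> upper_side c' p (r - `|p - x|) A.
Proof.
move=> h q qp hq; apply: h => //.
have -> : q - x = (q - p) + (p - x) by rewrite addrA subrK.
by apply: (le_lt_trans (ler_normD _ _)); rewrite -ltrBrDr.
Qed.

Lemma upper_expansion_near p : U p -> `|p - x| < r -> 0 <= height c p ->
  upper_expansion c w p (G1 p).
Proof.
move=> Up px hp e e0; have r1 : 0 < r - `|p - x| by rewrite subr_gt0.
exact: (one_sided_expansion Fdir dd phi2 oU UD wc f1.1 f1.2 Up hp r1 (sub_upper_side s1) e0).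
Qed.

Lemma lower_expansion_near p : U p -> `|p - x| < r -> height c p <= 0 ->
  lower_expansion c w p (G2 p).
Proof.
move=> Up px hp; apply: lower_expansion_flip => e e0.
have r1 : 0 < r - `|p - x| by rewrite subr_gt0.
apply: (one_sided_expansion Fdir' dd' phi2' oU UD wc f2'.1 f2'.2 Up _ r1 (sub_upper_side s2) e0).
by rewrite flip_height oppr_ge0.
Qed.

Lemma upper_closure_near p : `|p - x| < r -> 0 <= height c p -> closure A1 p.
Proof.
move=> px hp; have r1 : 0 < r - `|p - x| by rewrite subr_gt0.
exact: (upper_closure Fdir dd r1 (sub_upper_side s1) hp).
Qed.

Lemma lower_closure_near p : `|p - x| < r -> height c p <= 0 -> closure A2 p.
Proof.
move=> px hp; have r1 : 0 < r - `|p - x| by rewrite subr_gt0.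
apply: (upper_closure Fdir' dd' r1 (sub_upper_side s2)).
by rewrite flip_height oppr_ge0.
Qed.

Lemma sides_agree p : U p -> `|p - x| < r -> height c p = 0 ->
  dotp (G1 p) dir = dotp (G2 p) dir -> G1 p = G2 p.
Proof.
move=> Up px hp e.
have h0 : 0 <= height c p by rewrite hp.
have h0' : height c p <= 0 by rewrite hp.
have t1 := trace_grad FF Fdir dd phi2 (UD Up) hp (or_introl (upper_expansion_near Up px h0)).
have t2 := trace_grad FF Fdir dd phi2 (UD Up) hp (or_intror (lower_expansion_near Up px h0')).
by rewrite (normal_decomp FF Fdir dd (Y p) (G1 p)) (normal_decomp FF Fdir dd (Y p) (G2 p)) -t1 -t2 e.
Qed.

Lemma near_height_cts p (e : R) : U p -> 0 < e ->
  \forall q \near p, `|height c q - height c p| < e.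
Proof.
move=> Up; apply: continuous_near.
exact: has_grad_continuous (has_grad_height phi2 (UD Up)).
Qed.

Lemma near_in_ball p (e : R) : `|p - x| < e -> \forall q \near p, `|q - x| < e.
Proof.
move=> px; apply/near_ballP; exists (e - `|p - x|); first by rewrite subr_gt0.
move=> q qp; have -> : q - x = (q - p) + (p - x) by rewrite addrA subrK.
by apply: (le_lt_trans (ler_normD _ _)); rewrite -ltrBrDr.
Qed.

(* If the two one-sided slopes agreed on all of the hypersurface near [x], the
   two gradient fields would glue to a continuous gradient. *)
Lemma kink_dense (rho : R) : 0 < rho ->
  exists p, [/\ U p, `|p - x| < rho, `|p - x| < r, height c p = 0 &
    dotp (G1 p) dir != dotp (G2 p) dir].
Proof.
move=> rho0; apply: contrapT => none.
pose V := [set p | `|p - x| < Num.min rho r] `&` U.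
have oV : open V.
  apply: openI => //; rewrite openE => p /= px.
  exact: near_in_ball.
have VU : V `<=` U by move=> p [].
have Vr p : V p -> `|p - x| < r by move=> [/=]; rewrite lt_min => /andP[].
have agree p : V p -> height c p = 0 -> G1 p = G2 p.
  move=> Vp hp; have [Up pr] := (VU p Vp, Vr p Vp).
  apply: sides_agree => //; apply: contrapT => ne; apply: none; exists p; split => //.
    by case: Vp => /=; rewrite lt_min => /andP[].
  exact/eqP.
have Vx : V x by split => //=; rewrite subrr normr0 lt_min rho0 r0.
apply: (nonC1 oV VU); first by exists x.
pose G p := if 0 <= height c p then G1 p else G2 p.
have Gle p : V p -> height c p <= 0 -> G p = G2 p.
  move=> Vp hp; rewrite /G; case: ifP => // hp'; apply: agree => //.
  by apply/eqP; rewrite eq_le hp hp'.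
have Gge p : 0 <= height c p -> G p = G1 p by rewrite /G => ->.
have wG p : V p -> has_grad w p (G p).
  move=> Vp; have [Up pr] := (VU p Vp, Vr p Vp).
  have [hp|hp|hp] := ltgtP (height c p) 0.
  - rewrite Gle ?(ltW hp) //; apply: f2'.1; apply: s2 => //.
    by rewrite flip_height oppr_gt0.
  - by rewrite Gge ?(ltW hp) //; apply: f1.1; exact: s1.
  (* On the hypersurface the two one-sided expansions share the same vector and combine into a full
     one. *)
  - apply/has_gradP => e e0.
    have hp0 : 0 <= height c p by rewrite hp.
    have hp1 : height c p <= 0 by rewrite hp.
    have [r1 r10 h1] := upper_expansion_near Up pr hp0 e0.
    have [r2 r20 h2] := lower_expansion_near Up pr hp1 e0.
    apply/near_ballP; exists (Num.min r1 r2); first by rewrite lt_min r10 r20.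
    move=> q; rewrite lt_min => /andP[q1 q2].
    have [hq|hq] := lerP 0 (height c q).
      by rewrite Gge // h1 // subrr normr0.
    by rewrite Gle // h2 ?subrr ?normr0 // ltW.
have Gcts p (e : R) : V p -> 0 < e -> \forall q \near p, `|G q - G p| <= e.
  move=> Vp e0; have [Up pr] := (VU p Vp, Vr p Vp).
  have nV : \forall q \near p, V q by exact: open_nbhs_nbhs.
  have up : 0 <= height c p -> \forall q \near p, 0 <= height c q -> `|G q - G p| <= e.
    move=> hp; have n1 := within_continuous_near f1.2 (upper_closure_near pr hp) e0.
    apply: filterS2 nV n1 => q Vq h hq; rewrite !Gge //; apply: h.
    exact: upper_closure_near (Vr q Vq) hq.
  have low : height c p <= 0 -> \forall q \near p, height c q <= 0 -> `|G q - G p| <= e.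
    move=> hp; have n1 := within_continuous_near f2'.2 (lower_closure_near pr hp) e0.
    apply: filterS2 nV n1 => q Vq h hq; rewrite !Gle //; apply: h.
    exact: lower_closure_near (Vr q Vq) hq.
  have [hp|hp|hp] := ltgtP (height c p) 0.
  - have nh := near_height_cts Up (_ : 0 < - height c p).
    apply: filterS2 (low (ltW hp)) (nh _) => [q h|]; last by rewrite oppr_gt0.
    by rewrite ltr_norml => /andP[_ hq]; apply: h; lra.
  - apply: filterS2 (up (ltW hp)) (near_height_cts Up hp) => q h.
    by rewrite ltr_norml => /andP[hq _]; apply: h; lra.
  - have h0 : 0 <= height c p by rewrite hp.
    have h1 : height c p <= 0 by rewrite hp.
    apply: filterS2 (up h0) (low h1) => q hu hl.
    by have [hq|hq] := lerP 0 (height c q); [exact: hu|apply: hl; exact: ltW].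
split=> [p Vp|i p Vp]; first by case: (wG p Vp).
apply: (@continuous_at_near _ _ (fun q => G q 0 i)).
  have nV : \forall q \near p, V q by exact: open_nbhs_nbhs.
  by apply: filterS nV => q Vq; rewrite (has_grad_partial i (wG q Vq)).
apply: continuous_of_near => e e0; apply: filterS (Gcts p e Vp e0) => q.
apply: le_trans; have := mx_entry_norm_le (G q - G p) 0 i.
by rewrite !mxE.
Qed.

Variables (k : nat) (Omega : set 'rV[R]_m.+1).
Hypotheses (k0 : (0 < k)%N) (km : (k <= m.+1)%N) (oO : open Omega) (UO : U `<=` Omega).
Hypotheses (wO : forall p, Omega p -> {for p, continuous w})
  (wpos : forall p, Omega p -> 0 < w p).
Hypotheses (wsup : viscosity_supersolution k Omega w)
  (wsub : viscosity_subsolution k Omega w).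

(** Positivity of all the functions at [x] would persist for nearby points and slopes. These include
    a kink [p] supplied by [kink_dense], with a slope strictly between its one-sided slopes, which
    [concave_kink] forbids. *)
Lemma upper_block_boundary (b := dotp (G1 x) dir)
    (T := tangent_block c f (Y x) (w x) (G1 x) b 0) :
  (forall j, (j < k)%N -> 0 <= mxsigma j T) /\ ~ (forall j, (j < k)%N -> 0 < mxsigma j T).
Proof.
have xr : `|x - x| < r by rewrite subrr normr0.
have hx0 : 0 <= height c x by rewrite hx.
have Dx := UD Ux; have u := upper_expansion_near Ux xr hx0.
split=> [j jk|pos].
  exact: (upper_block_ge0 FF Fdir dd oD phi2 f2 km oO (UO Ux) wpos wO wsup Dx hx u jk).
pose SB := slope_block c w x.
have SB0 : SB (x, (b, 0)) = T.
  rewrite /SB /slope_block /T /= mulr0 subrr scaler0 subr0; congr (tangent_block _ _ _ _ _ _ _).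
  rewrite (trace_grad FF Fdir dd phi2 Dx hx (or_introl u)).
  by rewrite -(normal_decomp FF Fdir dd).
have SBc := @slope_block_cts _ _ c _ _ phi2 f2 Omega x (UO Ux) wO Dx b 0.
have near_posj (j : 'I_k) : \forall z \near (x, (b, 0 : R)), 0 < mxsigma j (SB z).
  have e0 : 0 < mxsigma j (SB (x, (b, 0))) by rewrite SB0; exact: pos.
  apply: filterS (continuous_near (mxsigma_continuous (k := j) SBc) e0) => z.
  exact: pos_of_near.
have near_pos : \forall z \near (x, (b, 0 : R)), forall j : 'I_k, 0 < mxsigma j (SB z).
  exact: filter_forall near_posj.
have /nbhs_ballP[eta /= eta0 heta] := near_pos.
have eta20 : 0 < eta / 2 by rewrite divr_gt0.
have m0 : 0 < m.+1%:R + 1 :> R by rewrite ltr_wpDl.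
have e1 : 0 < eta / 2 / (m.+1%:R + 1) by rewrite divr_gt0.
have /near_ballP[r1 r10 h1] := within_continuous_near f1.2 (upper_closure_near xr hx0) e1.
have rho0 : 0 < Num.min eta r1 by rewrite lt_min eta0 r10.
have [p [Up + pr hp ne]] := kink_dense rho0; rewrite lt_min => /andP[peta pr1].
have hp0 : 0 <= height c p by rewrite hp.
have hp1 : height c p <= 0 by rewrite hp.
have up := upper_expansion_near Up pr hp0; have lp := lower_expansion_near Up pr hp1.
have Dp := UD Up; have Op := UO Up.
have le12 := no_convex_kink FF Fdir dd oD phi2 f2 Dp hp k0 (wpos Op) Op wsup up lp.
have lt12 : dotp (G1 p) dir < dotp (G2 p) dir by rewrite lt_neqAle ne.
set b1 := dotp (G1 p) dir in lt12; set b2 := dotp (G2 p) dir in lt12.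
(* Only [b1] is known to be close to [b], the gap [b2 - b1] may be large; so the slope is taken just
   above [b1]. *)
pose mn := Num.min (b2 - b1) (eta / 2).
have mn0 : 0 < mn by rewrite lt_min subr_gt0 lt12.
have mn1 : mn <= b2 - b1 by rewrite ge_min lexx.
have mn2 : mn <= eta / 2 by rewrite ge_min lexx orbT.
have b1b : `|b1 - b| <= eta / 2.
  rewrite /b1 /b -dotpBl dotpC; apply: (le_trans (dotp_normr _ _)).
  have g := h1 p pr1 (upper_closure_near pr hp0).
  apply: (@le_trans _ _ (m.+1%:R * 1 * (eta / 2 / (m.+1%:R + 1)))).
    by rewrite ler_pM ?mulr_ge0 // ler_wpM2l // dir_norm_le1.
  by rewrite mulr1 mulrCA ler_piMr ?(ltW eta20) // ler_pdivrMr // mul1r lerDl.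
pose beta := b1 + mn / 2.
have bb : `|beta - b| < eta by exact: half_step b1b mn0 mn2.
have b12 : b1 < beta < b2 by exact: half_step_between mn0 mn1.
apply: (concave_kink FF Fdir dd oD phi2 f2 Dp hp k0 km (wpos Op) Op wsub up lp b12) => j jk.
have d0 : `|0 - 0 : R| < eta by rewrite subrr normr0.
have := heta _ (ball_tripleP peta bb d0) (Ordinal jk).
by rewrite /SB /slope_block /= mulr0 scale0r subr0.
Qed.

End LocalSides.

(** * Geometry of the graph *)

(** For the graph metric [delta_ab + phi_a phi_b] the three first derivatives in a Christoffel
    symbol add up to [2 phi_ab phi_e]. *)
Lemma christoffel_sum (R : numFieldType) (i pa pb pe hab hae hbe : R) :
  2^-1 * (i * (pb * hae + pe * hab + (pa * hbe + pe * hab) - (pa * hbe + pb * hae))) =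
  hab * (i * pe).
Proof. by field. Qed.

(** The Christoffel term and the second fundamental form are both multiples of [phi_ab]; in their
    sum the normal derivative [al] cancels. *)
Lemma slope_coefficient (R : comRingType) (h1 h2 b1 b2 al : R) :
  h1 - h2 * (b1 - al * b2) - al * (h2 * b2) = h1 - b1 * h2.
Proof. by ring. Qed.

Section InducedGeometry.
Variables (R : realType) (m : nat) (c : graph_chart R m.+1).
Implicit Types (y : 'rV[R]_m).

Local Notation F := (gc_frame c).
Local Notation phi := (gc_fun c).
Local Notation dir := (gc_dir c).
Local Notation Y := (gc_coord c).
Local Notation psi := (gc_param c).

Hypothesis FF : F *m F^T = 1%:M.
Hypothesis Fdir : F *m dir^T = 0.
Hypothesis dd : enorm dir = 1.

Variables (D : set 'rV[R]_m) (f : 'rV[R]_m -> R).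
Hypotheses (oD : open D) (phi2 : Ck 2 D phi) (f2 : Ck 2 D f).

Lemma partial_rV n (Psi : 'rV[R]_m -> 'rV[R]_n) (gr : 'I_n -> 'rV[R]_m) y a :
  (forall j, has_grad (fun z => Psi z 0 j) y (gr j)) ->
  partial a Psi y = \row_j gr j 0 a.
Proof.
move=> h; rewrite /partial derive_mx; last first.
  apply/derivable_mxP => i j; rewrite (ord1 i).
  by case: (h j) => d _; exact: diff_derivable.
by apply/matrixP => i j; rewrite !mxE (ord1 i) -(has_grad_partial a (h j)).
Qed.

Lemma near_D y : D y -> \forall z \near y, D z.
Proof. by move=> Dy; exact: open_nbhs_nbhs. Qed.

Lemma partial_param y a : D y -> partial a psi y = row a (tangent c y).
Proof.
move=> Dy.
rewrite (@partial_rV _ _ (fun j => (col j F)^T + dir 0 j *: grad phi y)) => [|j].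
  apply/rowP => j; rewrite !mxE; congr (_ + _).
  by rewrite big_ord1 !mxE mulrC.
have h1 := has_grad_dotp (col j F)^T y.
have h2 := has_gradZ (dir 0 j) (C2_has_grad phi2 Dy).
apply: has_grad_near (has_gradD h1 h2); apply: filterE => z.
rewrite /gc_param !mxE mulrC; congr (_ + _).
by apply: eq_bigr => i _; rewrite !mxE.
Qed.

Lemma metric_param y : D y -> metric psi y = tangent c y *m (tangent c y)^T.
Proof.
move=> Dy; apply/matrixP => a b; rewrite !mxE !partial_param //.
by apply: eq_bigr => j _; rewrite !mxE.
Qed.

Lemma metric_paramE y a b : D y ->
  metric psi y a b = (a == b)%:R + partial a phi y * partial b phi y.
Proof.
move=> Dy; rewrite metric_param // (tangent_metric FF Fdir dd) !mxE.
by congr (_ + _); rewrite big_ord1 !mxE.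
Qed.

Lemma partial_metric y a b d : D y -> partial a (fun z => metric psi z b d) y =
  partial b phi y * hess phi y a d + partial d phi y * hess phi y a b.
Proof.
move=> Dy.
have h : has_grad (fun z => (b == d)%:R + partial b phi z * partial d phi z) y
    (0 + (partial b phi y *: (col d (hess phi y))^T + partial d phi y *: (col b (hess phi y))^T)).
  apply: has_gradD; first exact: has_grad_cst.
  by apply: has_gradM; exact: (C2_has_grad_partial phi2).
have h' : has_grad (fun z => metric psi z b d) y
    (0 + (partial b phi y *: (col d (hess phi y))^T + partial d phi y *: (col b (hess phi y))^T)).
  apply: has_grad_near h; apply: filterS (near_D Dy) => z Dz.
  by rewrite metric_paramE.
by rewrite (has_grad_partial a h') !mxE add0r.
Qed.

Lemma hess_symE y a b : D y -> hess phi y a b = hess phi y b a.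
Proof. by move=> Dy; rewrite -[in LHS](hess_sym oD Dy phi2) mxE. Qed.

Lemma christoffel_param y d a b : D y -> christoffel psi y d a b =
  hess phi y a b * (\sum_e invmx (metric psi y) d e * partial e phi y).
Proof.
move=> Dy; rewrite /christoffel mulr_sumr mulr_sumr; apply: eq_bigr => e _.
rewrite !partial_metric // (hess_symE b a Dy) (hess_symE e a Dy) (hess_symE e b Dy).
exact: christoffel_sum.
Qed.

Lemma second_form_param y nu a b : D y ->
  second_form psi nu y a b = hess phi y a b * dotp nu dir.
Proof.
move=> Dy; rewrite mxE -dotpZr; congr (dotp _ _).
have -> : partial a (partial b psi) y = partial a (fun z => row b (tangent c z)) y.
  apply: near_eq_derive; apply: filterS (near_D Dy) => z Dz.
  exact: partial_param.
rewrite (@partial_rV _ _ (fun j => dir 0 j *: (col b (hess phi y))^T)) => [|j].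
  by apply/rowP => j; rewrite !mxE mulrC.
have h := has_gradD (has_grad_cst (F b j) y) (has_gradZ (dir 0 j) (C2_has_grad_partial phi2 b Dy)).
rewrite add0r in h; apply: has_grad_near h; apply: filterE => z.
by rewrite !mxE big_ord1 !mxE mulrC.
Qed.

Lemma cov_hess_param y a b : D y -> cov_hess psi f y a b = hess f y a b -
  hess phi y a b * \sum_d (\sum_e invmx (metric psi y) d e * partial e phi y) * partial d f y.
Proof.
move=> Dy.
have E1 : cov_hess psi f y a b =
  partial a (partial b f) y - \sum_d christoffel psi y d a b * partial d f y by rewrite mxE.
have E2 : hess f y a b = partial a (partial b f) y by rewrite mxE.
have E3 : \sum_d christoffel psi y d a b * partial d f y = hess phi y a b *
    \sum_d (\sum_e invmx (metric psi y) d e * partial e phi y) * partial d f y.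
  rewrite mulr_sumr; apply: eq_bigr => d _.
  by rewrite christoffel_param // mulrA.
exact: (etrans E1 (congr2 (fun u v => u - v) (Logic.eq_sym E2) E3)).
Qed.

(* [G] is a gradient at the point with tangential part [grad f] and normal
   derivative [alpha]; its component along [gc_dir] is the only combination of
   [grad f] and [alpha] that enters the coefficient of the Hessian of [gc_fun]. *)
Lemma Tmx_param y nu (G : 'rV[R]_m.+1) : D y ->
  grad f y = G *m (tangent c y)^T -> enorm nu = 1 ->
  (forall a, dotp nu (partial a psi y) = 0) ->
  Tmx psi nu f (dotp G nu) y =
  (2^-1 * dotp G G) *: (tangent c y *m (tangent c y)^T) -
  f y *: (hess f y - dotp G dir *: hess phi y).
Proof.
move=> Dy vE nu1 nuJ.
set J := tangent c y; set Q := orthonormalizer c y; set E := tangent_frame c y.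
set al := dotp G nu.
have nuJ0 : nu *m J^T = 0.
  apply/rowP => a; rewrite !mxE -[RHS](nuJ a) partial_param //.
  by apply: eq_bigr => j _; rewrite !mxE.
have nuE : nu *m E^T = 0 by rewrite trmx_mul mulmxA nuJ0 mul0mx.
have nunu : nu *m nu^T = 1%:M by rewrite [LHS]mx11_scalar -dotpE -enorm_sqr nu1 expr1n.
have EE : E *m E^T = 1%:M by exact: tangent_frame_orth.
have Enu : E *m nu^T = 0 by rewrite -[LHS]trmxK trmx_mul trmxK nuE trmx0.
have dec : nu^T *m nu + E^T *m E = 1%:M.
  pose O : 'M[R]_(1 + m, m.+1) := col_mx nu E.
  have OO : O *m O^T = 1%:M.
    by rewrite tr_col_mx mul_col_row nunu EE nuE Enu -scalar_mx_block.
  by have := mulmx1C OO; rewrite tr_col_mx mul_row_col.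
have QgQ : Q *m (J *m J^T) *m Q^T = 1%:M by exact: orthonormalizerP.
have gi : invmx (metric psi y) = Q^T *m Q.
  rewrite metric_param // -/J.
  have e1 : Q^T *m Q *m (J *m J^T) = 1%:M by rewrite -mulmxA; exact: mulmx1C.
  have gu : J *m J^T \in unitmx by case: (mulmx1_unit e1).
  by rewrite -[LHS]mul1mx -e1 mulmxK.
have EEq : E^T *m E = J^T *m (Q^T *m Q) *m J.
  by rewrite /E /tangent_frame trmx_mul !mulmxA.
(* A scalar product splits into the product of the normal components and the pairing of the
   tangential components by the inverse metric. *)
have split2 (A B : 'rV[R]_m.+1) : dotp A B = dotp A nu * dotp B nu +
    (A *m J^T *m invmx (metric psi y) *m (B *m J^T)^T) 0 0.
  rewrite [dotp A B]dotpE -[A in A *m B^T]mulmx1 -dec mulmxDr mulmxDl mxE; congr (_ + _).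
    have -> : A *m (nu^T *m nu) *m B^T = (A *m nu^T) *m (nu *m B^T) by rewrite !mulmxA.
    by rewrite [A *m nu^T]mx11_scalar mul_scalar_mx mxE -!dotpE (dotpC nu).
  by rewrite gi EEq trmx_mul trmxK !mulmxA.
have quad (u v : 'rV[R]_m) : (u *m invmx (metric psi y) *m v^T) 0 0 =
    \sum_a \sum_b invmx (metric psi y) a b * u 0 a * v 0 b.
  rewrite mxE exchange_big /=; apply: eq_bigr => b _; rewrite !mxE mulr_suml.
  by apply: eq_bigr => a _; rewrite [_ * u 0 a]mulrC.
have normE : grad_sqnorm psi f y + al ^+ 2 = dotp G G.
  rewrite (split2 G G) -/al addrC expr2 -vE quad; congr (_ + _).
  by apply: eq_bigr => a _; apply: eq_bigr => b _; rewrite !mxE.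
have dirJ : dir *m J^T = grad phi y.
  by rewrite -[LHS]trmxK trmx_mul trmxK (tangent_dir Fdir dd) trmxK.
(* The splitting for [G] and [dir], whose tangential components are [grad f y] and [grad phi y]. *)
have slopeE : \sum_d (\sum_e invmx (metric psi y) d e * partial e phi y) * partial d f y
    = dotp G dir - al * dotp nu dir.
  rewrite (split2 G dir) -/al (dotpC dir nu) addrAC subrr add0r -vE dirJ quad.
  apply: eq_bigr => a _; rewrite mulr_suml; apply: eq_bigr => b _.
  by rewrite !mxE mulrAC.
rewrite /Tmx normE metric_param // -/J addrC; congr (_ - _ *: _).
have entB (A B : 'M[R]_m) a b : (A - B) a b = A a b - B a b by rewrite !mxE.
have entZ (t : R) (A : 'M[R]_m) a b : (t *: A) a b = t * A a b by rewrite !mxE.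
apply/matrixP => a b; rewrite !entB !entZ cov_hess_param // second_form_param // slopeE.
exact: slope_coefficient.
Qed.

End InducedGeometry.

(** * One-sided normal derivatives in terms of the one-sided gradients *)

Section OneSidedDerivatives.
Variables (R : realType).

Lemma lim_right (F : R -> R) (l : R) :
  (forall e : R, 0 < e -> exists2 d : R, 0 < d & forall t, 0 < t < d -> `|F t - l| <= e) ->
  lim (F t @[t --> (0 : R)^'+]) = l.
Proof.
move=> h; apply/cvg_lim => //; apply/cvgrPdist_le => e /h[d d0 hd].
near=> t; rewrite distrC; apply: hd; apply/andP; split; near: t.
  exact: nbhs_right_gt.
exact: nbhs_right_lt.
Unshelve. all: by end_near. Qed.

Lemma lim_left (F : R -> R) (l : R) :
  (forall e : R, 0 < e -> exists2 d : R, 0 < d & forall t, 0 < t < d -> `|F (- t) - l| <= e) ->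
  lim (F t @[t --> (0 : R)^'-]) = l.
Proof.
move=> h; apply/cvg_lim => //; apply/cvgrPdist_le => e /h[d d0 hd].
near=> t; rewrite distrC -[t]opprK; apply: hd; rewrite oppr_gt0 ltrNl; apply/andP; split; near: t.
  exact: nbhs_left_lt.
by apply: nbhs_left_gt; rewrite oppr_lt0.
Unshelve. all: by end_near. Qed.

Variables (m : nat) (c : graph_chart R m.+1) (w : 'rV[R]_m.+1 -> R) (x nu : 'rV[R]_m.+1).
Hypothesis hx : height c x = 0.
Variable C : 'rV[R]_m.+1.
Hypotheses (hg : has_grad (height c) x C) (Cnu : 0 < dotp nu C) (nu1 : enorm nu = 1).

Lemma nu_norm_le1 : `|nu| <= 1.
Proof.
have := norm_sqr_le_dotp nu; rewrite -enorm_sqr nu1 expr1n.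
by rewrite -[leRHS](expr1n _ 2) ler_pXn2r ?nnegrE.
Qed.

Lemma height_ray : exists2 d : R, 0 < d & forall t : R, 0 < t < d ->
  0 < height c (x + t *: nu) /\ height c (x + (- t) *: nu) < 0.
Proof.
have nn := nu_norm_le1.
have e0 : 0 < dotp nu C / 2 by rewrite divr_gt0.
have /near_ballP[d d0 hd] := (has_gradP _ _ _).1 hg _ e0.
exists d => // t /andP[t0 td].
have key (s : R) : `|s| = t ->
    `|height c (x + s *: nu) - s * dotp nu C| <= dotp nu C / 2 * t.
  move=> st; have sx : x + s *: nu - x = s *: nu by rewrite addrC addKr.
  have sn : `|s *: nu| <= t by rewrite normrZ st ler_piMr // ltW.
  have := hd (x + s *: nu); rewrite sx hx subr0 dotpZl => /(_ (le_lt_trans sn td)) h.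
  by apply: (le_trans h); rewrite ler_wpM2l // ltW.
have a0 : 0 < dotp nu C * t by rewrite mulr_gt0.
split.
  have := key t (gtr0_norm t0); rewrite ler_norml => /andP[h _].
  by move: h a0; lra.
have := key (- t); rewrite normrN (gtr0_norm t0) => /(_ erefl); rewrite ler_norml => /andP[_ h].
by move: h a0; lra.
Qed.

Lemma ray_quotient g (e r s : R) : s != 0 -> `|s| < r ->
  (forall q, `|q - x| < r -> `|q - x| <= `|s| -> q = x + s *: nu ->
    `|w q - w x - dotp (q - x) g| <= e * `|q - x|) -> 0 < e ->
  `|s^-1 * (w (x + s *: nu) - w x) - dotp g nu| <= e.
Proof.
move=> s0 sr h e0; have sx : x + s *: nu - x = s *: nu by rewrite addrC addKr.
have sn : `|s *: nu| <= `|s| by rewrite normrZ ler_piMr // nu_norm_le1.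
have := h (x + s *: nu); rewrite sx dotpZl => /(_ (le_lt_trans sn sr) sn erefl) h1.
have -> : s^-1 * (w (x + s *: nu) - w x) - dotp g nu =
    s^-1 * (w (x + s *: nu) - w x - s * dotp nu g).
  by rewrite [in RHS]mulrBr mulKf // dotpC.
have sp : 0 < `|s| by rewrite normr_gt0.
rewrite normrM normfV ler_pdivrMl //; apply: (le_trans h1).
by rewrite [leRHS]mulrC ler_wpM2l // ltW.
Qed.

Lemma deriv_plus_upper g : upper_expansion c w x g -> deriv_plus w x nu = dotp g nu.
Proof.
move=> ug; apply: lim_right => e e0; have [d0 d00 hd0] := height_ray.
have [r r0 hr] := ug e e0.
exists (Num.min d0 r); first by rewrite lt_min d00 r0.
move=> t; rewrite lt_min => /and3P[t0 td tr].
have [hp _] := hd0 t (introT andP (conj t0 td)).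
have tn : `|t| < r by rewrite gtr0_norm.
apply: (@ray_quotient g e r t) => //; first by rewrite gt_eqF.
move=> q qr _ qE; apply: hr => //; rewrite ?subrr ?normr0 ?hx //.
by rewrite qE ltW.
Qed.

Lemma deriv_minus_lower g : lower_expansion c w x g -> deriv_minus w x nu = dotp g nu.
Proof.
move=> ug; apply: lim_left => e e0; have [d0 d00 hd0] := height_ray.
have [r r0 hr] := ug e e0.
exists (Num.min d0 r); first by rewrite lt_min d00 r0.
move=> t; rewrite lt_min => /and3P[t0 td tr].
have [_ hp] := hd0 t (introT andP (conj t0 td)).
have tn : `|- t| < r by rewrite normrN gtr0_norm.
apply: (@ray_quotient g e r (- t)) => //; first by rewrite oppr_eq0 gt_eqF.
move=> q qr _ qE; apply: hr => //; rewrite ?subrr ?normr0 ?hx //.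
by rewrite qE ltW.
Qed.

End OneSidedDerivatives.

(** * From sign conditions to the boundary of the cone *)

Section Conclusion.
Variables (R : realType) (m : nat).

Lemma Ck_sub k n (D D' : set 'rV[R]_n) f : D' `<=` D -> Ck k D f -> Ck k D' f.
Proof.
move=> DD; elim: k f => [|k IH] f /=; first by move=> h x /DD; exact: h.
by case=> fd fp; split=> [x /DD|i]; [exact: fd|exact: IH].
Qed.

Lemma open_eball n (a : 'rV[R]_n) (r : R) : open (eball a r).
Proof.
have [r0|r0] := lerP r 0.
  rewrite (_ : eball a r = set0); first exact: open0.
  apply/seteqP; split => // y; rewrite /eball /= => h.
  by have := sqrtr_ge0 (dotp (y - a) (y - a)); rewrite leNgt (lt_le_trans h r0).
rewrite (_ : eball a r = (fun y => dotp (y - a) (y - a)) @^-1` [set t | t < r ^+ 2]).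
  apply: open_comp; last exact: open_lt.
  by move=> y _; exact: has_grad_continuous (has_grad_sqdist a y).
apply/seteqP; split => y; rewrite /eball /= -enorm_sqr ltr_pXn2r //;
  by rewrite nnegrE ?sqrtr_ge0 // ltW.
Qed.

(** Weak inequalities place the eigenvalues in the closure of the cone; lying outside the cone keeps
    them out of its interior. *)
Lemma boundary_Gamma (M : 'M[R]_m) k : splits (char_poly M) -> (k <= m)%N ->
  (forall j, (j <= k)%N -> 0 <= mxsigma j M) -> ~ (forall j, (j <= k)%N -> 0 < mxsigma j M) ->
  boundary (@Gamma R m k) (eigvals M).
Proof.
move=> Ms km ge0 ngt0; split.
  apply: closure_Gamma => // j jk; rewrite sigma_eigvals //; first exact: ge0.
  exact: leq_trans jk km.
move=> /interior_subset G; apply: ngt0 => j jk.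
case: j jk => [|j] jk; first by rewrite mxsigma0.
by rewrite -sigma_eigvals //; [exact: G|exact: leq_trans jk km].
Qed.

End Conclusion.

Section SymmetricClosure.
Variables (R : comNzRingType) (n : nat).
Implicit Types A B : 'M[R]_n.

Lemma symB A B : A^T = A -> B^T = B -> (A - B)^T = A - B.
Proof. by move=> hA hB; rewrite linearB /= hA hB. Qed.

Lemma symZ (a : R) A : A^T = A -> (a *: A)^T = a *: A.
Proof. by move=> hA; rewrite linearZ /= hA. Qed.

Lemma sym_congr A B : A^T = A -> (B *m A *m B^T)^T = B *m A *m B^T.
Proof. by move=> hA; rewrite !trmx_mul trmxK hA mulmxA. Qed.

End SymmetricClosure.

Section SideBoundary.
Variables (R : realType) (m : nat) (c : graph_chart R m.+1).

Local Notation F := (gc_frame c).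
Local Notation phi := (gc_fun c).
Local Notation dir := (gc_dir c).
Local Notation Y := (gc_coord c).
Local Notation psi := (gc_param c).

Lemma side_boundary (D : set 'rV[R]_m) (w : 'rV[R]_m.+1 -> R) (U Omega A1 A2 : set 'rV[R]_m.+1)
    (x nu : 'rV[R]_m.+1) (r : R) (G1 G2 : 'rV[R]_m.+1 -> 'rV[R]_m.+1) k :
  F *m F^T = 1%:M -> F *m dir^T = 0 -> enorm dir = 1 ->
  open D -> Ck 2 D phi -> Ck 2 D (w \o psi) ->
  open U -> (forall p, U p -> D (Y p)) ->
  (forall V : set 'rV[R]_m.+1, open V -> V `<=` U ->
    (exists2 p, V p & height c p = 0) -> ~ Ck 1 V w) ->
  U x -> 0 < r -> height c x = 0 ->
  upper_side c x r A1 -> upper_side (flip c) x r A2 ->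
  side_field w A1 G1 -> side_field w A2 G2 ->
  (0 < k)%N -> (k <= m.+1)%N -> open Omega -> U `<=` Omega ->
  (forall p, Omega p -> {for p, continuous w}) -> (forall p, Omega p -> 0 < w p) ->
  viscosity_supersolution k Omega w -> viscosity_subsolution k Omega w ->
  enorm nu = 1 -> (forall a, dotp nu (partial a psi (Y x)) = 0) ->
  boundary (@Gamma R m k.-1) (eigvals (invmx (metric psi (Y x)) *m
    Tmx psi nu (w \o psi) (dotp (G1 x) nu) (Y x))).
Proof.
move=> FF Fdir dd oD phi2 f2 oU UD nonC1 Ux r0 hx s1 s2 sf1 sf2 k0 km oO UO wO wpos.
move=> wsup wsub nu1 nuJ.
have wU p : U p -> {for p, continuous w} by move=> /UO; exact: wO.
have Dx := UD x Ux.
have xr : `|x - x| < r by rewrite subrr normr0.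
have hx0 : 0 <= height c x by rewrite hx.
have u := upper_expansion_near Fdir dd phi2 oU UD wU s1 sf1 Ux xr hx0.
have gE := trace_grad FF Fdir dd phi2 Dx hx (or_introl u).
have [ge0 ngt0] := upper_block_boundary FF Fdir dd oD phi2 f2 oU UD wU nonC1 Ux r0 hx
  s1 s2 sf1 sf2 k0 km oO UO wO wpos wsup wsub.
set T := tangent_block _ _ _ _ _ _ _ in ge0 ngt0.
(* [invmx (metric psi (Y x)) *m Tmx] is in general not symmetric, but [eigvals] and [mxsigma] see
   only its characteristic polynomial, which is that of the symmetric block [T]. *)
have cE : char_poly (invmx (metric psi (Y x)) *m
    Tmx psi nu (w \o psi) (dotp (G1 x) nu) (Y x)) = char_poly T.
  rewrite (Tmx_param FF Fdir dd oD phi2 Dx gE nu1 nuJ).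
  rewrite (metric_param phi2 Dx) (char_poly_pencil _ (orthonormalizerP FF Fdir dd (Y x))).
  by rewrite /T /tangent_block scale0r subr0 /= (param_coord0 FF Fdir dd hx).
have Tsym : T^T = T.
  apply: sym_congr; apply: symB; last apply: symZ.
    by apply: symZ; rewrite trmx_mul trmxK.
  apply: symB; last by apply: symZ; rewrite trmx_mul trmxK.
  apply: symB; first exact: (hess_sym oD Dx f2).
  by apply: symZ; exact: (hess_sym oD Dx phi2).
have kE j : (j <= k.-1)%N = (j < k)%N by rewrite -ltnS prednK.
apply: boundary_Gamma.
- by rewrite cE; exact: sym_char_poly_splits.
- by rewrite -ltnS prednK.
- by move=> j; rewrite kE /mxsigma cE; exact: ge0.
- by move=> h; apply: ngt0 => j jk; have := h j; rewrite kE /mxsigma cE; apply.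
Qed.

End SideBoundary.

(** By [normal_decomp] a vector orthogonal to the tangent rows is a multiple of the conormal. The
    sign of the product tells whether [nu] points up or down in the chart. *)
Lemma normal_transversal (R : realType) m (c : graph_chart R m.+1) (y : 'rV[R]_m) nu :
  gc_frame c *m (gc_frame c)^T = 1%:M -> gc_frame c *m (gc_dir c)^T = 0 ->
  enorm (gc_dir c) = 1 -> enorm nu = 1 -> nu *m (tangent c y)^T = 0 ->
  dotp nu (conormal c y) != 0.
Proof.
move=> FF Fdir dd nu1 nuJ; apply/eqP => h.
have nuE := normal_decomp FF Fdir dd y nu; rewrite nuJ mul0mx add0r in nuE.
have : dotp nu nu = 0 by rewrite {2}nuE dotpZr h mulr0.
by move/eqP; rewrite -enorm_sqr nu1 expr1n oner_eq0.
Qed.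

Theorem theorem1p2 (R : realType) (n k : nat) (Omega : set 'rV[R]_n)
    (x0 : 'rV[R]_n) (eps : R) (w : 'rV[R]_n -> R)
    (Sigma Bp Bm : set 'rV[R]_n)
    (hn : (3 <= n)%N) (hk : (2 <= k <= n)%N)
    (Omega_open : open Omega) (Omega_connected : connected Omega)
    (eps_gt0 : 0 < eps) (B_Omega : closure (eball x0 eps) `<=` Omega)
    (w_sol : viscosity_solution k Omega w)
    (w_sing : singular_hypersurface w (eball x0 eps) Sigma Bp Bm) :
  forall (x nu : 'rV[R]_n) (c : graph_chart R n),
    (Sigma `&` eball x0 eps) x ->
    is_graph_chart Sigma c -> gc_dom c x ->
    inward_unit_normal (gc_param c) Bp (gc_coord c x) nu ->
    forall alpha : R,
      alpha = deriv_plus w x nu \/ alpha = deriv_minus w x nu ->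
      boundary (@Gamma R n.-1 k.-1)
        (eigvals (invmx (metric (gc_param c) (gc_coord c x)) *m
                  Tmx (gc_param c) nu (w \o gc_param c) alpha (gc_coord c x))).
Proof.
case: n Omega x0 w Sigma Bp Bm hn hk Omega_open Omega_connected B_Omega w_sol w_sing
  => [//|m] Omega x0 w Sigma Bp Bm hn hk oO _ BO w_sol w_sing x nu c [Sx Bx] chart domx
  [nu1 nuJ _] alpha.
case: w_sol => wO wpos wsup wsub.
case: w_sing => _ [cover _ BpBm0 [oBp oBm] _] [_ [C1p C1m] _ nonC1] C2f.
have f2 := C2f c chart; set B := eball x0 eps in Bx BO cover nonC1 f2 *.
case: (chart) => -[FF Fdir dd] [odom obase] dombase sm graph.
have oB : open B by exact: open_eball.
set D := [set y | _] in f2.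
have phi2base : Ck 2 (gc_base c) (gc_fun c) := sm 2%N.
have oD : open D.
  rewrite openE => y [by_ py].
  have pc : {for y, continuous (gc_param c)}.
    apply: continuousD; first exact: mulmxr_continuous.
    apply: (@continuous_comp _ _ _ (gc_fun c) (fun t : R => t *: gc_dir c)).
      exact: has_grad_continuous (C2_has_grad phi2base by_).
    exact: scalel_continuous.
  have n1 : \forall z \near y, gc_base c z by exact: open_nbhs_nbhs.
  have n2 : \forall z \near y, (gc_dom c `&` B) (gc_param c z).
    by apply: pc; apply: open_nbhs_nbhs; split => //; exact: openI.
  exact: filterI n1 n2.
have phi2 : Ck 2 D (gc_fun c) by apply: Ck_sub phi2base => y [].
have hx : height c x = 0.
  by rewrite /height; have := (graph x domx).1 Sx => ->; rewrite subrr.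
have Dx : D (gc_coord c x).
  split; first exact: dombase.
  by rewrite (param_coord0 FF Fdir dd hx).
(* Points whose foot on the graph is also in the chart and in the ball, where the trace of [w] is
   known to be C^2. *)
pose U := (gc_dom c `&` B) `&` [set p | D (gc_coord c p)].
have oU : open U by apply: openI; [exact: openI|exact: open_coord_preimage].
have UD p : U p -> D (gc_coord c p) by case.
have UO : U `<=` Omega by move=> p [[_ Bp_]] _; apply: BO; exact: subset_closure.
have Ux : U x by [].
have wU p : U p -> {for p, continuous w} by move=> /UO; exact: wO.
have onSigma p : U p -> height c p = 0 -> Sigma p.
  by move=> [[dp _] _] hp; apply/(graph p dp)/eqP; rewrite -subr_eq0; apply/eqP.
have nC1 V : open V -> V `<=` U -> (exists2 p, V p & height c p = 0) -> ~ Ck 1 V w.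
  move=> oV VU [p Vp hp]; apply: nonC1 => //; first by move=> q /VU[[]].
  by exists p; split => //; apply: onSigma => //; exact: VU.
have coverU p : U p -> height c p != 0 -> Bp p \/ Bm p.
  move=> Up hp; have : (B `\` Sigma) p.
    case: (Up) => -[dp Bp_] _; split => // /(graph p dp) e.
    by move: hp; rewrite /height e subrr eqxx.
  by rewrite cover.
have [Gp fp] := C1_closure_side_field C1p; have [Gm fm] := C1_closure_side_field C1m.
have Fdir' := flip_frame_dir Fdir; have dd' := flip_enorm dd.
have phi2' := flip_C2 oD phi2.
(* A chart does not prescribe which of [Bp] and [Bm] lies above it; this is determined for [c] and
   for [flip c] separately. *)
have side c' : gc_frame c' *m (gc_dir c')^T = 0 -> enorm (gc_dir c') = 1 ->
    Ck 2 D (gc_fun c') -> (forall p, U p -> D (gc_coord c' p)) ->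
    (forall p, U p -> height c' p != 0 -> Bp p \/ Bm p) -> height c' x = 0 ->
    exists r A G, [/\ 0 < r, upper_side c' x r A & side_field w A G].
  move=> h1 h2 h3 h4 h5 h6; have h7 : 0 <= height c' x by rewrite h6.
  have [r r0 [s|s]] := upper_side_dichotomy h1 h2 h3 oU h4 oBp oBm BpBm0 h5 Ux h7.
    by exists r, Bp, Gp.
  by exists r, Bm, Gm.
have hxf : height (flip c) x = 0 by rewrite flip_height hx oppr0.
have [r1 [A1 [G1 [r10 s1 sf1]]]] := side c Fdir dd phi2 UD coverU hx.
have coverUf p : U p -> height (flip c) p != 0 -> Bp p \/ Bm p.
  by rewrite flip_height oppr_eq0; exact: coverU.
have [r2 [A2 [G2 [r20 s2 sf2]]]] := side (flip c) Fdir' dd' phi2' UD coverUf hxf.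
have shrink c' r r' A : r <= r' -> upper_side c' x r' A -> upper_side c' x r A.
  by move=> rr h p px; apply: h; exact: lt_le_trans px rr.
pose r := Num.min r1 r2; have r0 : 0 < r by rewrite lt_min r10 r20.
have {}s1 : upper_side c x r A1 by apply: shrink s1; rewrite ge_min lexx.
have {}s2 : upper_side (flip c) x r A2 by apply: shrink s2; rewrite ge_min lexx orbT.
have k0 : (0 < k)%N by case/andP: hk => h _; exact: leq_trans h.
have km : (k <= m.+1)%N by case/andP: hk.
have b1 : boundary (@Gamma R m k.-1) (eigvals (invmx (metric (gc_param c) (gc_coord c x)) *m
    Tmx (gc_param c) nu (w \o gc_param c) (dotp (G1 x) nu) (gc_coord c x))).
  exact: (side_boundary FF Fdir dd oD phi2 f2 oU UD nC1 Ux r0 hx s1 s2 sf1 sf2 k0 km oO UO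
    wO wpos wsup wsub nu1 nuJ).
(* The lower side is the upper side of [flip c], and flipping twice restores the heights, so the
   roles of [A1] and [A2] are exchanged. *)
have b2 : boundary (@Gamma R m k.-1) (eigvals (invmx (metric (gc_param c) (gc_coord c x)) *m
    Tmx (gc_param c) nu (w \o gc_param c) (dotp (G2 x) nu) (gc_coord c x))).
  have s1' : upper_side (flip (flip c)) x r A1.
    by move=> p px; rewrite !flip_height opprK; exact: s1.
  have nC1' V : open V -> V `<=` U -> (exists2 p, V p & height (flip c) p = 0) -> ~ Ck 1 V w.
    move=> oV VU [p Vp /eqP]; rewrite flip_height oppr_eq0 => /eqP hp.
    by apply: nC1 => //; exists p.
  have f2' : Ck 2 D (w \o gc_param (flip c)) by rewrite flip_param.
  have nuJ' a : dotp nu (partial a (gc_param (flip c)) (gc_coord (flip c) x)) = 0.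
    by rewrite flip_param; exact: nuJ.
  have := side_boundary (c := flip c) FF Fdir' dd' oD phi2' f2' oU UD nC1' Ux r0 hxf s2 s1'
    sf2 sf1 k0 km oO UO wO wpos wsup wsub nu1 nuJ'.
  by rewrite flip_param.
move=> halpha; suff h : alpha = dotp (G1 x) nu \/ alpha = dotp (G2 x) nu.
  by case: h => ->; [exact: b1|exact: b2].
move: halpha.
have xr : `|x - x| < r by rewrite subrr normr0.
have hx0 : 0 <= height c x by rewrite hx.
have hxf0 : 0 <= height (flip c) x by rewrite hxf.
have u1 := upper_expansion_near Fdir dd phi2 oU UD wU s1 sf1 Ux xr hx0.
have u2 := upper_expansion_near Fdir' dd' phi2' oU UD wU s2 sf2 Ux xr hxf0.
have hg := has_grad_height phi2 Dx.
have nuJ0 : nu *m (tangent c (gc_coord c x))^T = 0.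
  apply/rowP => a; rewrite !mxE -[RHS](nuJ a) (partial_param phi2) //.
  by apply: eq_bigr => j _; rewrite !mxE.
have th0 := normal_transversal FF Fdir dd nu1 nuJ0.
(* If [nu] points downwards in [c] it points upwards in [flip c]; then [deriv_plus] belongs to [G2]
   and [deriv_minus] to [G1]. *)
have [th|th|/eqP] := ltgtP 0 (dotp nu (conormal c (gc_coord c x))); last by rewrite eq_sym (negPf th0).
  have l2 := lower_expansion_flip u2.
  by case=> ->; [left; exact: (deriv_plus_upper hx hg th nu1 u1)|
                 right; exact: (deriv_minus_lower hx hg th nu1 l2)].
have hgf : has_grad (height (flip c)) x (- conormal c (gc_coord c x)).
  by apply: has_grad_near (has_gradN hg); apply: filterE => p; rewrite flip_height.
have l1 : lower_expansion (flip c) w x (G1 x).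
  move=> e /u1[d d0 hd]; exists d => // p q px qx; rewrite !flip_height !oppr_le0.
  exact: hd.
have thf : 0 < dotp nu (- conormal c (gc_coord c x)) by rewrite dotpNr oppr_gt0.
by case=> ->; [right; exact: (deriv_plus_upper hxf hgf thf nu1 u2)|
               left; exact: (deriv_minus_lower hxf hgf thf nu1 l1)].
Qed.
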